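(* Let $T:\Sigma\to\Sigma$ be a topologically mixing two-sided subshift of finite type with $h_{top}(T)>0$, and let $\mathcal{A}\in\mathcal{W}$ be a typical cocycle. Let $L=\{\alpha\in\mathbb{R}:\ \exists x\in\Sigma \text{ with } \lim_{n\to\infty}\frac1n\log\|\mathcal{A}^n(x)\|=\alpha\}$ and, for $\alpha\in\mathbb{R}$, $E(\alpha)=\{x\in\Sigma:\ \lim_{n\to\infty}\frac1n\log\|\mathcal{A}^n(x)\|=\alpha\}$. Then $$L=\overline{\{\alpha\in\mathbb{R}:\ h_{top}(E(\alpha))>0\}}.$$ Furthermore, $\alpha\mapsto h_{top}(E(\alpha))$ is concave on the interior $\mathring{L}$ of $L$.
   Context: Subshift: for a $0$-$1$ matrix $Q$, $\Sigma=\{(x_i)_{i\in\mathbb{Z}}: Q_{x_i,x_{i+1}}=1\ \forall i\}$ with left shift $T$. Fix $\omega\in(0,1)$ and the metric $d(x,y)=\omega^{m}$, where $m$ is the largest integer with $x_i=y_i$ for all $|i|<m$. $W^s_{loc}(x)=\{y:y_n=x_n\ \forall n\ge0\}$, $W^u_{loc}(x)=\{y:y_n=x_n\ \forall n<0\}$; $W^s(x)=\{y: T^ny\in W^s_{loc}(T^nx)\text{ for some }n\ge0\}$, $W^u(x)=\{y:T^ny\in W^u_{loc}(T^nx)\text{ for some }n\le0\}$. Cocycles: for $\mathcal{A}:\Sigma\to GL(k,\mathbb{R})$, $\mathcal{A}^n(x)=\mathcal{A}(T^{n-1}x)\cdots\mathcal{A}(x)$ and $\mathcal{A}^{-n}(x)=\mathcal{A}(T^{-n}x)^{-1}\cdots\mathcal{A}(T^{-1}x)^{-1}$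 for $n\ge1$; $\|\cdot\|$ is the Euclidean operator norm. Fix $r>0$. $H^r_b(\Sigma,GL(k,\mathbb{R}))$ is the set of $r$-Hölder maps $\mathcal{A}:\Sigma\to GL(k,\mathbb{R})$ that are fiber bunched: $\|\mathcal{A}(x)\|\,\|\mathcal{A}(x)^{-1}\|\,\omega^r<1$ for all $x$. For such $\mathcal{A}$ the canonical holonomies $H^s_{y\leftarrow x}=\lim_{n\to\infty}\mathcal{A}^n(y)^{-1}\mathcal{A}^n(x)$ ($y\in W^s_{loc}(x)$) and $H^u_{y\leftarrow x}=\lim_{n\to-\infty}\mathcal{A}^n(y)^{-1}\mathcal{A}^n(x)$ ($y\in W^u_{loc}(x)$) exist; they extend to $y\in W^{s}(x)$ (resp. $W^u(x)$) by $H^{s/u}_{y\leftarrow x}=\mathcal{A}^n(y)^{-1}H^{s/u}_{T^ny\leftarrow T^nx}\mathcal{A}^n(x)$ with $n$ (resp. $-n$) large. Typical cocycles: $\mathcal{A}\in H^r_b(\Sigma,GL(k,\mathbb{R}))$ is 1-typical if there are a periodic point $p$ and a homoclinic point $z\in W^s(p)\cap W^u(p)$, $z\ne p$, such that (i) the eigenvalues of $P:=\mathcal{A}^{per(p)}(p)$ have multiplicity 1 and distinct absolute values, with eigenvectors $v_1,\dots,v_k$; (ii) with $\psi:=H^s_{p\leftarrow z}\circ H^u_{z\leftarrow p}$, for all $1\le i,j\le k$, $\psi(v_i)$ is not in the hyperplane spanned by all the $v_l$ with $l\ne j$. A 1-typical $\mathcal{A}$ is $t$-typical ($2\le t\le k-1$)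 if, for the same $p,z$: (I) all products of $t$ distinct eigenvalues of $P$ are distinct; (II) the induced map $\psi^{\wedge t}$ on $\wedge^t\mathbb{R}^k$ satisfies the analogue of (ii) with respect to the eigenvectors $\{v_{i_1}\wedge\dots\wedge v_{i_t}\}_{i_1<\dots<i_t}$ of $P^{\wedge t}$. $\mathcal{A}$ is typical if it is $t$-typical for all $1\le t\le k-1$ (same $p,z$); $\mathcal{W}\subset H^r_b(\Sigma,GL(k,\mathbb{R}))$ is the set of typical maps. Topological entropy of a subset $Y\subset\Sigma$ (Bowen): let $d_n(x,y)=\max_{0\le j<n}d(T^jx,T^jy)$, $B_n(x,\epsilon)$ the open $d_n$-ball. $S(Y,s,N,\epsilon)=\inf\sum_ie^{-sn_i}$ over countable covers of $Y$ by balls $B_{n_i}(x_i,\epsilon)$ with all $n_i\ge N$; $S(Y,s,\epsilon)=\lim_{N\to\infty}S(Y,s,N,\epsilon)$; $h_{top}(T,Y,\epsilon)$ is the critical $s$ at which $S(Y,s,\epsilon)$ jumps from $\infty$ to $0$; $h_{top}(Y)=\lim_{\epsilon\to0}h_{top}(T,Y,\epsilon)$, and $h_{top}(T)=h_{top}(\Sigma)$. *)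

(* Defs.v *)
From HB Require Import structures.
From mathcomp Require Import all_boot all_order all_algebra.
From mathcomp Require Import all_classical all_reals all_analysis.

Set Implicit Arguments.
Unset Strict Implicit.
Unset Printing Implicit Defensive.

Import Order.TTheory GRing.Theory Num.Theory.
Import numFieldNormedType.Exports.

Local Open Scope classical_set_scope.
Local Open Scope ring_scope.

Definition biseq (q : nat) : Type := int -> 'I_q.

Definition subshift (q : nat) (Q : 'M[bool]_q) : set (biseq q) :=
  [set x | forall i : int, Q (x i) (x (i + 1))].

(* [shift n] is the n-th iterate [T^n] of the left shift, for every integer [n]. *)
Definition shift (q : nat) (n : int) (x : biseq q) : biseq q :=
  fun i => x (i + n).

Lemma shift_iter (q : nat) (n : nat) (x : biseq q) :
  shift n%:Z x = iter n (shift 1) x.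
Proof.
apply: funext => i; elim: n i => [|n IHn] i; first by rewrite /shift addr0.
by rewrite iterS /shift -/(shift 1) -IHn /shift -addrA -intS.
Qed.

Lemma shiftN (q : nat) (n : int) : cancel (@shift q n) (shift (- n)).
Proof. by move=> x; apply: funext => i; rewrite /shift subrK. Qed.

Definition agree (q : nat) (x y : biseq q) (m : nat) : Prop :=
  forall i : int, (`|i| < m)%N -> x i = y i.

(* [omega ^+ m] for the largest [m] such that [x] and [y] agree on [`|i| < m];
   no largest [m] exists precisely when [x = y], and then the distance is 0. *)
Definition sdist (R : realType) (q : nat) (omega : R) (x y : biseq q) : R :=
  if `[< x = y >] then 0 else
  omega ^+ xget 0%N
    [set m | agree x y m /\ forall m', agree x y m' -> (m' <= m)%N].

Definition sopen (R : realType) (q : nat) (Q : 'M[bool]_q) (omega : R)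
    (U : set (biseq q)) : Prop :=
  U `<=` subshift Q /\
  forall x, U x -> exists2 e : R, 0 < e &
    forall y, subshift Q y -> sdist omega x y < e -> U y.

Definition top_mixing (R : realType) (q : nat) (Q : 'M[bool]_q) (omega : R) :
    Prop :=
  forall U V : set (biseq q),
    sopen Q omega U -> sopen Q omega V -> U !=set0 -> V !=set0 ->
    exists N : nat, forall n : nat, (N <= n)%N ->
      (shift n%:Z @` U) `&` V !=set0.

Definition Wsloc (q : nat) (x : biseq q) : set (biseq q) :=
  [set y | forall n : int, 0 <= n -> y n = x n].

Definition Wuloc (q : nat) (x : biseq q) : set (biseq q) :=
  [set y | forall n : int, n < 0 -> y n = x n].

Definition Ws (q : nat) (x : biseq q) : set (biseq q) :=
  [set y | exists n : nat, Wsloc (shift n%:Z x) (shift n%:Z y)].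

Definition Wu (q : nat) (x : biseq q) : set (biseq q) :=
  [set y | exists n : nat, Wuloc (shift (- n%:Z) x) (shift (- n%:Z) y)].

Definition least_period (q : nat) (p : biseq q) (n : nat) : Prop :=
  [/\ (0 < n)%N, shift n%:Z p = p &
      forall m : nat, (0 < m)%N -> shift m%:Z p = p -> (n <= m)%N].

Definition bowen_dist (R : realType) (q : nat) (omega : R) (n : nat)
    (x y : biseq q) : R :=
  \big[Num.max/0]_(j < n) sdist omega (shift j%:Z x) (shift j%:Z y).

Definition bowen_ball (R : realType) (q : nat) (Q : 'M[bool]_q) (omega : R)
    (n : nat) (x : biseq q) (eps : R) : set (biseq q) :=
  [set y | subshift Q y /\ bowen_dist omega n x y < eps].

(* The countable family of balls is indexed by an arbitrary set [I] of naturals,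
   so that finite and empty families are allowed. *)
Definition bowen_cover (R : realType) (q : nat) (Q : 'M[bool]_q) (omega : R)
    (Y : set (biseq q)) (N : nat) (eps : R)
    (I : set nat) (x : nat -> biseq q) (n : nat -> nat) : Prop :=
  (forall i, I i -> subshift Q (x i) /\ (N <= n i)%N) /\
  Y `<=` \bigcup_(i in I) bowen_ball Q omega (n i) (x i) eps.

Definition bowen_sum_N (R : realType) (q : nat) (Q : 'M[bool]_q) (omega : R)
    (Y : set (biseq q)) (s eps : R) (N : nat) : \bar R :=
  ereal_inf [set a | exists (I : set nat) (x : nat -> biseq q) (n : nat -> nat),
    bowen_cover Q omega Y N eps I x n /\
    a = \esum_(i in I) (expR (- s * (n i)%:R))%:E].

Definition bowen_sum (R : realType) (q : nat) (Q : 'M[bool]_q) (omega : R)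
    (Y : set (biseq q)) (s eps : R) : \bar R :=
  lim (bowen_sum_N Q omega Y s eps N @[N --> \oo]).

(* For nonempty [Y] the sum vanishes for no [s <= 0], so restricting the critical
   exponent to [0 <= s] only fixes the convention that the empty set has
   entropy 0. *)
Definition htop_eps (R : realType) (q : nat) (Q : 'M[bool]_q) (omega : R)
    (Y : set (biseq q)) (eps : R) : \bar R :=
  ereal_inf [set s%:E | s in [set s : R | 0 <= s /\
    bowen_sum Q omega Y s eps = 0%E]].

Definition htop (R : realType) (q : nat) (Q : 'M[bool]_q) (omega : R)
    (Y : set (biseq q)) : \bar R :=
  lim (htop_eps Q omega Y eps @[eps --> 0^'+]).

Definition enorm (R : realType) (k : nat) (v : 'cV[R]_k) : R :=
  Num.sqrt (\sum_i v i 0 ^+ 2).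

Definition opnorm (R : realType) (k : nat) (M : 'M[R]_k) : R :=
  sup [set enorm (M *m v) | v in [set v : 'cV[R]_k | enorm v <= 1]].

Fixpoint cocycle_pos (R : realType) (q k : nat) (A : biseq q -> 'M[R]_k)
    (n : nat) (x : biseq q) : 'M[R]_k :=
  if n is m.+1 then A (shift m%:Z x) *m cocycle_pos A m x else 1%:M.

Fixpoint cocycle_neg (R : realType) (q k : nat) (A : biseq q -> 'M[R]_k)
    (n : nat) (x : biseq q) : 'M[R]_k :=
  if n is m.+1 then invmx (A (shift (- n%:Z) x)) *m cocycle_neg A m x
  else 1%:M.

(* [A^n(x)] for an integer [n]; recall that [Negz m] is [- m.+1]. *)
Definition cocycle (R : realType) (q k : nat) (A : biseq q -> 'M[R]_k)
    (n : int) (x : biseq q) : 'M[R]_k :=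
  match n with
  | Posz m => cocycle_pos A m x
  | Negz m => cocycle_neg A m.+1 x
  end.

Definition holder (R : realType) (q k : nat) (Q : 'M[bool]_q) (omega r : R)
    (A : biseq q -> 'M[R]_k) : Prop :=
  exists C : R, forall x y, subshift Q x -> subshift Q y ->
    opnorm (A x - A y) <= C * sdist omega x y `^ r.

Definition fiber_bunched (R : realType) (q k : nat) (Q : 'M[bool]_q)
    (omega r : R) (A : biseq q -> 'M[R]_k) : Prop :=
  forall x, subshift Q x -> opnorm (A x) * opnorm (invmx (A x)) * omega `^ r < 1.

(* A map [Sigma -> GL(k, R)] is a matrix-valued function whose values at the points
   of the subshift are invertible; its values elsewhere are never used. *)
Definition Hb (R : realType) (q k : nat) (Q : 'M[bool]_q) (omega r : R) :
    set (biseq q -> 'M[R]_k) :=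
  [set A | [/\ forall x, subshift Q x -> A x \in unitmx,
               holder Q omega r A & fiber_bunched Q omega r A]].

(* [Hs_loc A y x], [Hu_loc A y x], [Hs A y x] and [Hu A y x] are holonomies from
   [x] to [y]. *)

Definition Hs_loc (R : realType) (q k : nat) (A : biseq q -> 'M[R]_k)
    (y x : biseq q) : 'M[R]_k :=
  lim (invmx (cocycle A n%:Z y) *m cocycle A n%:Z x @[n --> \oo]).

Definition Hu_loc (R : realType) (q k : nat) (A : biseq q -> 'M[R]_k)
    (y x : biseq q) : 'M[R]_k :=
  lim (invmx (cocycle A (- n%:Z) y) *m cocycle A (- n%:Z) x @[n --> \oo]).

(* Any time [n] at which the shifted points lie on a common local leaf may be
   used: the result does not depend on it. *)
Definition Hs (R : realType) (q k : nat) (A : biseq q -> 'M[R]_k)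
    (y x : biseq q) : 'M[R]_k :=
  let n := (xget 0%N [set n : nat | Wsloc (shift n%:Z x) (shift n%:Z y)])%:Z in
  invmx (cocycle A n y) *m Hs_loc A (shift n y) (shift n x) *m cocycle A n x.

Definition Hu (R : realType) (q k : nat) (A : biseq q -> 'M[R]_k)
    (y x : biseq q) : 'M[R]_k :=
  let n := - (xget 0%N
    [set n : nat | Wuloc (shift (- n%:Z) x) (shift (- n%:Z) y)])%:Z in
  invmx (cocycle A n y) *m Hu_loc A (shift n y) (shift n x) *m cocycle A n x.

(* Strictly increasing multi-indices [i_1 < ... < i_t], and the exterior power
   of [R^k] in coordinates with respect to the basis
   [e_(i_1) /\ ... /\ e_(i_t)]. *)
Definition mindex (t k : nat) : finType :=
  {f : {ffun 'I_t -> 'I_k} |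
    [forall a : 'I_t, forall b : 'I_t, (a < b)%N ==> (f a < f b)%N]}.

Definition ext (R : realType) (t k : nat) : vectType R :=
  {ffun mindex t k -> R^o}.

Definition wedge (R : realType) (t k : nat) (w : 'I_t -> 'cV[R]_k) : ext R t k :=
  [ffun I : mindex t k => \det (\matrix_(a < t, b < t) w b (val I a) 0)].

(* The map induced on the exterior power: its matrix consists of the t x t minors. *)
Definition ext_map (R : realType) (t k : nat) (M : 'M[R]_k) (u : ext R t k) :
    ext R t k :=
  [ffun I : mindex t k =>
    \sum_(J : mindex t k) \det (mxsub (val I) (val J) M) * (u : {ffun _ -> _}) J].

(* [lam] lists all eigenvalues of [P] with multiplicity. Eigenvalues of pairwise
   distinct absolute values are real, as non-real eigenvalues of a real matrix come
   in conjugate pairs. *)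
Definition simple_eigen (R : realType) (k : nat) (P : 'M[R]_k)
    (lam : 'I_k -> R) (v : 'I_k -> 'cV[R]_k) : Prop :=
  [/\ char_poly P = \prod_(i < k) ('X - (lam i)%:P),
      injective (fun i => `|lam i|) &
      forall i, v i != 0 /\ P *m v i = lam i *: v i].

Definition one_typical_at (R : realType) (q k : nat) (Q : 'M[bool]_q)
    (A : biseq q -> 'M[R]_k) (p z : biseq q)
    (lam : 'I_k -> R) (v : 'I_k -> 'cV[R]_k) : Prop :=
  let psi := Hs A p z *m Hu A z p in
  [/\ [/\ subshift Q p, subshift Q z, z <> p, Ws p z & Wu p z],
      exists2 n : nat, least_period p n &
        simple_eigen (cocycle A n%:Z p) lam v &
      forall i j : 'I_k,
        psi *m v i \notin (\sum_(l < k | l != j) <[v l]>)%VS].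

Definition t_typical_at (R : realType) (q k : nat) (Q : 'M[bool]_q) (t : nat)
    (A : biseq q -> 'M[R]_k) (p z : biseq q)
    (lam : 'I_k -> R) (v : 'I_k -> 'cV[R]_k) : Prop :=
  let psi := Hs A p z *m Hu A z p in
  let vI (I : mindex t k) := wedge (fun a => v (val I a)) in
  one_typical_at Q A p z lam v /\
  ((2 <= t)%N ->
    injective (fun I : mindex t k => \prod_(a < t) lam (val I a)) /\
    forall I J : mindex t k,
      ext_map psi (vI I) \notin (\sum_(K : mindex t k | K != J) <[vI K]>)%VS).

Definition typical (R : realType) (q k : nat) (Q : 'M[bool]_q) (omega r : R) :
    set (biseq q -> 'M[R]_k) :=
  [set A | Hb Q omega r A /\
    exists (p z : biseq q) (lam : 'I_k -> R) (v : 'I_k -> 'cV[R]_k),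
      forall t : nat, (1 <= t <= k.-1)%N -> t_typical_at Q t A p z lam v].

Definition level_set (R : realType) (q k : nat) (Q : 'M[bool]_q)
    (A : biseq q -> 'M[R]_k) (alpha : R) : set (biseq q) :=
  [set x | subshift Q x /\
    (n%:R^-1 * ln (opnorm (cocycle A n%:Z x)) @[n --> \oo] --> alpha)].

Definition lyap_spectrum (R : realType) (q k : nat) (Q : 'M[bool]_q)
    (A : biseq q -> 'M[R]_k) : set R :=
  [set alpha | exists x, level_set Q A alpha x].

Definition concave_on (R : realType) (D : set R) (f : R -> \bar R) : Prop :=
  convex_set (D : set R^o) /\
  forall a b t : R, D a -> D b -> 0 <= t <= 1 ->
    (t%:E * f a + (1 - t)%:E * f b <= f (t * a + (1 - t) * b)%R)%E.

(* Main.v *)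
(* The conditions (i), (ii) on P and psi alone give quasi-multiplicativity: two orbit
   segments with matrices R, L can be joined, through the periodic point, the homoclinic
   point and the periodic point again, with transition matrix close to
   L P^a psi P^b R for any a, b < k. The eigenvalues of P being distinct, a Vandermonde
   argument isolates the terms of this expression in the eigenbasis, all nonzero multiples
   of the entries of psi, so |L P^a psi P^b R| >= c |L| |R| for some a, b.

   Consequently words can be concatenated freely, up to bounded gaps, with log-norms
   additive up to a bounded error per word. Say that (alpha, h) is admissible if there are
   e^{n(h - e)} words of arbitrarily large length n and exponent e-close to alpha, for every
   e > 0. If h_top(E(alpha)) > h then (alpha, h) is admissible, by covering E(alpha) with
   words of length n. Conversely, mixing words of two admissible pairs with frequencies t
   and 1 - t gives a Moran subset of E(t alpha + (1 - t) beta) of entropy at least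
   t h + (1 - t) g; here the lower bound on Bowen entropy is obtained by choosing, block
   by block, a point that escapes any cover of small weight. Concavity follows, and so does
   the formula for L: every alpha in L is admissible with h = 0, L is closed because
   h = 0 already produces a point of E(alpha), and mixing alpha with a small proportion of
   an admissible pair (beta, h), h > 0, which exists by compactness since h_top(T) > 0,
   gives positive entropy arbitrarily close to alpha. *)
Require Import Defs.
From HB Require Import structures.
From mathcomp Require Import all_boot all_order all_algebra.
From mathcomp Require Import all_classical all_reals all_analysis.
From mathcomp Require Import ring lra zify.
Import Order.TTheory GRing.Theory Num.Theory.
Import numFieldNormedType.Exports.
Local Open Scope classical_set_scope.
Local Open Scope ring_scope.

Set Implicit Arguments.
Unset Strict Implicit.
Unset Printing Implicit Defensive.

(** Fiber bunching acts through bounded distortion: conjugating a Hölder error of size rho^n by A^n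
    costs at most the condition number of A^n, and the result decays like theta^n. Hence norms along
    segments sharing a whole past or a whole future are comparable with one constant, and holonomies
    are limits with rates uniform in the orbits, so a transition matrix can be compared with the
    ideal P^a psi P^b. The obstacle to concatenation is that the gap between two words is only known
    to be at most G. Each word gets a slot of fixed length, which changes the log-norm by a bounded
    amount; a point then determines each word up to G + 1 positions, so ln (G + 1) of entropy is
    lost per word, negligible for long words. More accurate words come with uncontrolled lengths, so
    each accuracy is kept until the past dominates the lengths of the next one; otherwise averages
    might fail to converge along all n. Bowen covers mix balls of different lengths. A random choice
    of words, derandomized by conditional expectations, does the work of a measure on the Moran
    set. *)

Local Notation shift := Defs.shift.

(** * Operator norm *)

Section Norm.
Variables (R : realType) (k : nat).
Implicit Types (u v : 'cV[R]_k) (M N : 'M[R]_k).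

Lemma enorm_ge0 v : 0 <= enorm v.
Proof. exact: sqrtr_ge0. Qed.

Lemma sqr_enorm v : enorm v ^+ 2 = \sum_i v i 0 ^+ 2.
Proof. by rewrite sqr_sqrtr// sumr_ge0// => i _; rewrite sqr_ge0. Qed.

Lemma enormZ (a : R) v : enorm (a *: v) = `|a| * enorm v.
Proof.
rewrite /enorm -sqrtr_sqr -sqrtrM ?sqr_ge0//; congr Num.sqrt.
by rewrite mulr_sumr; apply: eq_bigr => i _; rewrite mxE exprMn.
Qed.

Lemma enorm0 : enorm (0 : 'cV[R]_k) = 0.
Proof. by rewrite -(scale0r (0 : 'cV[R]_k)) enormZ normr0 mul0r. Qed.

Lemma entry_le_enorm v i : `|v i 0| <= enorm v.
Proof.
rewrite -sqrtr_sqr /enorm ler_sqrt ?sumr_ge0// => [|j _]; last by rewrite sqr_ge0.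
by rewrite (bigD1 i)//= lerDl sumr_ge0// => j _; rewrite sqr_ge0.
Qed.

Lemma enorm_eq0 v : enorm v = 0 -> v = 0.
Proof.
move=> v0; apply/matrixP => i j; rewrite ord1 mxE.
by apply/eqP; rewrite -normr_le0 -v0 entry_le_enorm.
Qed.

Lemma cauchy_schwarz u v : \sum_i u i 0 * v i 0 <= enorm u * enorm v.
Proof.
set b := \sum_i _.
have [v0|v0] := eqVneq (enorm v) 0.
  rewrite v0 mulr0 /b big1// => i _.
  by rewrite (enorm_eq0 v0) mxE mulr0.
set a := enorm v ^+ 2; set c := enorm u ^+ 2.
have a0 : 0 < a by rewrite exprn_gt0// lt_neqAle eq_sym v0 enorm_ge0.
have : 0 <= \sum_i (a * u i 0 - b * v i 0) ^+ 2 by apply: sumr_ge0 => i _; exact: sqr_ge0.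
have -> : \sum_i (a * u i 0 - b * v i 0) ^+ 2 = a * (a * c - b ^+ 2).
  rewrite (eq_bigr (fun i => a ^+ 2 * (u i 0) ^+ 2 + (- (2 * a * b) * (u i 0 * v i 0)
      + b ^+ 2 * (v i 0) ^+ 2))); last by move=> i _; ring.
  rewrite !big_split/= -!mulr_sumr -/b -!sqr_enorm -/a -/c; ring.
rewrite pmulr_rge0// subr_ge0 => h.
have [b0|b0] := ltP b 0.
  by rewrite (le_trans (ltW b0))// mulr_ge0// enorm_ge0.
rewrite -(@ler_pXn2r _ 2)// ?nnegrE ?mulr_ge0 ?enorm_ge0//.
by rewrite exprMn mulrC -/a -/c.
Qed.

Lemma enormD u v : enorm (u + v) <= enorm u + enorm v.
Proof.
rewrite -(@ler_pXn2r _ 2)// ?nnegrE ?addr_ge0 ?enorm_ge0// sqrrD !sqr_enorm.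
rewrite (eq_bigr (fun i => (u i 0) ^+ 2 + ((u i 0 * v i 0) *+ 2 + (v i 0) ^+ 2))); last first.
  by move=> i _; rewrite mxE sqrrD -addrA.
rewrite !big_split/= -[leRHS]addrA.
rewrite lerD2l lerD2r -mulr2n lerMn2r/=.
exact: cauchy_schwarz.
Qed.

Lemma enorm_le_sum v : enorm v <= \sum_i `|v i 0|.
Proof.
rewrite -(@ler_pXn2r _ 2)// ?nnegrE ?enorm_ge0 ?sumr_ge0//.
rewrite sqr_enorm expr2 mulr_suml; apply: ler_sum => i _.
rewrite -real_normK ?num_real// expr2 ler_wpM2l//.
by rewrite (bigD1 i)//= lerDl sumr_ge0.
Qed.

Let opset M := [set enorm (M *m v) | v in [set v : 'cV[R]_k | enorm v <= 1]].

Lemma mulmx_enorm_le_sum M v : enorm v <= 1 ->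
  enorm (M *m v) <= \sum_i \sum_j `|M i j|.
Proof.
move=> v1; rewrite (le_trans (enorm_le_sum _))//; apply: ler_sum => i _.
rewrite mxE (le_trans (ler_norm_sum _ _ _))//; apply: ler_sum => j _.
by rewrite normrM ler_piMr// (le_trans (entry_le_enorm _ _)).
Qed.

Lemma opset_sup M : has_sup (opset M).
Proof.
split; first by exists (enorm (M *m 0)), 0 => //=; rewrite enorm0 ler01.
exists (\sum_i \sum_j `|M i j|) => _ [v v1 <-]; exact: mulmx_enorm_le_sum.
Qed.

Lemma opnorm_ge0 M : 0 <= opnorm M.
Proof.
rewrite (le_trans (enorm_ge0 (M *m 0)))//.
by apply: sup_ubound; [exact: (opset_sup M).2|exists 0 => //=; rewrite enorm0 ler01].
Qed.

Lemma enorm_mulmx M v : enorm (M *m v) <= opnorm M * enorm v.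
Proof.
have [v0|v0] := eqVneq (enorm v) 0.
  by rewrite (enorm_eq0 v0) mulmx0 enorm0 mulr0.
have vp : 0 < enorm v by rewrite lt_neqAle eq_sym v0 enorm_ge0.
rewrite -ler_pdivrMr// mulrC -[X in X * _]ger0_norm ?invr_ge0 ?enorm_ge0//.
rewrite -enormZ scalemxAr.
apply: sup_ubound; first exact: (opset_sup M).2.
exists ((enorm v)^-1 *: v) => //=.
by rewrite enormZ ger0_norm ?invr_ge0 ?enorm_ge0// mulVf.
Qed.

Lemma opnorm_le M (c : R) : 0 <= c ->
  (forall v, enorm (M *m v) <= c * enorm v) -> opnorm M <= c.
Proof.
move=> c0 h; apply: ge_sup; first exact: (opset_sup M).1.
by move=> _ [v v1 <-]; rewrite (le_trans (h v))// ler_piMr.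
Qed.

Lemma opnormD M N : opnorm (M + N) <= opnorm M + opnorm N.
Proof.
apply: opnorm_le => [|v]; first by rewrite addr_ge0// opnorm_ge0.
by rewrite mulmxDl (le_trans (enormD _ _))// mulrDl lerD// enorm_mulmx.
Qed.

Lemma opnormM M N : opnorm (M *m N) <= opnorm M * opnorm N.
Proof.
apply: opnorm_le => [|v]; first by rewrite mulr_ge0// opnorm_ge0.
rewrite -mulmxA (le_trans (enorm_mulmx _ _))// -mulrA ler_wpM2l ?opnorm_ge0//.
exact: enorm_mulmx.
Qed.

Lemma opnormZ_le (a : R) M : opnorm (a *: M) <= `|a| * opnorm M.
Proof.
apply: opnorm_le => [|v]; first by rewrite mulr_ge0// opnorm_ge0.
by rewrite -scalemxAl enormZ -mulrA ler_wpM2l// enorm_mulmx.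
Qed.

Lemma opnorm1_le : opnorm (1%:M : 'M[R]_k) <= 1.
Proof. by apply: opnorm_le => // v; rewrite mul1mx mul1r. Qed.

Lemma opnormN M : opnorm (- M) = opnorm M.
Proof.
have H N : opnorm (- N) <= opnorm N.
  by rewrite -scaleN1r (le_trans (opnormZ_le _ _))// normrN1 mul1r.
by apply/eqP; rewrite eq_le H -{1}(opprK M) H.
Qed.

Lemma opnormB M N : opnorm (M - N) = opnorm (N - M).
Proof. by rewrite -opnormN opprB. Qed.

Lemma opnorm0 : opnorm (0 : 'M[R]_k) = 0.
Proof.
apply/eqP; rewrite eq_le opnorm_ge0 andbT; apply: opnorm_le => // v.
by rewrite mul0mx enorm0 mul0r.
Qed.

Lemma opnorm_le_sum M : opnorm M <= \sum_i \sum_j `|M i j|.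
Proof.
apply: ge_sup; first exact: (opset_sup M).1.
by move=> _ [v v1 <-]; exact: mulmx_enorm_le_sum.
Qed.

Lemma entry_le_opnorm M i j : `|M i j| <= opnorm M.
Proof.
have d1 : enorm (delta_mx j 0 : 'cV[R]_k) = 1.
  rewrite /enorm (bigD1 j)//= big1 => [|l lj]; last by rewrite mxE (negPf lj) expr0n.
  by rewrite mxE !eqxx addr0 expr1n sqrtr1.
have := enorm_mulmx M (delta_mx j 0); rewrite d1 mulr1; apply: le_trans.
rewrite -colE (le_trans _ (entry_le_enorm _ i))//.
by rewrite mxE.
Qed.

Lemma opnorm_gt0 M : M != 0 -> 0 < opnorm M.
Proof.
move=> M0; rewrite lt_neqAle opnorm_ge0 andbT; apply: contraNneq M0 => M0.
apply/eqP/matrixP => i j; rewrite mxE; apply/eqP.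
by rewrite -normr_le0 M0 entry_le_opnorm.
Qed.

Lemma opnorm_unit_gt0 M : (0 < k)%N -> M \in unitmx -> 0 < opnorm M.
Proof.
move=> k0 uM; apply: opnorm_gt0; apply: contraTneq uM => ->.
by case: k k0 => // n _; rewrite unitmxE det0 unitr0.
Qed.

(** The identity N^-1 = M^-1 - N^-1 (N - M) M^-1 is solved for the norm of N^-1. It makes bunching
    an open condition in [Hb_regular]. *)
Lemma opnorm_invmx_near M N (c d : R) : M \in unitmx -> N \in unitmx ->
  opnorm (invmx M) <= c -> opnorm (N - M) * c <= d -> d < 1 ->
  opnorm (invmx N) <= c / (1 - d).
Proof.
move=> uM uN cM cd d1.
have E : invmx N = invmx M - invmx N *m (N - M) *m invmx M.
  by rewrite mulmxBr mulVmx// mulmxBl mul1mx mulmxK// opprB addrC subrK.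
rewrite ler_pdivlMr ?subr_gt0// mulrBr mulr1 lerBlDr.
rewrite {1}E (le_trans (opnormD _ _))// opnormN lerD//.
rewrite (le_trans (opnormM _ _))// (le_trans (ler_wpM2r (opnorm_ge0 _) (opnormM _ _)))//.
rewrite -mulrA ler_wpM2l ?opnorm_ge0// (le_trans _ cd)// ler_wpM2l ?opnorm_ge0//.
Qed.

Lemma invmxB M N : M \in unitmx -> N \in unitmx ->
  invmx M - invmx N = invmx M *m (N - M) *m invmx N.
Proof. by move=> uM uN; rewrite mulmxBr mulVmx// mulmxBl mul1mx mulmxK. Qed.

End Norm.

(** * Products of bunched matrices *)

Section MatrixProducts.
Variables (R : realType) (k : nat).
Implicit Types (M N : nat -> 'M[R]_k).

Lemma invmxM (A B : 'M[R]_k) : A \in unitmx -> B \in unitmx ->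
  invmx (A *m B) = invmx B *m invmx A.
Proof.
move=> uA uB; have uAB : A *m B \in unitmx by rewrite unitmx_mul uA.
apply: (can_inj (mulKmx uAB)); rewrite mulmxV// -mulmxA (mulmxA B) mulmxV//.
by rewrite mul1mx mulmxV.
Qed.

Fixpoint prodm M (n : nat) : 'M[R]_k :=
  if n is m.+1 then M m *m prodm M m else 1%:M.

Lemma prodm_eq M N n : (forall j, (j < n)%N -> M j = N j) -> prodm M n = prodm N n.
Proof.
elim: n => //= n IH h; rewrite h// IH// => j jn; apply: h; exact: ltnW.
Qed.

Lemma prodm_add M n m :
  prodm M (n + m) = prodm (fun j => M (n + j)%N) m *m prodm M n.
Proof.
elim: m => [|m IH]; first by rewrite addn0 mul1mx.
by rewrite addnS /= IH mulmxA.
Qed.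

Variables (CA rho theta : R).
Hypotheses (CA1 : 1 <= CA) (rho_gt0 : 0 < rho).
Hypotheses (theta_gt0 : 0 < theta) (theta_lt1 : theta < 1).

Let CA0 : 0 <= CA. Proof. exact: le_trans ler01 CA1. Qed.

(** Abstracts the matrices along one orbit, with [rho] for omega^r. The condition is symmetric in
    [M j] and its inverse, so one set of lemmas serves both forward and backward products. *)
Definition bunched M := forall j,
  [/\ M j \in unitmx, opnorm (M j) <= CA, opnorm (invmx (M j)) <= CA &
      opnorm (M j) * opnorm (invmx (M j)) * rho <= theta].

Lemma bunched_tail M n : bunched M -> bunched (fun j => M (n + j)%N).
Proof. by move=> bM j; exact: bM. Qed.

Lemma prodm_unit M n : bunched M -> prodm M n \in unitmx.
Proof.
by move=> bM; elim: n => [|n IH] /=; rewrite ?unitmx1// unitmx_mul IH andbT; case: (bM n).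
Qed.

Lemma opnorm_prodm M n : bunched M -> opnorm (prodm M n) <= CA ^+ n.
Proof.
move=> bM; elim: n => [|n IH] /=; first by rewrite expr0 opnorm1_le.
rewrite (le_trans (opnormM _ _))// exprS ler_pM ?opnorm_ge0//; by case: (bM n).
Qed.

Lemma opnorm_inv_prodm M n : bunched M -> opnorm (invmx (prodm M n)) <= CA ^+ n.
Proof.
move=> bM; elim: n => [|n IH] /=; first by rewrite invmx1 expr0 opnorm1_le.
have [uM _ hM _] := bM n.
rewrite invmxM ?prodm_unit// (le_trans (opnormM _ _))// exprSr ler_pM ?opnorm_ge0//.
Qed.

Lemma opnorm_prodm_bunched M n : bunched M ->
  opnorm (prodm M n) * opnorm (invmx (prodm M n)) * rho ^+ n <= theta ^+ n.
Proof.
move=> bM; elim: n => [|n IH] /=.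
  by rewrite invmx1 !expr0 mulr1 mulr_ile1 ?opnorm_ge0// opnorm1_le.
have [uM _ _ hM] := bM n.
rewrite invmxM ?prodm_unit// !exprS.
apply: le_trans (ler_pM _ _ hM IH); rewrite ?mulr_ge0 ?exprn_ge0 ?opnorm_ge0 ?(ltW rho_gt0)//.
rewrite [leRHS](_ : _ = (opnorm (M n) * opnorm (prodm M n)) *
  (opnorm (invmx (prodm M n)) * opnorm (invmx (M n))) * (rho * rho ^+ n)); last by ring.
rewrite ler_wpM2r ?mulr_ge0 ?exprn_ge0 ?(ltW rho_gt0)//.
by rewrite ler_pM ?opnorm_ge0// opnormM.
Qed.

(* If [M] and [N] are the matrices of a cocycle along the orbits of [y] and [x], this is
   [A^n(y)^-1 A^n(x)], which converges to a holonomy. *)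
Definition defect M N n := invmx (prodm M n) *m prodm N n.

(** The increment is the relative error of the n-th factors conjugated by [prodm M n]. Conjugation
    costs the condition number of that product, and bunching turns its product with rho^n into
    theta^n. *)
Lemma defect_step M N n (C : R) : bunched M -> bunched N ->
  opnorm (M n - N n) <= C * rho ^+ n ->
  opnorm (defect M N n.+1 - defect M N n) <=
    (CA * C) * theta ^+ n * opnorm (defect M N n).
Proof.
move=> bM bN hC; have [uM _ iM _] := bM n.
have -> : defect M N n.+1 - defect M N n =
    invmx (prodm M n) *m (invmx (M n) *m (N n - M n)) *m prodm M n *m defect M N n.
  rewrite /defect /= invmxM ?prodm_unit//.
  rewrite mulmxBr mulVmx// mulmxBr mulmx1 !mulmxBl -!mulmxA; congr (_ - _).
    by rewrite mulKVmx ?prodm_unit.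
  by rewrite mulKVmx ?prodm_unit.
rewrite (le_trans (opnormM _ _))// ler_wpM2r ?opnorm_ge0//.
rewrite (le_trans (opnormM _ _))//.
have C0 : 0 <= C * rho ^+ n by rewrite (le_trans (opnorm_ge0 _) hC).
apply: (@le_trans _ _ (opnorm (invmx (prodm M n)) * (CA * (C * rho ^+ n)) * opnorm (prodm M n))).
  rewrite ler_wpM2r ?opnorm_ge0// (le_trans (opnormM _ _))// ler_wpM2l ?opnorm_ge0//.
  by rewrite (le_trans (opnormM _ _))// ler_pM ?opnorm_ge0// opnormB.
have C0' : 0 <= C by move: C0; rewrite pmulr_lge0// exprn_gt0.
rewrite (_ : _ * _ = (CA * C) * (opnorm (prodm M n) * opnorm (invmx (prodm M n)) * rho ^+ n)); last by ring.
rewrite ler_wpM2l ?mulr_ge0//.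
exact: opnorm_prodm_bunched.
Qed.

Lemma geometric_sum_le n : \sum_(i < n) theta ^+ i <= (1 - theta)^-1.
Proof.
rewrite -[leRHS]mul1r ler_pdivlMr ?subr_gt0//.
rewrite mulrC -opprB mulNr -subrX1 opprB.
by rewrite gerBl exprn_ge0// ltW.
Qed.

(** Dominates the infinite product of the factors 1 + CA * C * theta^i produced by [defect_step]. *)
Definition defect_bound (C : R) := expR (CA * C / (1 - theta)).

Lemma defect_bound_ge1 (C : R) : 0 <= C -> 1 <= defect_bound C.
Proof.
move=> C0; rewrite -expR0 ler_expR divr_ge0 ?mulr_ge0//.
by rewrite subr_ge0 ltW.
Qed.

Lemma opnorm_defect M N (C : R) n : bunched M -> bunched N -> 0 <= C ->
  (forall j, (j < n)%N -> opnorm (M j - N j) <= C * rho ^+ j) ->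
  opnorm (defect M N n) <= defect_bound C.
Proof.
move=> bM bN C0 h.
have c0 : 0 <= CA * C by rewrite mulr_ge0//.
apply: (@le_trans _ _ (expR (CA * C * \sum_(i < n) theta ^+ i))); last first.
  by rewrite ler_expR ler_wpM2l// geometric_sum_le.
elim: n h => [|n IH] h.
  by rewrite big_ord0 mulr0 expR0 /defect /= invmx1 mul1mx opnorm1_le.
have -> : defect M N n.+1 = defect M N n + (defect M N n.+1 - defect M N n).
  by rewrite addrC subrK.
rewrite (le_trans (opnormD _ _))//.
rewrite (le_trans (lerD (lexx _) (defect_step bM bN (h n (leqnn _)))))//.
rewrite big_ord_recr/= mulrDr expRD -{1}[opnorm _]mul1r -mulrDl mulrC.
rewrite ler_pM ?opnorm_ge0 ?addr_ge0 ?mulr_ge0 ?exprn_ge0 ?(ltW theta_gt0)//.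
- by apply: IH => j jn; apply: h; exact: ltnW.
- exact: expR_ge1Dx.
Qed.

Definition defect_rate (C : R) := CA * C * defect_bound C / (1 - theta).

Lemma defect_cauchy M N (C : R) m d : bunched M -> bunched N -> 0 <= C ->
  (forall j, (j < m + d)%N -> opnorm (M j - N j) <= C * rho ^+ j) ->
  opnorm (defect M N (m + d) - defect M N m) <= defect_rate C * theta ^+ m.
Proof.
move=> bM bN C0 h.
have c0 : 0 <= CA * C by rewrite mulr_ge0//.
have B0 : 0 <= defect_bound C by exact: expR_ge0.
apply: (@le_trans _ _ (CA * C * defect_bound C * theta ^+ m * \sum_(i < d) theta ^+ i)); last first.
  rewrite /defect_rate -[leRHS]mulrA (mulrC _^-1) mulrA ler_wpM2l ?geometric_sum_le//.
  by rewrite !mulr_ge0// exprn_ge0// ltW.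
elim: d h => [|d IH] h; first by rewrite addn0 subrr opnorm0 big_ord0 mulr0.
have -> : defect M N (m + d.+1) - defect M N m =
   (defect M N (m + d).+1 - defect M N (m + d)) + (defect M N (m + d) - defect M N m).
  by rewrite addnS addrA subrK.
rewrite big_ord_recr/= mulrDr addrC (le_trans (opnormD _ _))// lerD//.
  by apply: IH => j jd; apply: h; rewrite addnS ltnW.
rewrite (le_trans (defect_step (C := C) bM bN _))//; first by apply: h; rewrite addnS.
rewrite exprD (_ : _ * _ * opnorm _ = CA * C * opnorm (defect M N (m + d)) * theta ^+ m * theta ^+ d).
  rewrite !ler_wpM2r ?exprn_ge0 ?(ltW theta_gt0)// ler_wpM2l//.
  by apply: opnorm_defect => // j jd; apply: h; rewrite addnS ltnW.
by ring.
Qed.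

Lemma prodm_defect M N n : bunched M -> prodm N n = prodm M n *m defect M N n.
Proof. by move=> bM; rewrite /defect mulKVmx ?prodm_unit. Qed.

(** Bounded distortion: [prodm N n] is [prodm M n] times the defect, whose bound does not depend on
    [n]. *)
Lemma opnorm_prodm_compare M N (C : R) n : bunched M -> bunched N -> 0 <= C ->
  (forall j, (j < n)%N -> opnorm (M j - N j) <= C * rho ^+ j) ->
  opnorm (prodm N n) <= opnorm (prodm M n) * defect_bound C.
Proof.
move=> bM bN C0 h; rewrite (@prodm_defect M)// (le_trans (opnormM _ _))//.
by rewrite ler_wpM2l ?opnorm_ge0// opnorm_defect.
Qed.

Lemma opnorm_inv_prodm_compare M N (C : R) n : bunched M -> bunched N -> 0 <= C ->
  (forall j, (j < n)%N -> opnorm (M j - N j) <= C * rho ^+ j) ->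
  opnorm (invmx (prodm N n)) <= opnorm (invmx (prodm M n)) * defect_bound C.
Proof.
move=> bM bN C0 h.
have -> : invmx (prodm N n) = defect N M n *m invmx (prodm M n).
  by rewrite /defect -mulmxA mulmxV ?mulmx1// prodm_unit.
rewrite (le_trans (opnormM _ _))// mulrC ler_wpM2l ?opnorm_ge0//.
by apply: opnorm_defect => // j jn; rewrite opnormB; exact: h.
Qed.

Lemma prodm_near M N (e : R) n : bunched M -> bunched N ->
  (forall j, (j < n)%N -> opnorm (M j - N j) <= e) ->
  opnorm (prodm M n - prodm N n) <= n%:R * CA ^+ n * e.
Proof.
move=> bM bN; elim: n => [|n IH] h; first by rewrite /= subrr opnorm0 !mul0r.
have [_ hM _ _] := bM n.
have e0 : 0 <= e by rewrite (le_trans (opnorm_ge0 _) (h n _)).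
have -> : prodm M n.+1 - prodm N n.+1 =
   M n *m (prodm M n - prodm N n) + (M n - N n) *m prodm N n.
  by rewrite /= mulmxBr mulmxBl addrA subrK.
rewrite (le_trans (opnormD _ _))// -addn1 natrD !mulrDl lerD//.
  rewrite (le_trans (opnormM _ _))// exprD expr1.
  rewrite (_ : _ * _ * e = CA * (n%:R * CA ^+ n * e)); last by ring.
  by rewrite ler_pM ?opnorm_ge0// IH// => j jn; apply: h; exact: ltnW.
rewrite mul1r mulrC (le_trans (opnormM _ _))// ler_pM ?opnorm_ge0// ?h//.
rewrite (le_trans (opnorm_prodm _ bN))// exprD ler_peMr ?exprn_ge0 ?expr1//.
Qed.

Lemma inv_prodm_near M N (e : R) n : bunched M -> bunched N ->
  (forall j, (j < n)%N -> opnorm (M j - N j) <= e) ->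
  opnorm (invmx (prodm M n) - invmx (prodm N n)) <= n%:R * CA ^+ (3 * n) * e.
Proof.
move=> bM bN h.
rewrite invmxB ?prodm_unit//.
rewrite (le_trans (opnormM _ _))//.
rewrite (le_trans (ler_pM (opnorm_ge0 _) (opnorm_ge0 _) (opnormM _ _) (opnorm_inv_prodm n bN)))//.
rewrite (_ : n%:R * _ * e = CA ^+ n * (n%:R * CA ^+ n * e) * CA ^+ n); last first.
  by rewrite !mulSn mul0n addn0 !exprD; ring.
apply: ler_wpM2r; first exact: exprn_ge0.
apply: ler_pM (opnorm_ge0 _) (opnorm_ge0 _) (opnorm_inv_prodm n bM) _.
by rewrite opnormB; exact: prodm_near.
Qed.

(** A crude estimate, exponential in [n]; it is applied only at one fixed time, after which
    [defect_cauchy] takes over. *)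
Lemma defect_near M N M' N' (e : R) n :
  bunched M -> bunched N -> bunched M' -> bunched N' ->
  (forall j, (j < n)%N -> opnorm (M j - M' j) <= e) ->
  (forall j, (j < n)%N -> opnorm (N j - N' j) <= e) ->
  opnorm (defect M N n - defect M' N' n) <= (2 * n)%:R * CA ^+ (4 * n) * e.
Proof.
move=> bM bN bM' bN' hM hN.
have -> : defect M N n - defect M' N' n =
   (invmx (prodm M n) - invmx (prodm M' n)) *m prodm N n +
   invmx (prodm M' n) *m (prodm N n - prodm N' n).
  by rewrite /defect mulmxBl mulmxBr addrA subrK.
rewrite (le_trans (opnormD _ _))// mulSn mul1n natrD !mulrDl.
have e0 : (0 < n)%N -> 0 <= e by case: n hM hN => // n hM _ _; exact: le_trans (opnorm_ge0 _) (hM 0%N _).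
apply: lerD.
  rewrite (le_trans (opnormM _ _))//.
  rewrite (_ : n%:R * _ * e = n%:R * CA ^+ (3 * n) * e * CA ^+ n); last first.
    by rewrite (_ : 4 * n = 3 * n + n)%N ?exprD; [ring|lia].
  by apply: ler_pM (opnorm_ge0 _) (opnorm_ge0 _) (inv_prodm_near bM bM' hM) (opnorm_prodm n bN).
rewrite (le_trans (opnormM _ _))//.
apply: (@le_trans _ _ (CA ^+ n * (n%:R * CA ^+ n * e))).
  exact: ler_pM (opnorm_ge0 _) (opnorm_ge0 _) (opnorm_inv_prodm n bM') (prodm_near bN bN' hN).
case: n e0 {hM hN} => [|n] e0; first by rewrite !(mul0r, mulr0).
rewrite (_ : 4 * n.+1 = (n.+1 + n.+1) + (2 * n.+1))%N; last by lia.
rewrite !exprD mulrCA !mulrA ler_wpM2r ?e0// -!mulrA ler_wpM2l// mulrA.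
by rewrite ler_peMr ?mulr_ge0 ?exprn_ge0// exprn_ege1.
Qed.

Definition oplim (D : nat -> 'M[R]_k) (H : 'M[R]_k) :=
  forall e : R, 0 < e -> exists n0, forall n, (n0 <= n)%N -> opnorm (D n - H) <= e.

(** After time [B] the Cauchy rate, which depends on [C] only, keeps the defect nearly constant; up
    to time [B] closeness of the factors suffices. Thus [B] and [d] are chosen before the nearby
    orbits, of which only a finite stretch must be close to the limiting ones. *)
Lemma defect_uniform M' N' (C e : R) (H : 'M[R]_k) :
  bunched M' -> bunched N' -> 0 <= C -> 0 < e -> oplim (defect M' N') H ->
  exists (B : nat) (d : R), 0 < d /\ forall M N n,
    bunched M -> bunched N -> (B <= n)%N ->
    (forall j, (j < n)%N -> opnorm (M j - N j) <= C * rho ^+ j) ->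
    (forall j, (j < B)%N -> opnorm (M j - M' j) <= d) ->
    (forall j, (j < B)%N -> opnorm (N j - N' j) <= d) ->
    opnorm (defect M N n - H) <= e.
Proof.
move=> bM' bN' C0 e0 HH.
have e3 : 0 < e / 3 by rewrite divr_gt0.
have [n1 hn1] := HH _ e3.
have [n2 hn2] : exists n2, forall n, (n2 <= n)%N -> defect_rate C * theta ^+ n <= e / 3.
  have : (fun n => defect_rate C * theta ^+ n) @ \oo --> (0 : R).
    by apply: cvg_geometric; rewrite ger0_norm ?ltW.
  move=> /cvgr0Pnorm_le /(_ _ e3) [n2 _ h2]; exists n2 => n n2n.
  exact: le_trans (ler_norm _) (h2 n n2n).
pose B := maxn n1 n2.
pose K := (2 * B)%:R * CA ^+ (4 * B) + 1.
have K0 : 0 < K by rewrite ltr_wpDl// mulr_ge0// exprn_ge0.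
exists B, (e / 3 / K); split; first by rewrite divr_gt0.
move=> M N n bM bN Bn h hM hN.
have -> : defect M N n - H = (defect M N n - defect M N B) +
   ((defect M N B - defect M' N' B) + (defect M' N' B - H)).
  by rewrite [X in _ = _ + X]addrA subrK addrA subrK.
rewrite (_ : e = e / 3 + (e / 3 + e / 3)); last by field.
rewrite (le_trans (opnormD _ _))// lerD//.
  have h2 := hn2 B (leq_maxr _ _); apply: le_trans h2.
  by rewrite -(subnKC Bn); apply: defect_cauchy => // j; rewrite subnKC//; exact: h.
rewrite (le_trans (opnormD _ _))// lerD//; last by apply: hn1; exact: leq_maxl.
rewrite (le_trans (defect_near bM bN bM' bN' hM hN))//.
by rewrite mulrA ler_pdivrMr// mulrC ler_wpM2l ?(ltW e3)// lerDl.
Qed.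

Lemma mx_norm_le_opnorm (M : 'M[R]_k) : `|M| <= opnorm M.
Proof.
rewrite /Num.norm/= mx_normrE; apply: bigmax_le => [|i _]; first exact: opnorm_ge0.
exact: entry_le_opnorm.
Qed.

Lemma opnorm_le_mx_norm (M : 'M[R]_k) : opnorm M <= (k * k)%:R * `|M|.
Proof.
rewrite (le_trans (opnorm_le_sum _))//.
apply: (@le_trans _ _ (\sum_(i < k) \sum_(j < k) `|M|)).
  apply: ler_sum => i _; apply: ler_sum => j _.
  rewrite [leRHS]/Num.norm/= mx_normrE.
  by apply: (le_bigmax_cond _ (fun ij : 'I_k * 'I_k => `|M ij.1 ij.2|) (j := (i, j))).
by rewrite !sumr_const card_ord -mulrnA mulr_natl.
Qed.

Lemma oplim_cvg D H : oplim D H <-> (D n @[n --> \oo] --> H).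
Proof.
split=> [h|/cvgrPdist_le h].
  apply/cvgrPdist_le => e e0; have [n0 hn] := h _ e0; exists n0 => // n /= n0n.
  by rewrite distrC (le_trans (mx_norm_le_opnorm _))// hn.
move=> e e0; have K0 : 0 < (k * k)%:R + 1 :> R by rewrite ltr_wpDl.
have [n0 _ hn] := h _ (divr_gt0 e0 K0); exists n0 => n n0n.
have := hn n n0n; rewrite /= distrC => {}hn.
rewrite (le_trans (opnorm_le_mx_norm _))//.
rewrite ler_pdivlMr// mulrC in hn; apply: le_trans hn.
by rewrite ler_wpM2r// lerDl.
Qed.

Lemma defect_oplim M N (C : R) : bunched M -> bunched N -> 0 <= C ->
  (forall j, opnorm (M j - N j) <= C * rho ^+ j) ->
  oplim (defect M N) (lim (defect M N n @[n --> \oo])).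
Proof.
move=> bM bN C0 h; apply/oplim_cvg.
suff : cvg (defect M N n @[n --> \oo]) by [].
apply/cauchy_cvgP/cauchy_exP => e e0.
have : (fun n => defect_rate C * theta ^+ n) @ \oo --> (0 : R).
  by apply: cvg_geometric; rewrite ger0_norm ?ltW.
move=> /cvgr0Pnorm_lt /(_ _ e0) [n _ hn].
exists (defect M N n), n => // m /= nm.
rewrite -ball_normE /= distrC (le_lt_trans (mx_norm_le_opnorm _))//.
rewrite (le_lt_trans _ (hn n (leqnn _)))//= (le_trans _ (ler_norm _))//.
by rewrite -(subnKC nm); exact: defect_cauchy.
Qed.

End MatrixProducts.

(** * Symbolic dynamics *)

Section SymbolicMetric.
Variables (R : realType) (q : nat) (omega : R).
Hypothesis omega01 : 0 < omega < 1.
Implicit Types x y : biseq q.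

Let w0 : 0 < omega. Proof. by case/andP: omega01. Qed.
Let w1 : omega < 1. Proof. by case/andP: omega01. Qed.

Lemma agreeW x y m n : (m <= n)%N -> agree x y n -> agree x y m.
Proof. by move=> mn h i im; apply: h; exact: leq_trans im mn. Qed.

Lemma sdist_neq x y : x <> y ->
  exists M, [/\ sdist omega x y = omega ^+ M, agree x y M &
    forall m, agree x y m -> (m <= M)%N].
Proof.
move=> xy; rewrite /sdist; case: asboolP => // _.
set S := [set m | _].
suff : exists M, S M.
  by move=> /(xgetPex 0%N) [aM hM]; exists (xget 0%N S).
have [i xyi] : exists i, x i <> y i.
  by apply/existsNP => h; apply: xy; apply: funext.
have bnd m : agree x y m -> (m <= `|i|)%N.
  by move=> am; rewrite leqNgt; apply/negP => /am.
have ex : exists m, `[< agree x y m >] by exists 0%N; apply/asboolP => j.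
have ub m : `[< agree x y m >] -> (m <= `|i|)%N by move=> /asboolP; exact: bnd.
case: (ex_maxnP ex ub) => M /asboolP aM hM; exists M; split=> // m am.
by apply: hM; apply/asboolP.
Qed.

Lemma sdist_le x y m : agree x y m -> sdist omega x y <= omega ^+ m.
Proof.
move=> am; have [->|/sdist_neq [M [-> _ /(_ m am) mM]]] := pselect (x = y).
  by rewrite /sdist; case: asboolP => // _; rewrite exprn_ge0// ltW.
by rewrite ler_wiXn2l// ltW.
Qed.

Lemma sdist_lt x y m : sdist omega x y < omega ^+ m -> agree x y m.+1.
Proof.
have [->|/sdist_neq [M [-> aM _]]] := pselect (x = y); first by [].
rewrite ltr_iXn2l// => mM; exact: agreeW aM.
Qed.

Lemma sdist_ge0 x y : 0 <= sdist omega x y.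
Proof. by rewrite /sdist; case: asboolP => // _; rewrite exprn_ge0// ltW. Qed.

End SymbolicMetric.

Section Shift.
Variables (q : nat) (Q : 'M[bool]_q).
Implicit Types x y : biseq q.

Lemma subshift_shift n x : subshift Q x -> subshift Q (shift n x).
Proof. by move=> h i; rewrite /shift addrAC; exact: h. Qed.

Lemma shift_shift m n x : shift m (shift n x) = shift (m + n) x.
Proof. by apply: funext => i; rewrite /shift addrA. Qed.

Lemma shift0 x : shift 0 x = x.
Proof. by apply: funext => i; rewrite /shift addr0. Qed.

Definition splice x y (n : int) : biseq q := fun i => if i < n then x i else y i.

Lemma subshift_splice x y n : subshift Q x -> subshift Q y -> x n = y n ->
  subshift Q (splice x y n).
Proof.
move=> hx hy e i; rewrite /splice; case: ltP => h1; case: ltP => h2.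
- exact: hx.
- have E : i + 1 = n by lia.
  by rewrite E -e -E; exact: hx.
- by exfalso; lia.
- exact: hy.
Qed.

(* Compactness of the subshift: by Koenig's lemma, a failure of boundedness would
   produce a point none of whose neighbourhoods carries a bound. *)
Lemma subshift_bounded (R : realType) (U : biseq q -> R) :
  (forall x, subshift Q x -> exists (m : nat) (B : R),
     forall y, subshift Q y -> agree x y m -> U y <= B) ->
  exists B : R, forall y, subshift Q y -> U y <= B.
Proof.
move=> loc; apply: contrapT => unb.
pose bad (m : nat) (x : biseq q) := forall n : nat,
  exists y, [/\ subshift Q y, agree x y m & n%:R < U y].
have bad0 x : bad 0%N x.
  move=> n; apply: contrapT => h; apply: unb; exists n%:R => y Qy.
  by rewrite leNgt; apply/negP => ny; apply: h; exists y.
have step m x : bad m x -> exists x', agree x x' m /\ bad m.+1 x'.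
  move=> bx; apply: contrapT => none.
  (* The extensions of the central word by the coordinates m and -m are finitely many, so one of
     them must be bad; the values of [ext] at |i| > m are irrelevant. *)
  pose ext (c : 'I_q * 'I_q) : biseq q := fun i =>
    if (`|i| < m)%N then x i else if 0 <= i then c.1 else c.2.
  have /choice [N hN] : forall c, exists n : nat, forall y, subshift Q y ->
      agree (ext c) y m.+1 -> U y <= n%:R.
    move=> c; apply: contrapT => h; apply: none; exists (ext c); split.
      by move=> i im; rewrite /ext im.
    move=> n; apply: contrapT => h'; apply: h; exists n => y Qy ay.
    by rewrite leNgt; apply/negP => ny; apply: h'; exists y.
  have [y [Qy ay]] := bx (\max_c N c).
  apply/negP; rewrite -leNgt.
  apply: (le_trans (hN (y m%:Z, y (- m%:Z)) y Qy _)).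
    move=> i; rewrite ltnS leq_eqVlt => /orP[/eqP im|im]; rewrite /ext.
      rewrite im ltnn; case: ifPn => i0 /=; congr y; first by rewrite -im gez0_abs.
      by rewrite -im ltz0_abs ?opprK// ltNge.
    by rewrite im; exact: ay.
  by rewrite ler_nat; exact: (leq_bigmax (y m%:Z, y (- m%:Z))).
have [x0 _] : exists x0 : biseq q, True.
  by apply: contrapT => h; apply: unb; exists 0 => y _; exfalso; apply: h; exists y.
have /choice [nx hnx] : forall s : nat * biseq q, exists x', bad s.1 s.2 ->
    agree s.2 x' s.1 /\ bad s.1.+1 x'.
  move=> s; have [b|nb] := pselect (bad s.1 s.2); last by exists x0.
  by have [x' hx'] := step _ _ b; exists x'.
pose X := fix X m := if m is m'.+1 then nx (m', X m') else x0.
have badX m : bad m (X m).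
  by elim: m => [|m IH]; [exact: bad0|exact: (hnx (m, X m) IH).2].
have aX m n : (m <= n)%N -> agree (X m) (X n) m.
  move=> /subnKC <-; elim: (n - m)%N => [|d IH]; first by rewrite addn0.
  move=> i im; rewrite IH// addnS /=.
  apply: (hnx (m + d, X (m + d))%N (badX _)).1 => /=.
  exact: leq_trans im (leq_addr _ _).
pose z : biseq q := fun i => X `|i|.+1 i.
have az m : agree (X m) z m.
  by move=> i im; rewrite /z; exact/esym/aX.
have Qz : subshift Q z.
  move=> i; pose m := ((`|i| + `|(i + 1)%R|).+1)%N.
  have [y [Qy ay _]] := badX m 0%N.
  rewrite -!(az m) ?ay//; try by rewrite /m ltnS ?leq_addr ?leq_addl.
have [m [B hB]] := loc z Qz.
have [y [Qy ay]] := badX m (Num.trunc B).+1.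
apply/negP; rewrite -leNgt (le_trans (hB y Qy _))//.
  by move=> i im; rewrite -(az m)// ay.
by rewrite ltW// truncnS_gt.
Qed.

End Shift.

(** * Uniform bounds along the cocycle *)

Section Regular.
Variables (R : realType) (q k : nat) (Q : 'M[bool]_q).
Implicit Types (x y : biseq q) (A : biseq q -> 'M[R]_k).

(** The pointwise hypotheses made uniform: [theta] < 1 replaces the strict bunching inequality, and
    the Hölder condition is read on cylinders, where the r-th power of the distance is at most
    rho^m. *)
Record regular A (CA C rho theta : R) : Prop := Regular {
  reg_CA : 1 <= CA;
  reg_C : 0 <= C;
  reg_rho : 0 < rho < 1;
  reg_theta : 0 < theta < 1;
  reg_bound : forall x, subshift Q x ->
    [/\ A x \in unitmx, opnorm (A x) <= CA, opnorm (invmx (A x)) <= CA &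
        opnorm (A x) * opnorm (invmx (A x)) * rho <= theta];
  reg_holder : forall x y m, subshift Q x -> subshift Q y -> agree x y m ->
    opnorm (A x - A y) <= C * rho ^+ m }.

(** Continuity gives every bound on a cylinder around each point, and [subshift_bounded] makes it
    global. *)
Lemma Hb_regular (omega r : R) A : 0 < omega < 1 -> 0 < r -> Hb Q omega r A ->
  exists CA C theta, regular A CA C (omega `^ r) theta.
Proof.
move=> w01 r0 [uA [C0 hC0] fb]; have /andP[w0 w1] := w01.
set rho := omega `^ r.
have rho0 : 0 < rho by exact: powR_gt0.
have rho1 : rho < 1.
  have -> : 1 = 1 `^ r :> R by rewrite powR1.
  by rewrite gt0_ltr_powR// ?nnegrE ?ltW.
pose C := `|C0|.
have hold x y m : subshift Q x -> subshift Q y -> agree x y m ->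
    opnorm (A x - A y) <= C * rho ^+ m.
  move=> Qx Qy axy; rewrite (le_trans (hC0 x y Qx Qy))//.
  apply: (@le_trans _ _ (C * sdist omega x y `^ r)).
    by rewrite ler_wpM2r ?powR_ge0// ler_norm.
  rewrite ler_wpM2l ?normr_ge0//.
  have -> : rho ^+ m = (omega ^+ m) `^ r.
    rewrite -(powR_mulrn m (ltW rho0)) -(powR_mulrn m (ltW w0)) /rho.
    by rewrite -2!powRrM mulrC.
  rewrite ge0_ler_powR ?nnegrE ?exprn_ge0 ?sdist_ge0 ?(ltW r0) ?(ltW w0)//.
  exact: sdist_le.
pose f x := opnorm (A x) * opnorm (invmx (A x)) * rho.
have near x : subshift Q x -> exists (m : nat) (B t : R), t < 1 /\
    forall y, subshift Q y -> agree x y m ->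
      [/\ opnorm (A y) <= B, opnorm (invmx (A y)) <= B & f y <= t].
  move=> Qx; pose a := opnorm (A x); pose c := opnorm (invmx (A x)).
  have a0 : 0 <= a by exact: opnorm_ge0.
  have c0 : 0 <= c by exact: opnorm_ge0.
  have s0 : 0 < 1 - f x by rewrite subr_gt0 fb.
  have s1 : 1 - f x <= 1 by rewrite gerBl !mulr_ge0 ?opnorm_ge0 ?ltW.
  (* With a * c * rho = f x, the perturbed quantity (a + e) * c / (1 - e * c) * rho is below 1 as
     soon as e * c * (1 + rho) < 1 - f x; this choice leaves a factor 2 to spare. *)
  pose e := (1 - f x) / (2 * (1 + c) * (1 + rho)).
  have c1 : 0 < 1 + c by lra.
  have r1 : 0 < 1 + rho by lra.
  have e0 : 0 < e by rewrite divr_gt0// !mulr_gt0.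
  have ec : e * (c * (1 + rho)) <= (1 - f x) / 2.
    rewrite /e -mulrA ler_wpM2l ?(ltW s0)// mulrC ler_pdivrMr ?mulr_gt0//.
    rewrite (_ : _^-1 * _ = (1 + c) * (1 + rho)); last by field.
    by rewrite ler_wpM2r ?(ltW r1)//; lra.
  have ec1 : e * c < 1.
    apply: (@le_lt_trans _ _ (e * (c * (1 + rho)))); last by lra.
    by rewrite ler_wpM2l ?(ltW e0)// ler_peMr//; lra.
  have [m hm] : exists m, C * rho ^+ m <= e.
    have : (fun n => C * rho ^+ n) @ \oo --> (0 : R).
      by apply: cvg_geometric; rewrite ger0_norm ?ltW.
    move=> /cvgr0Pnorm_le /(_ _ e0) [n _ hn]; exists n.
    exact: le_trans (ler_norm _) (hn n (leqnn _)).
  pose B := c / (1 - e * c).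
  exists m, (Num.max (a + e) B), ((a + e) * B * rho); split.
    rewrite /B mulrA mulrAC ltr_pdivrMr ?subr_gt0// mul1r.
    have : a * c * rho = f x by [].
    move: ec; nra.
  move=> y Qy axy.
  have d : opnorm (A y - A x) <= e.
    by rewrite opnormB (le_trans _ hm)// hold.
  have h1 : opnorm (A y) <= a + e.
    rewrite (_ : A y = A x + (A y - A x)); last by rewrite addrC subrK.
    by rewrite (le_trans (opnormD _ _))// lerD.
  have h2 : opnorm (invmx (A y)) <= B.
    apply: (@opnorm_invmx_near _ _ (A x)); rewrite ?uA//.
    by rewrite ler_wpM2r.
  split; rewrite ?le_max ?h1 ?h2 ?orbT//.
  by rewrite /f ler_wpM2r ?(ltW rho0)// ler_pM ?opnorm_ge0.
have [B hB] : exists B, forall x, subshift Q x ->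
    Num.max (opnorm (A x)) (opnorm (invmx (A x))) <= B.
  apply: subshift_bounded => x /near[m [B [t [_ h]]]]; exists m, B => y Qy axy.
  by rewrite ge_max; have [-> -> _] := h y Qy axy.
(* A uniform gap below 1 is an upper bound for (1 - f)^-1, the form to which compactness applies.
   The maximum with 2 then makes 1 - 1/T' positive. *)
have [T hT] : exists T, forall x, subshift Q x -> (1 - f x)^-1 <= T.
  apply: subshift_bounded => x /near[m [B0 [t [t1 h]]]]; exists m, (1 - t)^-1 => y Qy axy.
  have [_ _ ft] := h y Qy axy.
  by rewrite lef_pV2 ?posrE ?subr_gt0 ?fb// lerD2l lerN2.
pose T' := Num.max T 2.
have T2 : 2 <= T' by rewrite le_max lexx orbT.
exists (Num.max B 1), C, (1 - T'^-1); split=> //.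
- by rewrite le_max lexx orbT.
- by rewrite normr_ge0.
- by rewrite rho0 rho1.
- have ? : 0 < T'^-1 by rewrite invr_gt0; lra.
  have ? : T'^-1 <= 2^-1 by rewrite lef_pV2 ?posrE; lra.
  by apply/andP; split; lra.
- move=> x Qx; have := hB x Qx; rewrite ge_max => /andP[h1 h2].
  rewrite uA// !le_max h1 h2; split=> //.
  have := hT x Qx; rewrite -/(f x) => h.
  have s0 : 0 < 1 - f x by rewrite subr_gt0 fb.
  have : (1 - f x)^-1 <= T' by rewrite le_max h.
  move=> {}h; rewrite lerBrDl -lerBrDr -[leRHS]invrK.
  by rewrite lef_pV2 ?posrE ?invr_gt0//; lra.
Qed.

End Regular.

(** * Forward and backward products, and bounded distortion of their norms *)

Section Cocycle.
Variables (R : realType) (q k : nat) (Q : 'M[bool]_q).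
Variables (A : biseq q -> 'M[R]_k) (CA C rho theta : R).
Hypothesis reg : regular Q A CA C rho theta.
Implicit Types x y : biseq q.

Let CA1 : 1 <= CA := reg_CA reg.
Let CA0 : 0 <= CA := le_trans ler01 CA1.
Let C0 : 0 <= C := reg_C reg.
Let rho0 : 0 < rho. Proof. by case/andP: (reg_rho reg). Qed.
Let rho1 : rho < 1. Proof. by case/andP: (reg_rho reg). Qed.
Let theta0 : 0 < theta. Proof. by case/andP: (reg_theta reg). Qed.
Let theta1 : theta < 1. Proof. by case/andP: (reg_theta reg). Qed.

Definition fwd x (j : nat) : 'M[R]_k := A (shift j%:Z x).
(** The index is j + 1 because the first factor of A^-n(x) is the inverse of A at T^-1 x. *)
Definition bwd x (j : nat) : 'M[R]_k := invmx (A (shift (- j.+1%:Z) x)).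

Lemma cocycle_fwd n x : cocycle A n%:Z x = prodm (fwd x) n.
Proof. by rewrite /=; elim: n => //= n ->. Qed.

Lemma cocycle_bwd n x : cocycle A (- n%:Z) x = prodm (bwd x) n.
Proof.
have E m : cocycle_neg A m x = prodm (bwd x) m by elim: m => //= m ->.
by case: n => // n; rewrite -E.
Qed.

Lemma fwd_bunched x : subshift Q x -> bunched CA rho theta (fwd x).
Proof. by move=> Qx j; apply: (reg_bound reg); exact: subshift_shift. Qed.

Lemma bwd_bunched x : subshift Q x -> bunched CA rho theta (bwd x).
Proof.
move=> Qx j; have [u a b c] := reg_bound reg (subshift_shift (- j.+1%:Z) Qx).
by rewrite /bwd invmxK unitmx_inv; split=> //; rewrite [X in X * rho]mulrC.
Qed.

Lemma prodm_fwd_split x n m :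
  prodm (fwd x) (n + m) = prodm (fwd (shift n%:Z x)) m *m prodm (fwd x) n.
Proof.
rewrite prodm_add; congr (_ *m _); apply: prodm_eq => j _.
by rewrite /fwd shift_shift -PoszD addnC.
Qed.

Lemma prodm_bwd x n : subshift Q x ->
  prodm (bwd x) n = invmx (prodm (fwd (shift (- n%:Z) x)) n).
Proof.
move=> Qx; elim: n => [|n IH]; first by rewrite /= invmx1.
rewrite -[in RHS]add1n prodm_fwd_split shift_shift.
have -> : (1 - (1 + n)%N%:Z = - n%:Z)%R by lia.
have Qn i : subshift Q (shift i x) by exact: subshift_shift.
by rewrite invmxM ?(prodm_unit _ (fwd_bunched (Qn _)))//= mulmx1 -IH /bwd /fwd shift0.
Qed.

Lemma prodm_fwd_bwd x n : subshift Q x ->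
  prodm (fwd x) n = invmx (prodm (bwd (shift n%:Z x)) n).
Proof.
move=> Qx; rewrite prodm_bwd ?invmxK; last exact: subshift_shift.
by rewrite shift_shift addNr shift0.
Qed.

Lemma cocycle_unit x n : subshift Q x -> prodm (fwd x) n \in unitmx.
Proof. by move=> Qx; exact: prodm_unit (fwd_bunched Qx). Qed.

(** A Hölder constant for both A and its pointwise inverse: the difference of two inverses carries
    one extra factor [CA] on each side. *)
Definition C2 := CA * CA * C.

Lemma C2_ge0 : 0 <= C2. Proof. by rewrite !mulr_ge0. Qed.

Lemma C_le_C2 : C <= C2.
Proof. by rewrite /C2 ler_peMl// mulr_ege1. Qed.

Lemma fwd_near x y j m : subshift Q x -> subshift Q y ->
  agree (shift j%:Z x) (shift j%:Z y) m -> opnorm (fwd x j - fwd y j) <= C2 * rho ^+ m.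
Proof.
move=> Qx Qy a; apply: le_trans (reg_holder reg _ _ a) _; try exact: subshift_shift.
by rewrite ler_wpM2r ?exprn_ge0 ?(ltW rho0)// C_le_C2.
Qed.

Lemma bwd_near x y j m : subshift Q x -> subshift Q y ->
  agree (shift (- j.+1%:Z) x) (shift (- j.+1%:Z) y) m ->
  opnorm (bwd x j - bwd y j) <= C2 * rho ^+ m.
Proof.
move=> Qx Qy a.
have [u1 _ i1 _] := reg_bound reg (subshift_shift (- j.+1%:Z) Qx).
have [u2 _ i2 _] := reg_bound reg (subshift_shift (- j.+1%:Z) Qy).
rewrite /bwd invmxB// (le_trans (opnormM _ _))//.
rewrite (_ : C2 * _ = CA * (C * rho ^+ m) * CA); last by rewrite /C2; ring.
rewrite ler_pM ?opnorm_ge0// (le_trans (opnormM _ _))//.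
rewrite ler_pM ?opnorm_ge0// opnormB.
by apply: (reg_holder reg _ _ a); exact: subshift_shift.
Qed.

Lemma rho_subn j n0 : rho ^+ (j - n0) <= rho ^- n0 * rho ^+ j.
Proof.
rewrite mulrC ler_pdivlMr ?exprn_gt0// -exprD ler_wiXn2l ?(ltW rho0) ?(ltW rho1)//.
lia.
Qed.

(** At time j the shifted points agree on radius j - n0 (truncated at 0), so a late start of the
    agreement only costs the factor rho^-n0. *)
Lemma fwd_close x y (n0 j : nat) : subshift Q x -> subshift Q y ->
  (forall i, n0%:Z <= i -> x i = y i) ->
  opnorm (fwd x j - fwd y j) <= (C2 * rho ^- n0) * rho ^+ j.
Proof.
move=> Qx Qy h; apply: (@le_trans _ _ (C2 * rho ^+ (j - n0))).
  by apply: fwd_near => // i ij; apply: h; lia.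
by rewrite -mulrA ler_wpM2l ?C2_ge0// rho_subn.
Qed.

Lemma bwd_close x y (n0 j : nat) : subshift Q x -> subshift Q y ->
  (forall i, i < - n0%:Z -> x i = y i) ->
  opnorm (bwd x j - bwd y j) <= (C2 * rho ^- n0) * rho ^+ j.
Proof.
move=> Qx Qy h; apply: (@le_trans _ _ (C2 * rho ^+ (j - n0))).
  by apply: bwd_near => // i ij; apply: h; lia.
by rewrite -mulrA ler_wpM2l ?C2_ge0// rho_subn.
Qed.

Definition cnorm (n : nat) x : R := opnorm (prodm (fwd x) n).

Lemma cnorm_ge0 n x : 0 <= cnorm n x. Proof. exact: opnorm_ge0. Qed.

Lemma cnorm_add n m x : cnorm (n + m) x <= cnorm n x * cnorm m (shift n%:Z x).
Proof. by rewrite /cnorm prodm_fwd_split mulrC opnormM. Qed.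

Lemma cnorm_le n x : subshift Q x -> cnorm n x <= CA ^+ n.
Proof. by move=> Qx; exact: opnorm_prodm (fwd_bunched Qx). Qed.

Lemma cnorm_le_addr n m x : subshift Q x -> cnorm n x <= CA ^+ m * cnorm (n + m) x.
Proof.
move=> Qx; rewrite /cnorm prodm_fwd_split.
set P := prodm (fwd (shift _ _)) _.
have Qs := subshift_shift (n%:Z) Qx.
have uP : P \in unitmx by exact: cocycle_unit.
rewrite -{1}(mulKmx uP (prodm (fwd x) n)) (le_trans (opnormM _ _))//.
by rewrite ler_wpM2r ?opnorm_ge0//; exact: opnorm_inv_prodm (fwd_bunched Qs).
Qed.

Lemma cnorm_le_addl n m x : subshift Q x ->
  cnorm m (shift n%:Z x) <= CA ^+ n * cnorm (n + m) x.
Proof.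
move=> Qx; rewrite /cnorm prodm_fwd_split.
have u := cocycle_unit n Qx.
rewrite -{1}(mulmxK u (prodm (fwd (shift n%:Z x)) m)) (le_trans (opnormM _ _))// mulrC.
by rewrite ler_wpM2r ?opnorm_ge0//; exact: opnorm_inv_prodm (fwd_bunched Qx).
Qed.

Definition Kd := defect_bound CA theta C2.

Lemma Kd_ge1 : 1 <= Kd.
Proof. exact: defect_bound_ge1 C2_ge0. Qed.

Lemma cnorm_future n x y : subshift Q x -> subshift Q y ->
  (forall i, 0 <= i -> x i = y i) -> cnorm n x <= cnorm n y * Kd.
Proof.
move=> Qx Qy h.
apply: (opnorm_prodm_compare CA1 rho0 theta0 theta1 (fwd_bunched Qy) (fwd_bunched Qx) C2_ge0).
move=> j _; have := @fwd_close y x 0 j Qy Qx; rewrite expr0 invr1 mulr1; apply.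
by move=> i i0; rewrite h.
Qed.

(** A^n(x) is the inverse of the backward product of length n from T^n x, which sees the coordinates
    below n through bounded distortion. With [cnorm_future], either half-line determines the norm up
    to [Kd]. *)
Lemma cnorm_past n x y : subshift Q x -> subshift Q y ->
  (forall i, i < n%:Z -> x i = y i) -> cnorm n x <= cnorm n y * Kd.
Proof.
move=> Qx Qy h; rewrite /cnorm !prodm_fwd_bwd//.
have Qx' := subshift_shift (n%:Z) Qx.
have Qy' := subshift_shift (n%:Z) Qy.
apply: (opnorm_inv_prodm_compare CA1 rho0 theta0 theta1 (bwd_bunched Qy') (bwd_bunched Qx') C2_ge0).
move=> j _; have := @bwd_close _ _ 0 j Qy' Qx'; rewrite expr0 invr1 mulr1; apply.
by move=> i i0; rewrite /shift h//; lia.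
Qed.

End Cocycle.

(** * Twisting *)

Section Twisting.
Variables (R : realType) (k : nat).
Hypothesis k_gt0 : (0 < k)%N.
Variables (P psi : 'M[R]_k) (lam : 'I_k -> R) (v : 'I_k -> 'cV[R]_k).
Hypothesis lam_inj : injective lam.
Hypothesis v_eigen : forall i, v i != 0 /\ P *m v i = lam i *: v i.
Hypothesis twist :
  forall i j, psi *m v i \notin (\sum_(l < k | l != j) <[v l]>)%VS.

Let pw (a : nat) : 'M[R]_k := prodm (fun=> P) a.
Let V : 'M[R]_k := \matrix_(r, i) v i r 0.
Let Vd : 'M[R]_k := Vandermonde k (\row_i lam i).

Lemma opnorm_entry (M : 'M[R]_k) :
  exists i j, opnorm M <= (k * k)%:R * `|M i j|.
Proof.
have E : `|M| = mx_norm M by [].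
have [M0|M0] := eqVneq (mx_norm M) 0.
  exists (Ordinal k_gt0), (Ordinal k_gt0); rewrite (le_trans (opnorm_le_mx_norm _))//.
  by rewrite E M0 mulr0 mulr_ge0.
have [[i j] h] := mx_norm_neq0 M0; exists i, j.
by rewrite (le_trans (opnorm_le_mx_norm _))// E h.
Qed.

Lemma Vandermonde_unit : Vd \in unitmx.
Proof.
rewrite unitmxE unitfE det_Vandermonde; apply/prodf_neq0 => i _.
apply/prodf_neq0 => j ij; rewrite !mxE subr_eq0.
by apply: contraTneq ij => /lam_inj ->; rewrite ltnn.
Qed.

Lemma powm_eigen a i : pw a *m v i = lam i ^+ a *: v i.
Proof.
elim: a => [|a IH]; first by rewrite mul1mx scale1r.
by rewrite /= -mulmxA IH -scalemxAr (v_eigen i).2 scalerA -exprSr.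
Qed.

Lemma powm_eigenmx a : pw a *m V = V *m diag_mx (\row_i lam i ^+ a).
Proof.
apply/matrixP => r i; rewrite mul_mx_diag !mxE.
have /matrixP/(_ r 0) := powm_eigen a i; rewrite !mxE mulrC => <-.
by apply: eq_bigr => l _; rewrite mxE.
Qed.

(** Applying the powers P^a to a relation between the eigenvectors gives an invertible Vandermonde
    system for its individual terms, which therefore vanish. *)
Lemma eigenmx_unit : V \in unitmx.
Proof.
suff ker0 (c : 'cV[R]_k) : V *m c = 0 -> c = 0.
  rewrite -unitmx_tr -row_free_unit -kermx_eq0; apply/eqP/row_matrixP => i.
  rewrite row0; apply: trmx_inj; rewrite trmx0; apply: ker0.
  apply: trmx_inj; rewrite trmx_mul trmxK trmx0; apply/sub_kermxP.
  exact: row_sub.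
move=> Vc0; have W0 : (\matrix_(r, i) (v i r 0 * c i 0)) *m Vd^T = 0 :> 'M[R]_k.
  apply/matrixP => r a; rewrite !mxE.
  have : pw a *m (V *m c) = 0 by rewrite Vc0 mulmx0.
  rewrite mulmxA powm_eigenmx -mulmxA => /matrixP/(_ r 0); rewrite !mxE => E.
  by apply: etrans E; apply: eq_bigr => i _; rewrite mul_diag_mx !mxE; ring.
have {}W0 : \matrix_(r, i) (v i r 0 * c i 0) = 0 :> 'M[R]_k.
  have u : Vd^T \in unitmx by rewrite unitmx_tr Vandermonde_unit.
  by apply: (can_inj (mulmxK u)); rewrite W0 mul0mx.
apply/matrixP => i j; rewrite ord1 mxE; apply: contraNeq (v_eigen i).1 => ci0.
apply/eqP/matrixP => r s; rewrite ord1 mxE.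
have /matrixP/(_ r i) := W0; rewrite !mxE => /eqP.
by rewrite mulf_eq0 (negPf ci0) orbF => /eqP.
Qed.

Let Gam := invmx V *m psi *m V.

(** [Gam] is psi in the eigenbasis: a zero entry (j, i) would put psi (v_i) in the span of the v_l
    with l different from j. *)
Lemma twist_coef i j : Gam j i != 0.
Proof.
apply: contraNneq (twist i j) => G0.
have -> : psi *m v i = \sum_(l < k) Gam l i *: v l.
  have -> : psi *m v i = V *m (Gam *m delta_mx i 0).
    rewrite /Gam !mulmxA mulmxV ?eigenmx_unit// mul1mx -mulmxA; congr (_ *m _).
    by apply/matrixP => r s; rewrite -colE !mxE ord1.
  apply/matrixP => r s; rewrite ord1 mxE summxE; apply: eq_bigr => l _.
  by rewrite -colE !mxE mulrC.
rewrite (bigD1 j)//= G0 scale0r add0r; apply: rpred_sum => l lj.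
apply: rpredZ; apply: (subvP (sumv_sup l lj (subvv _))); exact: memv_line.
Qed.

Let U := invmx Vd.

(** Lagrange interpolation: row j of the inverse Vandermonde matrix lists the coefficients of the
    polynomial that is 1 at lam_j and 0 at the other eigenvalues. Evaluated at P, it is the spectral
    projection onto v_j. *)
Lemma eigen_projection j :
  \sum_(a < k) U j a *: pw a = V *m delta_mx j j *m invmx V.
Proof.
apply: (can_inj (mulmxK eigenmx_unit)); rewrite mulmxKV ?eigenmx_unit//.
rewrite mulmx_suml; under eq_bigr => a _ do rewrite -scalemxAl powm_eigenmx scalemxAr.
rewrite -mulmx_sumr; congr (_ *m _).
apply/matrixP => i l; rewrite summxE mxE.
have : (U *m Vd) j i = (1%:M : 'M[R]_k) j i by rewrite mulVmx// Vandermonde_unit.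
rewrite !mxE => E.
have [<-{l}|il] := eqVneq i l; last first.
  rewrite big1 => [|a _]; last by rewrite !mxE (negPf il) mulr0n mulr0.
  by case: (eqVneq i j) => //= ij; rewrite -ij eq_sym (negPf il).
rewrite andbb eq_sym -E; apply: eq_bigr => a _.
by rewrite !mxE eqxx mulr1n.
Qed.

(** Placing psi between two spectral projections isolates a single entry of [Gam]. *)
Lemma twist_entry (L T : 'M[R]_k) r j i s :
  \sum_(a < k) \sum_(b < k) U j a * U i b * (L *m (pw a *m psi *m pw b) *m T) r s =
  (L *m V) r j * Gam j i * (invmx V *m T) i s.
Proof.
have -> : \sum_(a < k) \sum_(b < k) U j a * U i b * (L *m (pw a *m psi *m pw b) *m T) r s
  = (L *m ((\sum_(a < k) U j a *: pw a) *m psi *m (\sum_(b < k) U i b *: pw b)) *m T) r s.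
  rewrite !mulmx_suml mulmx_sumr mulmx_suml summxE; apply: eq_bigr => a _.
  rewrite !mulmx_sumr mulmx_suml summxE; apply: eq_bigr => b _.
  by rewrite -!scalemxAl -!scalemxAr -!scalemxAl scalerA [in RHS]mxE.
rewrite !eigen_projection.
have -> : L *m (V *m delta_mx j j *m invmx V *m psi *m (V *m delta_mx i i *m invmx V)) *m T
   = (L *m V) *m delta_mx j (0 : 'I_1) *m (delta_mx 0 j *m Gam *m delta_mx i (0 : 'I_1)) *m
     (delta_mx 0 i *m (invmx V *m T)).
  by rewrite -(mul_delta_mx (0 : 'I_1) j j) -(mul_delta_mx (0 : 'I_1) i i) /Gam !mulmxA.
rewrite -colE -!rowE -colE [LHS]mxE big_ord1 [(col j _ *m _) _ _]mxE big_ord1.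
by rewrite !mxE.
Qed.

(* The Vandermonde matrix is invertible, so the k^2 products with exponents below
   [k] determine the individual terms of [L P^a psi P^b T] in the eigenbasis. *)
Lemma twist_nondegenerate : exists c d : R, [/\ 0 < c, 0 < d &
  forall (L T : 'M[R]_k) (X : nat -> nat -> 'M[R]_k),
  (forall a b, (a < k)%N -> (b < k)%N ->
     opnorm (X a b - prodm (fun=> P) a *m psi *m prodm (fun=> P) b) <= d) ->
  exists a b, [/\ (a < k)%N, (b < k)%N &
    c * (opnorm L * opnorm T) <= opnorm (L *m X a b *m T)]].
Proof.
pose K := (k * k)%:R * (k * k)%:R * (opnorm V * opnorm (invmx V)) : R.
have K0 : 0 <= K by rewrite !mulr_ge0// opnorm_ge0.
pose u := \sum_(j < k) \sum_(i < k) \sum_(a < k) \sum_(b < k) `|U j a * U i b| : R.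
have u0 : 0 <= u by do 4! (apply: sumr_ge0 => ? _).
pose gam := \big[Num.min/1]_(ji : 'I_k * 'I_k) `|Gam ji.1 ji.2| : R.
have gam0 : 0 < gam.
  apply: lt_bigmin => // -[j i] _ /=; by rewrite normr_gt0 twist_coef.
(* If all k^2 products were below c |L| |T|, the error d = c would at most double this for the exact
   products, and interpolation would give gam <= 2 * K * u * c, which is at most gam / 2 for this
   [c]. *)
pose c := gam / (4 * (K * u + 1)) : R.
have Ku : 0 < K * u + 1 by rewrite ltr_wpDl// mulr_ge0.
have c0 : 0 < c by rewrite divr_gt0// mulr_gt0.
exists c, c; split=> // L T X hX; apply: contrapT => H.
have small a b : (a < k)%N -> (b < k)%N ->
    opnorm (L *m (pw a *m psi *m pw b) *m T) <= 2 * c * (opnorm L * opnorm T).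
  move=> ak bk; have hlt : opnorm (L *m X a b *m T) < c * (opnorm L * opnorm T).
    by rewrite ltNge; apply/negP => h; apply: H; exists a, b.
  have -> : L *m (pw a *m psi *m pw b) *m T =
     L *m X a b *m T - L *m (X a b - pw a *m psi *m pw b) *m T.
    by rewrite -mulmxBl -mulmxBr opprB addrC subrK.
  rewrite (le_trans (opnormD _ _))// opnormN.
  rewrite (_ : 2 * c * _ = c * (opnorm L * opnorm T) + c * (opnorm L * opnorm T)); last by ring.
  rewrite lerD ?(ltW hlt)// (le_trans (opnormM _ _))// mulrA ler_wpM2r ?opnorm_ge0//.
  by rewrite (le_trans (opnormM _ _))// mulrC ler_wpM2r ?opnorm_ge0// hX.
have LT0 : 0 < opnorm L * opnorm T.
  have := H; have := opnorm_ge0 L; have := opnorm_ge0 T; set l := opnorm L; set t := opnorm T.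
  move=> t0 l0 _; rewrite lt_neqAle mulr_ge0// andbT; apply/negP => /eqP E.
  by apply: H; exists 0%N, 0%N; rewrite -/l -/t -E mulr0 k_gt0 opnorm_ge0.
have [r [j hL]] := opnorm_entry (L *m V).
have [i [s hT]] := opnorm_entry (invmx V *m T).
have hL' : opnorm L <= (k * k)%:R * `|(L *m V) r j| * opnorm (invmx V).
  rewrite -{1}(mulmxK eigenmx_unit L) (le_trans (opnormM _ _))//.
  by rewrite ler_wpM2r ?opnorm_ge0.
have hT' : opnorm T <= opnorm V * ((k * k)%:R * `|(invmx V *m T) i s|).
  rewrite -{1}(mulKVmx eigenmx_unit T) (le_trans (opnormM _ _))//.
  by rewrite ler_wpM2l ?opnorm_ge0.
have := twist_entry L T r j i s => /(congr1 Num.norm); rewrite !normrM => E.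
have gij : gam <= `|Gam j i| by exact: (bigmin_le_cond _ (j := (j, i))).
have up : `|(L *m V) r j| * `|Gam j i| * `|(invmx V *m T) i s| <=
    u * (2 * c * (opnorm L * opnorm T)).
  rewrite -E (le_trans (ler_norm_sum _ _ _))//.
  apply: (@le_trans _ _ (\sum_(a < k) \sum_(b < k) `|U j a * U i b| * (2 * c * (opnorm L * opnorm T)))).
    apply: ler_sum => a _; rewrite (le_trans (ler_norm_sum _ _ _))//.
    apply: ler_sum => b _; rewrite normrM ler_wpM2l//.
    by rewrite (le_trans (entry_le_opnorm _ _ _))// small.
  under eq_bigr => a _ do rewrite -mulr_suml.
  rewrite -mulr_suml ler_wpM2r//; first by apply: mulr_ge0; rewrite ?(ltW LT0)// mulr_ge0// ltW.
  rewrite /u [leRHS](bigD1 j)//= -[leLHS]addr0 lerD//; last first.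
    by do 4! (apply: sumr_ge0 => ? _).
  rewrite [leRHS](bigD1 i)//= -[leLHS]addr0 lerD//.
  by do 3! (apply: sumr_ge0 => ? _).
have lo : gam * (opnorm L * opnorm T) <=
    K * (`|(L *m V) r j| * `|Gam j i| * `|(invmx V *m T) i s|).
  apply: (@le_trans _ _ (`|Gam j i| * (opnorm L * opnorm T))).
    by rewrite ler_wpM2r// ltW.
  apply: (le_trans (ler_wpM2l (normr_ge0 _) (ler_pM (opnorm_ge0 _) (opnorm_ge0 _) hL' hT'))).
  by rewrite le_eqVlt; apply/orP; left; apply/eqP; rewrite /K; ring.
have : gam * (opnorm L * opnorm T) <= K * u * (2 * c) * (opnorm L * opnorm T).
  rewrite -[leRHS]mulrA -[leRHS]mulrA; apply: (le_trans lo).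
  by rewrite ler_wpM2l.
rewrite ler_pM2r// leNgt => /negP; apply.
apply: (@le_lt_trans _ _ ((K * u + 1) * (2 * c))).
  by rewrite ler_wpM2r ?lerDl// mulr_ge0// ltW.
rewrite /c (_ : _ * _ = gam / 2); first by lra.
by field; rewrite gt_eqF.
Qed.

End Twisting.

(** * Quasi-multiplicativity *)

Section OperatorLimits.
Variables (R : realType) (k : nat).

Lemma oplim_tail (D : nat -> 'M[R]_k) (H : 'M[R]_k) (n1 : nat) :
  oplim (fun n => D (n1 + n)%N) H -> oplim D H.
Proof.
move=> h e e0; have [n0 hn] := h e e0; exists (n1 + n0)%N => n nn.
by rewrite -(subnKC (leq_trans (leq_addr _ _) nn)); apply: hn; lia.
Qed.

Lemma oplimM (X Y H : 'M[R]_k) (D : nat -> 'M[R]_k) :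
  oplim D H -> oplim (fun n => X *m D n *m Y) (X *m H *m Y).
Proof.
move=> h e e0; have K0 : 0 < opnorm X * opnorm Y + 1.
  by rewrite ltr_wpDl// mulr_ge0// opnorm_ge0.
have [n0 hn] := h _ (divr_gt0 e0 K0); exists n0 => n /hn.
rewrite -mulmxBl -mulmxBr ler_pdivlMr// => {}hn.
rewrite (le_trans (opnormM _ _))//.
rewrite (le_trans (ler_wpM2r (opnorm_ge0 _) (opnormM _ _)))//.
apply: le_trans hn; rewrite mulrDr mulr1 mulrAC mulrC lerDl; exact: opnorm_ge0.
Qed.

Lemma opnorm_mulmx_near (X1 X2 T1 T2 : 'M[R]_k) (K1 K2 e1 e2 : R) :
  opnorm T1 <= K1 -> opnorm X2 <= K2 ->
  opnorm (X1 - T1) <= e1 -> opnorm (X2 - T2) <= e2 ->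
  opnorm (X1 *m X2 - T1 *m T2) <= e1 * K2 + K1 * e2.
Proof.
move=> h1 h2 d1 d2.
have -> : X1 *m X2 - T1 *m T2 = (X1 - T1) *m X2 + T1 *m (X2 - T2).
  by rewrite mulmxBl mulmxBr addrA subrK.
rewrite (le_trans (opnormD _ _))// lerD// (le_trans (opnormM _ _))//;
  by rewrite ler_pM ?opnorm_ge0.
Qed.

Lemma opnorm_le_near (X T : 'M[R]_k) (K e : R) :
  opnorm T <= K -> opnorm (X - T) <= e -> opnorm X <= K + e.
Proof.
move=> hT hX; have -> : X = T + (X - T) by rewrite addrC subrK.
by rewrite (le_trans (opnormD _ _))// lerD.
Qed.

Lemma opnorm_mulmx4_near (K d : R) : 0 <= K -> 0 < d -> exists2 e : R, 0 < e &
  forall X1 X2 X3 X4 T1 T2 T3 T4 : 'M[R]_k,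
  opnorm T1 <= K -> opnorm T2 <= K -> opnorm T3 <= K -> opnorm T4 <= K ->
  opnorm (X1 - T1) <= e -> opnorm (X2 - T2) <= e ->
  opnorm (X3 - T3) <= e -> opnorm (X4 - T4) <= e ->
  opnorm (X1 *m X2 *m (X3 *m X4) - T1 *m T2 *m (T3 *m T4)) <= d.
Proof.
move=> K0 d0; pose e := Num.min 1 (d / (4 * (K + 1) ^+ 3)).
have K1 : 0 < (K + 1) ^+ 3 by rewrite exprn_gt0// ltr_wpDl.
have e0 : 0 < e by rewrite lt_min ltr01 divr_gt0// mulr_gt0.
have e1 : e <= 1 by rewrite ge_min lexx.
have ed : 4 * (K + 1) ^+ 3 * e <= d.
  have K4 : 0 < 4 * (K + 1) ^+ 3 by rewrite pmulr_rgt0.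
  by rewrite mulrC -ler_pdivlMr// ge_min lexx orbT.
exists e => // X1 X2 X3 X4 T1 T2 T3 T4 t1 t2 t3 t4 x1 x2 x3 x4.
have n12 := opnorm_mulmx_near t1 (opnorm_le_near t2 x2) x1 x2.
have n34 := opnorm_mulmx_near t3 (opnorm_le_near t4 x4) x3 x4.
have b12 : opnorm (T1 *m T2) <= K * K.
  by rewrite (le_trans (opnormM _ _))// ler_pM ?opnorm_ge0.
have b34 : opnorm (X3 *m X4) <= (K + e) * (K + e).
  rewrite (le_trans (opnormM _ _))// ler_pM ?opnorm_ge0//.
    exact: opnorm_le_near t3 x3.
  exact: opnorm_le_near t4 x4.
apply: (le_trans (opnorm_mulmx_near b12 b34 n12 n34)).
apply: (le_trans _ ed); have := ltW e0; have : K + e <= K + 1 by rewrite lerD2l.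
set S := K + 1; set s := K + e => sS e0'.
have s0 : 0 <= s by rewrite addr_ge0.
have KS : K <= S by rewrite lerDl.
have h : e * s + K * e <= 2 * S * e.
  rewrite [leLHS](_ : _ = (s + K) * e); last by ring.
  by rewrite ler_wpM2r// mulr2n mulrDl mul1r lerD.
have S0 : 0 <= S by rewrite addr_ge0.
have h1 : (e * s + K * e) * (s * s) <= 2 * S * e * (S * S).
  by rewrite ler_pM ?addr_ge0 ?mulr_ge0// ler_pM.
have h2 : K * K * (e * s + K * e) <= S * S * (2 * S * e).
  by rewrite ler_pM ?addr_ge0 ?mulr_ge0// ler_pM.
by apply: (le_trans (lerD h1 h2)); rewrite le_eqVlt; apply/orP; left; apply/eqP; ring.
Qed.

End OperatorLimits.

Section Mixing.
Variables (R : realType) (q : nat) (Q : 'M[bool]_q) (omega : R).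
Hypothesis omega01 : 0 < omega < 1.

(** Cylinders given by the symbol at 0 are open and finitely many, so the maximum of their pairwise
    mixing times serves for all pairs. *)
Lemma mixing_connect : top_mixing Q omega -> exists N : nat,
  forall x y, subshift Q x -> subshift Q y ->
  exists c, [/\ subshift Q c, c 0 = x 0 & c N%:Z = y 0].
Proof.
move=> mix; pose U (a : 'I_q) : set (biseq q) := [set x | subshift Q x /\ x 0 = a].
have oU a : sopen Q omega (U a).
  split=> [x []//|x [Qx xa]]; exists 1 => // y Qy; rewrite -(expr0 omega).
  by move=> /(sdist_lt omega01) xy; split=> //; rewrite -xa; apply/esym/xy.
have /choice [N hN] : forall ab : 'I_q * 'I_q, exists N : nat,
    U ab.1 !=set0 -> U ab.2 !=set0 -> forall n, (N <= n)%N ->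
    exists c, [/\ subshift Q c, c 0 = ab.1 & c n%:Z = ab.2].
  move=> [a b] /=; have [a0|] := pselect (U a !=set0); last by exists 0%N.
  have [b0|] := pselect (U b !=set0); last by exists 0%N.
  have [N hN] := mix _ _ (oU a) (oU b) a0 b0.
  exists N => _ _ n /hN [y [[c [Qc ca] cy] [_ cb]]]; exists c; split=> //.
  by rewrite -cb -cy /Defs.shift add0r.
exists (\max_ab N ab) => x y Qx Qy.
apply: (hN (x 0, y 0)); [by exists x|by exists y|].
exact: (leq_bigmax (x 0, y 0)).
Qed.

End Mixing.

Section QuasiMultiplicativity.
Variables (R : realType) (q k : nat) (Q : 'M[bool]_q).
Variables (A : biseq q -> 'M[R]_k) (CA C rho theta : R).
Hypothesis reg : regular Q A CA C rho theta.
Variable N : nat.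
Hypothesis connect : forall x y, subshift Q x -> subshift Q y ->
  exists c, [/\ subshift Q c, c 0 = x 0 & c N%:Z = y 0].
Implicit Types x y : biseq q.

Let CA1 : 1 <= CA := reg_CA reg.
Let CA0 : 0 <= CA := le_trans ler01 CA1.
Let rho0 : 0 < rho. Proof. by case/andP: (reg_rho reg). Qed.
Let rho1 : rho < 1. Proof. by case/andP: (reg_rho reg). Qed.
Let theta0 : 0 < theta. Proof. by case/andP: (reg_theta reg). Qed.
Let theta1 : theta < 1. Proof. by case/andP: (reg_theta reg). Qed.

(** [w] follows [x] on the entire left half-line and [y] on the entire right one, not merely along
    the two words; this allows infinite iteration of the gluing and the use of bounded
    distortion. *)
Definition quasi_multiplicative := exists (G : nat) (c : R), 0 < c /\
  forall x y n m, subshift Q x -> subshift Q y -> exists w g,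
  [/\ subshift Q w, (g <= G)%N, forall i, i < n%:Z -> w i = x i,
      forall i, 0 <= i -> w (n%:Z + g%:Z + i) = y i &
      c * (cnorm A n x * cnorm A m y) <= cnorm A (n + g + m) w].

Lemma defect_oplim_tail M M' (C' : R) n1 :
  bunched CA rho theta M -> bunched CA rho theta M' -> 0 <= C' ->
  (forall j, opnorm (M (n1 + j)%N - M' (n1 + j)%N) <= C' * rho ^+ j) ->
  oplim (defect M M') (invmx (prodm M n1) *m
    (lim (defect (fun j => M (n1 + j)%N) (fun j => M' (n1 + j)%N) n @[n --> \oo]) : 'M[R]_k) *m
    prodm M' n1).
Proof.
move=> bM bM' C0 h; apply: (@oplim_tail _ _ _ _ n1).
have -> : (fun n => defect M M' (n1 + n)%N) = (fun n => invmx (prodm M n1) *m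
    defect (fun j => M (n1 + j)%N) (fun j => M' (n1 + j)%N) n *m prodm M' n1).
  apply: funext => n; rewrite /defect !prodm_add invmxM ?mulmxA//.
  - exact: prodm_unit (bunched_tail n1 bM).
  - exact: prodm_unit bM.
apply: oplimM.
exact: (defect_oplim CA1 rho0 theta0 theta1 (bunched_tail n1 bM) (bunched_tail n1 bM') C0 h).
Qed.

(** The time chosen in [Hs] merely splits a prefix off the two products, so the extended holonomy is
    still the limit of A^n(y)^-1 A^n(x). *)
Lemma Hs_oplim x y : subshift Q x -> subshift Q y -> Ws y x ->
  oplim (defect (fwd A y) (fwd A x)) (Hs A y x).
Proof.
move=> Qx Qy [n hn]; rewrite /Hs; cbv zeta; set S := [set n | _].
have : S (xget 0%N S) by apply: (@xgetPex _ 0%N S); exists n => i i0; rewrite hn.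
move: (xget 0%N S) => n1 {n hn} hn1; rewrite /S /= in hn1.
rewrite !cocycle_fwd /Hs_loc.
have T (u : biseq q) : (fun j => fwd A u (n1 + j)%N) = fwd A (shift n1%:Z u).
  by apply: funext => j; rewrite /fwd shift_shift -PoszD addnC.
have <- : (fun j => defect (fwd A (shift n1%:Z y)) (fwd A (shift n1%:Z x)) j) =
    (fun j => invmx (cocycle A j%:Z (shift n1%:Z y)) *m cocycle A j%:Z (shift n1%:Z x)).
  by apply: funext => j; rewrite !cocycle_fwd.
rewrite -!T; apply: (@defect_oplim_tail _ _ (C2 CA C)).
- exact: fwd_bunched reg _ Qy.
- exact: fwd_bunched reg _ Qx.
- exact: C2_ge0 reg.
move=> j; rewrite !(congr1 (fun f => f j) (T _)).
have Qx' := subshift_shift n1%:Z Qx; have Qy' := subshift_shift n1%:Z Qy.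
have := @fwd_close _ _ _ _ _ _ _ _ _ reg _ _ 0 j Qy' Qx'; rewrite expr0 invr1 mulr1.
by apply.
Qed.

Lemma Hu_oplim x y : subshift Q x -> subshift Q y -> Wu x y ->
  oplim (defect (bwd A y) (bwd A x)) (Hu A y x).
Proof.
move=> Qx Qy [n hn]; rewrite /Hu; cbv zeta; set S := [set n | _].
have : S (xget 0%N S) by apply: (@xgetPex _ 0%N S); exists n.
move: (xget 0%N S) => n1 {n hn} hn1; rewrite /S /= in hn1.
rewrite !cocycle_bwd /Hu_loc.
have T (u : biseq q) : (fun j => bwd A u (n1 + j)%N) = bwd A (shift (- n1%:Z) u).
  apply: funext => j; rewrite /bwd shift_shift; congr (invmx (A (shift _ u))); lia.
have <- : (fun j => defect (bwd A (shift (- n1%:Z) y)) (bwd A (shift (- n1%:Z) x)) j) =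
    (fun j => invmx (cocycle A (- j%:Z) (shift (- n1%:Z) y)) *m
      cocycle A (- j%:Z) (shift (- n1%:Z) x)).
  by apply: funext => j; rewrite !cocycle_bwd.
rewrite -!T; apply: (@defect_oplim_tail _ _ (C2 CA C)).
- exact: bwd_bunched reg _ Qy.
- exact: bwd_bunched reg _ Qx.
- exact: C2_ge0 reg.
move=> j; rewrite !(congr1 (fun f => f j) (T _)).
have Qx' := subshift_shift (- n1%:Z) Qx; have Qy' := subshift_shift (- n1%:Z) Qy.
have := @bwd_close _ _ _ _ _ _ _ _ _ reg _ _ 0 j Qy' Qx'; rewrite expr0 invr1 mulr1; apply.
by move=> i i0; apply: hn1; lia.
Qed.

End QuasiMultiplicativity.

(** * Splicing orbits through the periodic and the homoclinic point *)

Section Gluing.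
Variables (q : nat) (Q : 'M[bool]_q) (N : nat).
Hypothesis connect : forall x y : biseq q, subshift Q x -> subshift Q y ->
  exists c, [/\ subshift Q c, c 0 = x 0 & c N%:Z = y 0].
Implicit Types x y p z : biseq q.

Lemma glue_future p x (n : nat) : subshift Q p -> subshift Q x ->
  exists px, [/\ subshift Q px, forall i, 0 <= i -> px i = p i &
    forall i, i < - N%:Z -> px i = x (i + n%:Z + N%:Z)].
Proof.
move=> Qp Qx; have [cx [Qcx cx0 cxN]] := connect (subshift_shift n%:Z Qx) Qp.
have {}cx0 : cx 0 = x n%:Z by rewrite cx0 /Defs.shift add0r.
exists (splice (splice (shift (n + N)%N%:Z x) (shift N%:Z cx) (- N%:Z)) p 0); split.
- apply: subshift_splice => //; last first.
    rewrite /splice; case: ltP => h; last by rewrite /Defs.shift add0r.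
    by exfalso; lia.
  apply: subshift_splice; try exact: subshift_shift.
  rewrite /Defs.shift addNr cx0; congr x; lia.
- by move=> i i0; rewrite /splice; case: ltP => // h; exfalso; lia.
- move=> i h; rewrite /splice; case: ifPn => h'; last by exfalso; lia.
  by rewrite h /Defs.shift PoszD addrA.
Qed.

Lemma glue_past p y : subshift Q p -> subshift Q y ->
  exists py, [/\ subshift Q py, forall i, i <= 0 -> py i = p i &
    forall i, N%:Z <= i -> py i = y (i - N%:Z)].
Proof.
move=> Qp Qy; have [cy [Qcy cy0 cyN]] := connect Qp Qy.
exists (splice p (splice cy (shift (- N%:Z) y) N%:Z) 0); split.
- apply: subshift_splice => //.
    apply: subshift_splice => //; first exact: subshift_shift.
    by rewrite cyN /Defs.shift subrr.
  rewrite /splice /Defs.shift; case: ltP => h; first by rewrite cy0.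
  (* For N = 0 the connecting word is empty and the symbols of [p] and [y] at 0 coincide. *)
  have N0 : N%:Z = 0 by lia.
  by rewrite N0 subr0 -cyN N0 cy0.
- move=> i h; rewrite /splice; case: ifPn => // h'.
  have -> : i = 0 by lia.
  case: ifPn => h''; first by rewrite cy0.
  have N0 : N%:Z = 0 by lia.
  by rewrite /Defs.shift N0 subr0 -cyN N0 cy0.
- move=> i h; rewrite /splice; case: ifPn => h'; first by exfalso; lia.
  by case: ifPn => h'' //; exfalso; lia.
Qed.

(** Near n0 and -n0 the points z, X, Y all coincide with p, which permits the splices. Having the
    future of Y, the past of X and a long window of z, the point W has a forward defect from Y close
    to the stable holonomy from z to p, and a backward defect close to the unstable one from p to
    z. *)
Lemma glue_middle p z X Y (n0 al be : nat) :
  subshift Q z -> subshift Q X -> subshift Q Y ->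
  (forall i, n0%:Z <= i -> z i = p i) -> (forall i, i <= - n0%:Z -> z i = p i) ->
  (forall i, - be%:Z <= i -> X i = p i) -> (forall i, i <= al%:Z -> Y i = p i) ->
  (n0 <= al)%N -> (n0 <= be)%N ->
  exists W, [/\ subshift Q W, forall i, n0%:Z <= i -> W i = Y i,
    forall i, i < - n0%:Z -> W i = X i &
    forall i, - be%:Z <= i <= al%:Z -> W i = z i].
Proof.
move=> Qz QX QY zf zp XP YP ha hb.
exists (splice X (splice z Y n0%:Z) (- n0%:Z)); split.
- apply: subshift_splice => //.
    by apply: subshift_splice => //; rewrite YP ?zf//; lia.
  rewrite XP; last by lia.
  rewrite /splice; case: ifPn => h; first by rewrite zp.
  by rewrite YP//; lia.
- move=> i h; rewrite /splice; case: ifPn => h'; first by exfalso; lia.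
  by case: ifPn => h'' //; exfalso; lia.
- by move=> i h; rewrite /splice h.
- move=> i /andP[i1 i2]; rewrite /splice; case: ifPn => h'.
    by rewrite XP// zp//; lia.
  by case: ifPn => // h''; rewrite YP// zf//; lia.
Qed.

Lemma agree_shift_fwd x y (al be j m : nat) :
  (forall i, - be%:Z <= i <= al%:Z -> x i = y i) -> (j + m <= al)%N -> (m <= be)%N ->
  agree (shift j%:Z x) (shift j%:Z y) m.
Proof. by move=> h h1 h2 i im; apply: h; apply/andP; split; lia. Qed.

Lemma agree_shift_bwd x y (al be j m : nat) :
  (forall i, - be%:Z <= i <= al%:Z -> x i = y i) -> (j + m < be)%N -> (m <= al)%N ->
  agree (shift (- j.+1%:Z) x) (shift (- j.+1%:Z) y) m.
Proof. by move=> h h1 h2 i im; apply: h; apply/andP; split; lia. Qed.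

End Gluing.

(** * Quasi-multiplicativity from the homoclinic excursion *)

Section QuasiMultTwist.
Variables (R : realType) (q k : nat) (Q : 'M[bool]_q).
Variables (A : biseq q -> 'M[R]_k) (CA C rho theta : R).
Hypothesis reg : regular Q A CA C rho theta.
Variable N : nat.
Hypothesis connect : forall x y, subshift Q x -> subshift Q y ->
  exists c, [/\ subshift Q c, c 0 = x 0 & c N%:Z = y 0].
Implicit Types x y : biseq q.

Let CA1 : 1 <= CA := reg_CA reg.
Let CA0 : 0 <= CA := le_trans ler01 CA1.
Let rho0 : 0 < rho. Proof. by case/andP: (reg_rho reg). Qed.
Let rho1 : rho < 1. Proof. by case/andP: (reg_rho reg). Qed.
Let theta0 : 0 < theta. Proof. by case/andP: (reg_theta reg). Qed.
Let theta1 : theta < 1. Proof. by case/andP: (reg_theta reg). Qed.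

Variables (p z : biseq q) (per n0 : nat) (Hs' Hu' : 'M[R]_k).
Hypotheses (Qp : subshift Q p) (Qz : subshift Q z).
Hypotheses (per_gt0 : (0 < per)%N) (p_per : shift per%:Z p = p).
Hypothesis z_future : forall i, n0%:Z <= i -> z i = p i.
Hypothesis z_past : forall i, i <= - n0%:Z -> z i = p i.
Hypothesis limHs : oplim (defect (fwd A p) (fwd A z)) Hs'.
Hypothesis limHu : oplim (defect (bwd A z) (bwd A p)) Hu'.

Let P := prodm (fwd A p) per.

Hypothesis twist : exists c d : R, [/\ 0 < c, 0 < d &
  forall (L T : 'M[R]_k) (X : nat -> nat -> 'M[R]_k),
  (forall a b, (a < k)%N -> (b < k)%N ->
     opnorm (X a b - prodm (fun=> P) a *m (Hs' *m Hu') *m prodm (fun=> P) b) <= d) ->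
  exists a b, [/\ (a < k)%N, (b < k)%N &
    c * (opnorm L * opnorm T) <= opnorm (L *m X a b *m T)]].

Lemma shift_period a : shift (a * per)%N%:Z p = p.
Proof.
elim: a => [|a IH]; first by rewrite mul0n shift0.
by rewrite mulSn PoszD addrC -shift_shift p_per IH.
Qed.

Lemma periodD a i : p (i + (a * per)%N%:Z) = p i.
Proof. by rewrite -{2}(shift_period a). Qed.

Lemma periodB a i : p (i - (a * per)%N%:Z) = p i.
Proof. by rewrite -{2}(subrK (a * per)%N%:Z i) periodD. Qed.

Lemma prodm_period a : prodm (fwd A p) (a * per) = prodm (fun=> P) a.
Proof.
elim: a => //= a IH; rewrite mulSn addnC prodm_fwd_split shift_period.
by rewrite IH.
Qed.

(* The connecting word follows [x], then [p] for [N1 + b] periods, then the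
   homoclinic excursion [z], then [p] again for [N1 + a] periods, and finally
   joins [y]; [N1] is large but fixed and [a, b < k] are chosen by [twist]. *)
Lemma twist_quasi_multiplicative : quasi_multiplicative Q A.
Proof.
have [c [d [c0 d0 HT]]] := twist.
(* Bounds the norms of all four ideal factors P^a, Hs', Hu', P^b with a, b < k. *)
pose K := 1 + CA ^+ (k * per) + opnorm Hs' + opnorm Hu'.
have CAk0 : 0 <= CA ^+ (k * per) by rewrite exprn_ge0.
have K0 : 0 <= K by rewrite !addr_ge0// opnorm_ge0.
have [e e0 He] := @opnorm_mulmx4_near R k K d K0 d0.
have C20 : 0 <= C2 CA C := C2_ge0 reg.
pose C' := C2 CA C * rho ^- n0.
have C'0 : 0 <= C' by rewrite mulr_ge0// invr_ge0 exprn_ge0// ltW.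
have bF x (Qx : subshift Q x) := fwd_bunched reg Qx.
have bB x (Qx : subshift Q x) := bwd_bunched reg Qx.
have [B1 [d1 [d10 h1]]] := defect_uniform CA1 rho0 theta0 theta1
  (bF _ Qp) (bF _ Qz) C'0 e0 limHs.
have [B2 [d2 [d20 h2]]] := defect_uniform CA1 rho0 theta0 theta1
  (bB _ Qz) (bB _ Qp) C'0 e0 limHu.
(* Accuracy of single factors that keeps a product over at most k periods within [e] of the power of
   P, by [prodm_near]. *)
pose e3 := e / ((k * per)%:R * CA ^+ (k * per) + 1).
have D0 : 0 < (k * per)%:R * CA ^+ (k * per) + 1 :> R by rewrite ltr_wpDl// mulr_ge0.
have e30 : 0 < e3 by rewrite divr_gt0.
have [me [hm1 hm2 hm3]] : exists me, [/\ C2 CA C * rho ^+ me <= d1,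
    C2 CA C * rho ^+ me <= d2 & C2 CA C * rho ^+ me <= e3].
  have : (fun n => C2 CA C * rho ^+ n) @ \oo --> (0 : R).
    by apply: cvg_geometric; rewrite ger0_norm ?ltW.
  have m0 : 0 < Num.min (Num.min d1 d2) e3 by rewrite !lt_min d10 d20.
  move=> /cvgr0Pnorm_le /(_ _ m0) [n _ hn]; exists n.
  have := le_trans (ler_norm _) (hn n (leqnn _)); rewrite !le_min.
  by move=> /andP[/andP[-> ->] ->].
(* So many periods of p on both sides that the radius-[me] windows at the first [B1] forward and
   [B2] backward times stay where the orbits follow p or z, and that the splices at n0 and -n0 lie
   inside. *)
pose N1 := (n0 + B1 + B2 + me).+1.
pose NP := (N1 * per)%N.
have NP1 : (n0 + B1 + B2 + me < NP)%N by rewrite /NP; apply: leq_pmulr.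
have Kd0 : 0 < Kd CA C theta by exact: lt_le_trans ltr01 (Kd_ge1 reg).
have CAp j : 0 < CA ^+ j by rewrite exprn_gt0// (lt_le_trans ltr01).
(* On each side, passing from the given word to [T] or [L] adds NP + N factors of A and alters the
   half-orbit beyond the word; these cost CA^(NP + N) and [Kd]. *)
pose cc := c / ((CA ^+ (NP + N) * Kd CA C theta) * (CA ^+ (NP + N) * Kd CA C theta)).
exists (2 * N + 2 * (NP + k * per))%N, cc; split.
  by rewrite divr_gt0// !mulr_gt0.
move=> x y n m Qx Qy.
have [px [Qpx pxP pxx]] := glue_future connect n Qp Qx.
have [py [Qpy pyP pyy]] := glue_past connect Qp Qy.
(* [NP] is a multiple of the period, so these shifts preserve the phase of p. *)
pose X b := shift (NP + b * per)%N%:Z px.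
pose Y a := shift (- (NP + a * per)%N%:Z) py.
have XP b i : - (NP + b * per)%N%:Z <= i -> X b i = p i.
  move=> h; rewrite /X /Defs.shift pxP; last by rewrite -lerBlDr sub0r.
  by rewrite /NP -mulnDl periodD.
have YP a i : i <= (NP + a * per)%N%:Z -> Y a i = p i.
  move=> h; rewrite /Y /Defs.shift pyP; last by rewrite subr_le0.
  by rewrite /NP -mulnDl periodB.
have QX b : subshift Q (X b) by exact: subshift_shift.
have QY a : subshift Q (Y a) by exact: subshift_shift.
have n0P a : (n0 <= NP + a * per)%N by clear -NP1; lia.
have /choice [W' HW] : forall ab : nat * nat, exists W, [/\ subshift Q W,
    forall i, n0%:Z <= i -> W i = Y ab.1 i, forall i, i < - n0%:Z -> W i = X ab.2 i &
    forall i, - (NP + ab.2 * per)%N%:Z <= i <= (NP + ab.1 * per)%N%:Z -> W i = z i].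
  move=> [a b]; exact: (glue_middle Qz (QX b) (QY a) z_future z_past (@XP b) (@YP a)).
pose W a b := W' (a, b).
have WY a b i : n0%:Z <= i -> W a b i = Y a i by case: (HW (a, b)) => _ h _ _; exact: h.
have WX a b i : i < - n0%:Z -> W a b i = X b i by case: (HW (a, b)) => _ _ h _; exact: h.
have Wz a b i : - (NP + b * per)%N%:Z <= i <= (NP + a * per)%N%:Z -> W a b i = z i.
  by case: (HW (a, b)) => _ _ _; exact.
have QW a b : subshift Q (W a b) by case: (HW (a, b)).
pose sL := shift (- NP%:Z) py.
pose sR := shift (- (n + N)%N%:Z) px.
have QsL : subshift Q sL by exact: subshift_shift.
have QsR : subshift Q sR by exact: subshift_shift.
(* The twisting estimate needs [L] and [T] independent of a and b. The variable numbers of periods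
   are therefore moved into [Xi], next to the two defects. *)
pose L := prodm (fwd A sL) (NP + N + m).
pose T := prodm (fwd A sR) (n + (N + NP)).
pose M1 a := (NP + a * per + (N + m))%N.
pose M2 b := (NP + b * per + (n + N))%N.
pose Xi a b := prodm (fwd A (Y a)) (a * per) *m defect (fwd A (Y a)) (fwd A (W a b)) (M1 a)
   *m (defect (bwd A (W a b)) (bwd A (X b)) (M2 b) *m
       prodm (fwd A (shift (NP%:Z) px)) (b * per)).
have powb a : (a < k)%N -> (a * per <= k * per)%N by move=> ak; rewrite leq_mul2r ltnW ?orbT.
have powK a : (a < k)%N -> opnorm (prodm (fun=> P) a) <= K.
  move=> ak; rewrite -prodm_period (le_trans (opnorm_prodm _ (bF _ Qp)))//.
  apply: (@le_trans _ _ (CA ^+ (k * per))); first by rewrite ler_weXn2l// powb.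
  rewrite /K -addrA -addrA addrCA lerDl !addr_ge0//; exact: opnorm_ge0.
have near_p s a : subshift Q s -> (a < k)%N ->
    (forall j, (j < a * per)%N -> agree (shift j%:Z s) (shift j%:Z p) me) ->
    opnorm (prodm (fwd A s) (a * per) - prodm (fun=> P) a) <= e.
  move=> Qs ak h; rewrite -prodm_period.
  apply: (le_trans (@prodm_near _ _ CA rho theta CA1 _ _ e3 _ (bF _ Qs) (bF _ Qp) _)).
    by move=> j ja; apply: le_trans hm3; apply: (fwd_near reg) => //; exact: h.
  rewrite /e3 mulrA ler_pdivrMr// mulrC ler_wpM2l ?(ltW e0)//.
  apply: (@le_trans _ _ ((k * per)%:R * CA ^+ (k * per))); last by rewrite lerDl.
  by rewrite ler_pM ?exprn_ge0// ?ler_nat ?powb// ler_weXn2l// powb.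
have hXi a b : (a < k)%N -> (b < k)%N ->
    opnorm (Xi a b - prodm (fun=> P) a *m (Hs' *m Hu') *m prodm (fun=> P) b) <= d.
  move=> ak bk; rewrite mulmxA -[X in _ - X]mulmxA; apply: He.
  - exact: powK.
  - by rewrite /K addrAC lerDr !addr_ge0// opnorm_ge0.
  - by rewrite /K lerDr !addr_ge0// opnorm_ge0.
  - exact: powK.
  - apply: near_p => // j ja; apply: (agree_shift_fwd (al := NP + a * per) (be := me)) => //.
      by move=> i /andP[_]; exact: YP.
    by clear -ja NP1; lia.
  - apply: h1; try exact: bF; first by rewrite /M1; clear -NP1; lia.
    + by move=> j _; apply: (fwd_close reg) => // i hi; rewrite WY.
    + move=> j jB; apply: le_trans hm1; apply: (fwd_near reg) => //.
      apply: (agree_shift_fwd (al := NP + a * per) (be := me)) => //.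
        by move=> i /andP[_]; exact: YP.
      by clear -jB NP1; lia.
    + move=> j jB; apply: le_trans hm1; apply: (fwd_near reg) => //.
      apply: (agree_shift_fwd (@Wz a b)); clear -jB NP1; lia.
  - apply: h2; try exact: bB; first by rewrite /M2; clear -NP1; lia.
    + by move=> j _; apply: (bwd_close reg) => // i hi; rewrite WX.
    + move=> j jB; apply: le_trans hm2; apply: (bwd_near reg) => //.
      apply: (agree_shift_bwd (@Wz a b)); clear -jB NP1; lia.
    + move=> j jB; apply: le_trans hm2; apply: (bwd_near reg) => //.
      apply: (agree_shift_bwd (al := me) (be := NP + b * per)) => //.
        by move=> i /andP[+ _]; exact: XP.
      by clear -jB NP1; lia.
  - apply: near_p => //; first exact: subshift_shift.
    move=> j ja; apply: (agree_shift_fwd (al := j + me) (be := NP)) => //.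
      move=> i /andP[hi _]; rewrite /Defs.shift pxP ?periodD//.
      by rewrite -lerBlDr sub0r.
    by clear -NP1; lia.
have [a [b [ak bk]]] := HT L T Xi hXi.
pose w := shift (- (M2 b)%:Z) (W a b).
have Qw : subshift Q w by exact: subshift_shift.
pose g := (2 * N + (NP + a * per) + (NP + b * per))%N.
have Mg : (M2 b + M1 a = n + g + m)%N by rewrite /M1 /M2 /g; clear; lia.
(* The defects are exact correction factors: one replaces the forward product along Y by that along
   W, the other does the same for the backward product along X, so no approximation enters this
   identity. *)
have -> : L *m Xi a b *m T = prodm (fwd A w) (n + g + m).
  have EF : prodm (fwd A (W a b)) (M1 a) = L *m (prodm (fwd A (Y a)) (a * per) *m
      defect (fwd A (Y a)) (fwd A (W a b)) (M1 a)).
    have -> : prodm (fwd A (W a b)) (M1 a) = prodm (fwd A (Y a)) (M1 a) *m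
        defect (fwd A (Y a)) (fwd A (W a b)) (M1 a) by apply: prodm_defect; exact: bF.
    rewrite mulmxA; congr (_ *m _).
    have -> : (M1 a = a * per + (NP + N + m))%N by rewrite /M1; clear; lia.
    rewrite prodm_fwd_split; congr (prodm (fwd A _) _ *m _).
    by rewrite /Y /sL shift_shift; congr (shift _ py); clear; lia.
  have EB : prodm (fwd A w) (M2 b) = defect (bwd A (W a b)) (bwd A (X b)) (M2 b) *m
       prodm (fwd A (shift (NP%:Z) px)) (b * per) *m T.
    have -> : prodm (fwd A w) (M2 b) = invmx (prodm (bwd A (W a b)) (M2 b)).
      by rewrite (prodm_bwd reg)// invmxK.
    rewrite /defect -mulmxA -mulmxA.
    have -> : prodm (fwd A (shift NP%:Z px)) (b * per) *m T =
        invmx (prodm (bwd A (X b)) (M2 b)).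
      rewrite (prodm_bwd reg)// invmxK.
      have -> : (M2 b = (n + (N + NP)) + b * per)%N by rewrite /M2; clear; lia.
      rewrite prodm_fwd_split; congr (prodm (fwd A _) _ *m prodm (fwd A _) _).
        by rewrite /X !shift_shift; congr (shift _ px); clear; lia.
      by rewrite /X /sR !shift_shift; congr (shift _ px); clear; lia.
    by rewrite mulmxV ?mulmx1//; apply: prodm_unit (bB _ (QX b)).
  rewrite -Mg prodm_fwd_split EB.
  have -> : shift (M2 b)%:Z w = W a b by rewrite /w shift_shift addrN shift0.
  by rewrite EF /Xi !mulmxA.
move=> hfin; exists w, g; split=> //.
- have := powb a ak; have := powb b bk; rewrite /g; clear; lia.
- move=> i hi; rewrite /w /Defs.shift WX; last by rewrite /M2; clear -hi NP1; lia.
  rewrite /X /Defs.shift pxx; last by rewrite /M2; clear -hi; lia.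
  by congr x; rewrite /M2; clear; lia.
- move=> i hi; rewrite /w /Defs.shift WY; last by rewrite /M2 /g; clear -hi NP1; lia.
  rewrite /Y /Defs.shift pyy; last by rewrite /M2 /g; clear -hi; lia.
  by congr y; rewrite /M2 /g; clear; lia.
apply: le_trans hfin.
have HL : cnorm A m y <= CA ^+ (NP + N) * Kd CA C theta * opnorm L.
  have := cnorm_le_addl reg (NP + N) m QsL; rewrite -/(cnorm A _ _) => hL.
  have QsL' := subshift_shift (NP + N)%N%:Z QsL.
  apply: (le_trans (cnorm_future reg m Qy QsL' _)).
    move=> i i0; rewrite /sL shift_shift /Defs.shift pyy; last by clear -i0; lia.
    by congr y; clear; lia.
  by rewrite [leRHS]mulrAC ler_wpM2r// ltW.
have HR : cnorm A n x <= CA ^+ (NP + N) * Kd CA C theta * opnorm T.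
  have := cnorm_le_addr reg n (N + NP) QsR => hT.
  apply: (le_trans (cnorm_past reg Qx QsR _)).
    move=> i i0; rewrite /sR /Defs.shift pxx; last by clear -i0; lia.
    by congr x; clear; lia.
  rewrite [leRHS]mulrAC ler_wpM2r ?(ltW Kd0)//.
  by rewrite addnC.
rewrite /cc mulrAC ler_pdivrMr ?mulr_gt0// -[leRHS]mulrA ler_wpM2l ?(ltW c0)//.
apply: (le_trans (ler_pM (cnorm_ge0 _ _ _) (cnorm_ge0 _ _ _) HR HL)).
by rewrite le_eqVlt; apply/orP; left; apply/eqP; ring.
Qed.

End QuasiMultTwist.

Section TypicalQuasiMult.
Variables (R : realType) (q k : nat) (Q : 'M[bool]_q).
Variables (A : biseq q -> 'M[R]_k) (CA C rho theta : R).
Hypothesis reg : regular Q A CA C rho theta.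
Variable N : nat.
Hypothesis connect : forall x y, subshift Q x -> subshift Q y ->
  exists c, [/\ subshift Q c, c 0 = x 0 & c N%:Z = y 0].

Lemma one_typical_quasi_multiplicative (p z : biseq q) (lam : 'I_k -> R)
    (v : 'I_k -> 'cV[R]_k) : (0 < k)%N ->
  one_typical_at Q A p z lam v -> quasi_multiplicative Q A.
Proof.
move=> k0 [[Qp Qz _ Wsz Wuz] [per [per0 pper _] [_ lam_inj veig]] tw].
have [n hn] := Wsz; have [m hm] := Wuz.
(* The successor accounts for the strict inequality in [Wuloc]: z and p agree only at i < -m. *)
apply: (twist_quasi_multiplicative (n0 := (n + m).+1) reg connect Qp Qz per0 pper _ _
  (Hs_oplim reg Qz Qp Wsz) (Hu_oplim reg Qp Qz Wuz)).
- move=> i hi; have := hn (i - n%:Z); rewrite /Defs.shift subrK; apply.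
  by clear -hi; lia.
- move=> i hi; have := hm (i + m%:Z); rewrite /Defs.shift addrK; apply.
  by clear -hi; lia.
- apply: (@twist_nondegenerate R k k0 _ _ lam v) => //.
  + by move=> i j ij; apply: lam_inj; rewrite ij.
  + by move=> i; rewrite -(cocycle_fwd A).
Qed.

(** In dimension one the norm is multiplicative, so any connecting word of length N works;
    distortion and the N connecting factors give the constant. *)
Lemma mx1_quasi_multiplicative : k = 1%N -> quasi_multiplicative Q A.
Proof.
move=> k1.
have nM (X Y : 'M[R]_k) : opnorm (X *m Y) = opnorm X * opnorm Y.
  have E (M : 'M[R]_1) : opnorm M = `|M 0 0|.
    apply/eqP; rewrite eq_le entry_le_opnorm andbT.
    by rewrite (le_trans (opnorm_le_sum _))// !big_ord1.
  by move: X Y; rewrite k1 => X Y; rewrite !E mxE big_ord1 normrM.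
have CA0 : 0 < CA by exact: lt_le_trans ltr01 (reg_CA reg).
have Kd0 : 0 < Kd CA C theta by exact: lt_le_trans ltr01 (Kd_ge1 reg).
pose c := (Kd CA C theta * Kd CA C theta * CA ^+ N)^-1.
have c0 : 0 < c by rewrite invr_gt0 !mulr_gt0// exprn_gt0.
exists N, c; split => // x y n m Qx Qy.
have [px [Qpx pxP pxx]] := glue_future connect n Qy Qx.
pose w := shift (- (n + N)%N%:Z) px.
have Qw : subshift Q w by exact: subshift_shift.
have wx i : i < n%:Z -> w i = x i.
  move=> hi; rewrite /w /Defs.shift pxx; last by clear -hi; lia.
  by congr x; clear; lia.
have wy i : 0 <= i -> w (n%:Z + N%:Z + i) = y i.
  move=> hi; rewrite /w /Defs.shift pxP; last by clear -hi; lia.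
  by congr y; clear; lia.
exists w, N; split=> //.
have Qw' j : subshift Q (shift j w) by exact: subshift_shift.
have -> : cnorm A (n + N + m) w = cnorm A m (shift (n + N)%N%:Z w) *
    (cnorm A N (shift n%:Z w) * cnorm A n w).
  by rewrite /cnorm !prodm_fwd_split !nM.
have hx : cnorm A n x <= cnorm A n w * Kd CA C theta.
  by apply: (cnorm_past reg) => // i hi; rewrite wx.
have hy : cnorm A m y <= cnorm A m (shift (n + N)%N%:Z w) * Kd CA C theta.
  apply: (cnorm_future reg) => // i hi.
  by rewrite /Defs.shift addrC PoszD wy.
have hN : 1 <= CA ^+ N * cnorm A N (shift n%:Z w).
  apply: le_trans (cnorm_le_addr reg 0 N (Qw' _)).
  have := nM 1%:M 1%:M; rewrite mulmx1 /cnorm /= => /eqP.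
  rewrite -[X in X == _]mul1r -subr_eq0 -mulrBl mulf_eq0 => /orP[|/eqP E].
    by rewrite subr_eq0 => /eqP <-.
  have k0 : (0 < k)%N by rewrite k1.
  by have := opnorm_unit_gt0 k0 (unitmx1 R k); rewrite E ltxx.
rewrite /c mulrC ler_pdivrMr ?mulr_gt0 ?exprn_gt0//.
apply: (le_trans (ler_pM (cnorm_ge0 _ _ _) (cnorm_ge0 _ _ _) hx hy)).
have := ler_wpM2l _ hN => /(_ (cnorm A n w * Kd CA C theta *
   (cnorm A m (shift (n + N)%N%:Z w) * Kd CA C theta))).
rewrite mulr1 => /(_ _)/le_trans; apply.
  by rewrite !mulr_ge0 ?cnorm_ge0 ?(ltW Kd0).
by rewrite le_eqVlt; apply/orP; left; apply/eqP; ring.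
Qed.

End TypicalQuasiMult.

Lemma typical_quasi_multiplicative (R : realType) (q k : nat) (Q : 'M[bool]_q)
    (omega r : R) (A : biseq q -> 'M[R]_k) :
  (0 < k)%N -> 0 < omega < 1 -> 0 < r -> top_mixing Q omega ->
  typical Q omega r A ->
  exists CA C theta, regular Q A CA C (omega `^ r) theta /\ quasi_multiplicative Q A.
Proof.
move=> k0 w01 r0 mix [hb [p [z [lam [v typ]]]]].
have [CA [C [theta reg]]] := Hb_regular w01 r0 hb.
have [N conn] := mixing_connect w01 mix.
exists CA, C, theta; split=> //.
(* For k = 1 the range 1 <= t <= k - 1 in [typical] is empty and provides no homoclinic point. *)
have [k1|k1] := eqVneq k 1%N; first exact: (mx1_quasi_multiplicative reg conn k1).
have [one _] := typ 1%N ltac:(by move: k0 k1; clear; lia).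
exact: (one_typical_quasi_multiplicative reg conn k0 one).
Qed.

(** * Bowen entropy *)

Section BowenEntropy.
Variables (R : realType) (q : nat) (Q : 'M[bool]_q) (omega : R).
Hypothesis omega01 : 0 < omega < 1.
Implicit Types (x y : biseq q) (Y : set (biseq q)).

Let w0 : 0 < omega. Proof. by case/andP: omega01. Qed.
Let w1 : omega < 1. Proof. by case/andP: omega01. Qed.

Lemma bowen_sum_N_ge0 Y (s eps : R) N : (0 <= bowen_sum_N Q omega Y s eps N)%E.
Proof.
apply: le_ereal_inf_tmp => _ [I [x [n [_ ->]]]].
by apply: esum_ge0 => i _; rewrite lee_fin expR_ge0.
Qed.

Lemma bowen_sum_N_nondecreasing Y (s eps : R) :
  nondecreasing_seq (bowen_sum_N Q omega Y s eps).
Proof.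
move=> N N' NN'; apply: le_ereal_inf => _ [I [x [n [[h1 h2] ->]]]].
exists I, x, n; split=> //; split=> // i /h1 [Qx Nn]; split=> //.
exact: leq_trans NN' Nn.
Qed.

Lemma bowen_sumE Y (s eps : R) :
  bowen_sum Q omega Y s eps = ereal_sup (range (bowen_sum_N Q omega Y s eps)).
Proof.
apply/cvg_lim; first exact: ereal_hausdorff.
exact/ereal_nondecreasing_cvgn/bowen_sum_N_nondecreasing.
Qed.

Lemma bowen_sum_N_le Y (s eps : R) N :
  (bowen_sum_N Q omega Y s eps N <= bowen_sum Q omega Y s eps)%E.
Proof. by rewrite bowen_sumE; apply: ereal_sup_ubound; exists N. Qed.

Lemma bowen_sum_ge0 Y (s eps : R) : (0 <= bowen_sum Q omega Y s eps)%E.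
Proof. exact: le_trans (bowen_sum_N_ge0 _ _ _ 0) (bowen_sum_N_le _ _ _ 0). Qed.

Lemma bowen_sum_eps Y (s eps eps' : R) : eps <= eps' ->
  (bowen_sum Q omega Y s eps' <= bowen_sum Q omega Y s eps)%E.
Proof.
move=> ee'; rewrite bowen_sumE; apply: ge_ereal_sup => _ [N _ <-].
apply: le_trans (bowen_sum_N_le _ _ _ N).
apply: le_ereal_inf => _ [I [x [n [[h1 h2] ->]]]].
exists I, x, n; split=> //; split=> // y /h2 [i Ii [Qy hy]]; exists i => //.
by split=> //; exact: lt_le_trans hy ee'.
Qed.

Lemma htop_eps_antitone Y (eps eps' : R) : eps <= eps' ->
  (htop_eps Q omega Y eps' <= htop_eps Q omega Y eps)%E.
Proof.
move=> ee'; apply: le_ereal_inf => _ [s [s0 hs] <-]; exists s => //; split=> //.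
by apply/eqP; rewrite eq_le bowen_sum_ge0 andbT -hs bowen_sum_eps.
Qed.

Lemma htop_eps_ge0 Y (eps : R) : (0 <= htop_eps Q omega Y eps)%E.
Proof. by apply: le_ereal_inf_tmp => _ [s [s0 _] <-]; rewrite lee_fin. Qed.

Lemma htopE Y : htop Q omega Y =
  ereal_sup (htop_eps Q omega Y @` [set eps : R | 0 < eps]).
Proof.
apply/cvg_lim; first exact: ereal_hausdorff.
have := @nonincreasing_at_right_cvge R (htop_eps Q omega Y) 0 (BInfty R false).
have -> : [set` Interval (BRight (0 : R)) (BInfty R false)] = [set eps : R | 0 < eps].
  by apply/seteqP; split=> x /=; rewrite in_itv/= ?andbT.
apply=> // x y _ _; exact: htop_eps_antitone.
Qed.

Lemma htop_eps_le Y (eps : R) : 0 < eps -> (htop_eps Q omega Y eps <= htop Q omega Y)%E.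
Proof. by move=> e0; rewrite htopE; apply: ereal_sup_ubound; exists eps. Qed.

Lemma htop_ge0 Y : (0 <= htop Q omega Y)%E.
Proof. exact: le_trans (htop_eps_ge0 _ 1) (htop_eps_le _ ltr01). Qed.

Lemma htop_lt Y (s : \bar R) : (s < htop Q omega Y)%E ->
  exists2 eps : R, 0 < eps & (s < htop_eps Q omega Y eps)%E.
Proof. by rewrite htopE => /ereal_sup_gt[_ [e e0 <-] se]; exists e. Qed.

Definition window (m n : nat) x y :=
  forall l : int, - m%:Z <= l < (n + m)%N%:Z -> x l = y l.

Lemma bowen_dist_window (m n : nat) x y (eps : R) : omega ^+ m < eps ->
  window m n x y -> bowen_dist omega n x y < eps.
Proof.
move=> me h; apply: bigmax_lt; first exact: le_lt_trans (exprn_ge0 _ (ltW w0)) me.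
move=> j _; apply: le_lt_trans me; apply: sdist_le => // i im; apply: h.
by have := ltn_ord j; move: im; clear; lia.
Qed.

Lemma bowen_dist_agree (n : nat) x y (eps : R) : eps <= 1 ->
  bowen_dist omega n x y < eps -> forall l : nat, (l < n)%N -> x l%:Z = y l%:Z.
Proof.
move=> e1 h l ln.
have : sdist omega (shift l%:Z x) (shift l%:Z y) < omega ^+ 0.
  apply: le_lt_trans (lt_le_trans h e1).
  exact: (le_bigmax_cond _ (fun j : 'I_n => sdist omega (shift j%:Z x) (shift j%:Z y))
    (j := Ordinal ln)).
by move=> /(sdist_lt omega01) /(_ 0 isT); rewrite /Defs.shift add0r.
Qed.

(** One representative for each word of length n + 2m seen in [Z]; the family is both separated and
    spanning. *)
Lemma patterns (Z : set (biseq q)) (m n : nat) : exists (cnt : nat) (F : 'I_cnt -> biseq q),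
  [/\ forall i, Z (F i), forall i j, window m n (F i) (F j) -> i = j &
      forall x, Z x -> exists i, window m n (F i) x].
Proof.
pose T := {ffun 'I_(n + m + m) -> 'I_q}.
pose pat x : T := [ffun l : 'I_(n + m + m) => x (l%:Z - m%:Z)].
have patP x y : pat x = pat y <-> window m n x y.
  split=> [e l hl|h]; last first.
    apply/ffunP => l; rewrite !ffunE; apply: h.
    by have := ltn_ord l; clear; lia.
  have lt : (`|(l + m%:Z)%R|%N < n + m + m)%N by move: hl; clear; lia.
  have /ffunP/(_ (Ordinal lt)) := e; rewrite !ffunE /=.
  by have -> : `|(l + m%:Z)%R|%N%:Z - m%:Z = l by move: hl; clear; lia.
pose S := [set t : T | `[< exists2 x, Z x & pat x = t >]]%SET.
have /choice [F hF] : forall i : 'I_#|S|, exists x, Z x /\ pat x = enum_val i.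
  move=> i; have := enum_valP i; rewrite inE => /asboolP [x Zx e]; by exists x.
exists #|S|, F; split=> [i|i j /patP|x Zx].
- by case: (hF i).
- by rewrite (hF i).2 (hF j).2 => /enum_val_inj.
have xS : pat x \in S by rewrite inE; apply/asboolP; exists x.
exists (enum_rank_in xS (pat x)); apply/patP.
by rewrite (hF _).2 enum_rankK_in.
Qed.

Lemma expR_small (a d : R) : 0 < a -> 0 < d ->
  exists n0, forall n : nat, (n0 <= n)%N -> expR (- a * n%:R) <= d.
Proof.
move=> a0 d0.
have : (fun n => 1 * expR (- a) ^+ n) @ \oo --> (0 : R).
  by apply: cvg_geometric; rewrite ger0_norm ?expR_ge0// expR_lt1 oppr_lt0.
move=> /cvgr0Pnorm_le /(_ _ d0) [n0 _ hn]; exists n0 => n /hn /=.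
by rewrite mul1r -expRM_natr => /(le_trans (ler_norm _)).
Qed.

(** Otherwise [Yn n] shows fewer than e^(ns) words for all large n. As each point of [Y] lies in
    [Yn n] eventually, words of a sequence of levels cover [Y] with arbitrarily small weight at an
    exponent above s. The radius [m] depends only on the ball size and is fixed before n, so its
    cost per unit of length vanishes. *)
Lemma htop_covering (x0 : biseq q) Y (Yn : nat -> set (biseq q)) (s : R) :
  Y `<=` subshift Q -> 0 <= s ->
  (forall x, Y x -> exists N, forall n, (N <= n)%N -> Yn n x) ->
  (s%:E < htop Q omega Y)%E ->
  exists m : nat, forall N : nat, exists n, (N <= n)%N /\
  exists (cnt : nat) (F : 'I_cnt -> biseq q),
  [/\ forall i, subshift Q (F i) /\ Yn n (F i),
      forall i j, window m n (F i) (F j) -> i = j &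
      expR (n%:R * s) <= cnt%:R].
Proof.
move=> YQ s0 YYn /htop_lt [eps e0 hs].
have [m hm] : exists m, omega ^+ m < eps.
  have : (fun n => 1 * omega ^+ n) @ \oo --> (0 : R).
    by apply: cvg_geometric; rewrite ger0_norm ?ltW.
  move=> /cvgr0Pnorm_lt /(_ _ e0) [n _ hn]; exists n.
  by have := hn n (leqnn n); rewrite mul1r => /(le_lt_trans (ler_norm _)).
exists m; apply: contrapT => /existsNP [N0 hN0].
have few n : (N0 <= n)%N -> forall (cnt : nat) (F : 'I_cnt -> biseq q),
    (forall i, subshift Q (F i) /\ Yn n (F i)) ->
    (forall i j, window m n (F i) (F j) -> i = j) -> cnt%:R < expR (n%:R * s).
  move=> Nn cnt F h1 h2; rewrite ltNge; apply/negP => h3; apply: hN0.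
  by exists n; split=> //; exists cnt, F.
have [s' ss' s'h] : exists2 s' : R, s < s' & (s'%:E < htop_eps Q omega Y eps)%E.
  case: (htop_eps Q omega Y eps) hs => [h| |] //; last by exists (s + 1); rewrite ?ltry// ltrDl.
  by rewrite lte_fin => sh; exists ((s + h) / 2); rewrite ?lte_fin; lra.
suff : (htop_eps Q omega Y eps <= s'%:E)%E by rewrite leNgt s'h.
apply: ereal_inf_lbound; exists s' => //; split; first exact: le_trans s0 (ltW ss').
apply/eqP; rewrite eq_le bowen_sum_ge0 andbT bowen_sumE.
apply: ge_ereal_sup => _ [N _ <-]; apply/lee_addgt0Pr => d d0; rewrite add0e.
have a0 : 0 < s' - s by rewrite subr_gt0.
(* Level j contributes at most d / 2^(j+1) to the sum; the condition j <= n makes every point of [Y]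
   caught at some level. *)
have /choice [lev hlev] : forall j, exists n, [/\ (N <= n)%N, (N0 <= n)%N, (j <= n)%N &
    expR (- (s' - s) * n%:R) <= d / (2 ^ j.+1)%:R].
  move=> j; have dj : 0 < d / (2 ^ j.+1)%:R by rewrite divr_gt0// ltr0n expn_gt0.
  have [n1 h1] := expR_small a0 dj.
  exists (N + N0 + j + n1)%N; split; [clear; lia|clear; lia|clear; lia|].
  by apply: h1; rewrite leq_addl.
have /choice [cnt hcnt] : forall j, exists cnt, exists F : 'I_cnt -> biseq q,
  [/\ forall i, subshift Q (F i) /\ Yn (lev j) (F i),
      forall i i', window m (lev j) (F i) (F i') -> i = i' &
      forall x, subshift Q x /\ Yn (lev j) x -> exists i, window m (lev j) (F i) x].
  by move=> j; exact: (patterns (fun x => subshift Q x /\ Yn (lev j) x) m (lev j)).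
have /choice [F hF] : forall j, exists F : nat -> biseq q,
  [/\ forall i, (i < cnt j)%N -> subshift Q (F i), (cnt j)%:R < expR ((lev j)%:R * s) &
      forall x, subshift Q x -> Yn (lev j) x -> exists2 i, (i < cnt j)%N & window m (lev j) (F i) x].
  move=> j; have [F [h1 h2 h3]] := hcnt j.
  have [_ N0j _ _] := hlev j.
  have FE (i : 'I_(cnt j)) : oapp F x0 (insub (val i)) = F i by rewrite valK.
  exists (fun i => oapp F x0 (insub i)); split.
  - by move=> i ic; rewrite (FE (Ordinal ic)); case: (h1 (Ordinal ic)).
  - exact: (few _ N0j _ F).
  - move=> x Qx Yx; have [i hi] := h3 x (conj Qx Yx).
    by exists (val i); [exact: ltn_ord|rewrite FE].
(* Covers are indexed by naturals, so pairs (level, word) are encoded; the default (0, 0) is never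
   reached on codes of pairs. *)
pose dec (i : nat) : nat * nat := odflt (0%N, 0%N) (unpickle i).
have decK p : dec (pickle p) = p by rewrite /dec pickleK.
pose J : set (nat * nat) := [set: nat] `*`` (fun j => `I_(cnt j)).
apply: (@le_trans _ _ (\esum_(i in pickle @` J) (expR (- s' * (lev (dec i).1)%:R))%:E)%E).
  apply: ereal_inf_lbound; exists (pickle @` J), (fun i => F (dec i).1 (dec i).2), (fun i => lev (dec i).1).
  split=> //; split.
    move=> _ [[j i] [_ /= ic] <-]; rewrite decK /=.
    by have [h1 _ _] := hF j; have [h2 _ _ _] := hlev j; split=> //; exact: h1.
  move=> x Yx; have [n hn] := YYn x Yx.
  have [_ _ h3] := hF n; have [_ _ nl _] := hlev n.
  have [i ic hi] := h3 x (YQ x Yx) (hn _ nl).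
  exists (pickle (n, i)); first by exists (n, i).
  rewrite decK /=; split; first exact: YQ.
  exact: bowen_dist_window hm hi.
rewrite esum_image; last by move=> p p' _ _ /(congr1 dec); rewrite !decK.
rewrite /J -(@esum_esum _ _ _ _ _ (fun j i => (expR (- s' * (lev (dec (pickle (j, i))).1)%:R))%:E));
  last by move=> j i _ _; rewrite lee_fin expR_ge0.
rewrite -nneseries_esumT; last first.
  by move=> j; apply: esum_ge0 => i _; rewrite lee_fin expR_ge0.
apply: le_trans (epsilon_trick0 xpredT (ltW d0)).
apply: lee_nneseries => [j _ _|j _]; first by apply: esum_ge0 => i _; rewrite lee_fin expR_ge0.
rewrite esum_fset; [|exact: finite_II|by move=> i _; rewrite lee_fin expR_ge0].
rewrite (eq_fsbigr (fun=> (expR (- s' * (lev j)%:R))%:E)); last by move=> i _; rewrite decK.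
rewrite -fsbig_ord sumEFin lee_fin sumr_const card_ord -[leLHS]mulr_natl.
have [_ hc _] := hF j; have [_ _ _ hl] := hlev j; apply: le_trans hl.
apply: (@le_trans _ _ (expR ((lev j)%:R * s) * expR (- s' * (lev j)%:R))).
  by rewrite ler_wpM2r ?expR_ge0// ltW.
by rewrite -expRD ler_expR le_eqVlt; apply/orP; left; apply/eqP; ring.
Qed.

End BowenEntropy.

(** * Moran sets of glued orbits *)

Section Avoiding.
Variables (R : realType) (s lev : nat -> nat) (I : set nat).
Variables (B : nat -> nat -> nat -> bool) (b : nat).
Hypothesis s_gt0 : forall l, (0 < s l)%N.
Hypothesis B_card : forall i l, (#|[set c : 'I_(s l) | B i l c]%SET| <= b)%N.

Let wt i (t : seq nat) l : R :=
  if (l < size t)%N then (B i l (nth 0%N t l))%:R else b%:R / (s l)%:R.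
Let psi i (t : seq nat) : R := \prod_(l < lev i) wt i t l.
Let Phi (t : seq nat) : \bar R := (\esum_(i in I) (psi i t)%:E)%E.

Let wt_ge0 i t l : 0 <= wt i t l.
Proof. by rewrite /wt; case: ifP => _; rewrite ?ler0n// divr_ge0. Qed.

Let psi_ge0 i t : 0 <= psi i t.
Proof. by apply: prodr_ge0 => l _; exact: wt_ge0. Qed.

(** Only the factor at position [size t] changes: its undecided value b / s is replaced by an
    indicator, which holds for at most b of the s choices. *)
Lemma avoid_average i t :
  \sum_(c < s (size t)) psi i (rcons t (c : nat)) <= \sum_(c < s (size t)) psi i t.
Proof.
have wt_lt (c : nat) l : (l < size t)%N -> wt i (rcons t c) l = wt i t l.
  by move=> lt; rewrite /wt size_rcons ltnS (ltnW lt) lt nth_rcons lt.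
have wt_gt (c : nat) l : (size t < l)%N -> wt i (rcons t c) l = wt i t l.
  by move=> lt; rewrite /wt size_rcons ltnS leqNgt lt/= ltnNge (ltnW lt).
have [le|lt] := leqP (lev i) (size t).
  apply: ler_sum => c _; apply: ler_prod => l _; rewrite wt_ge0/= wt_lt//.
  exact: leq_trans (ltn_ord l) le.
have E t' : psi i t' = wt i t' (size t) *
    \prod_(l < lev i | l != Ordinal lt) wt i t' l by rewrite /psi (bigD1 (Ordinal lt)).
set P := \prod_(l < lev i | l != Ordinal lt) wt i t l.
have P0 : 0 <= P by apply: prodr_ge0 => l _; exact: wt_ge0.
have -> : \sum_(c < s (size t)) psi i (rcons t (c : nat)) =
    (\sum_(c < s (size t)) (B i (size t) c)%:R) * P.
  rewrite mulr_suml; apply: eq_bigr => c _; rewrite E; congr (_ * _).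
    by rewrite /wt size_rcons leqnn nth_rcons ltnn eqxx.
  apply: eq_bigr => l ll; have /orP[h|h] : (l < size t)%N || (size t < l)%N.
    by rewrite -neq_ltn; apply: contraNN ll => /eqP h; apply/eqP/val_inj.
  - exact: wt_lt.
  - exact: wt_gt.
rewrite sumr_const card_ord -mulr_natl E -/P mulrA ler_wpM2r//.
rewrite /wt ltnn mulrCA mulfV ?mulr1; last by rewrite pnatr_eq0 -lt0n.
rewrite -natr_sum ler_nat -big_mkcond/= sum1_card.
by apply: leq_trans (B_card i (size t)); rewrite cardsE.
Qed.

Lemma avoid_step t : (Phi t < 1)%E -> exists2 c, (c < s (size t))%N & (Phi (rcons t c) < 1)%E.
Proof.
move=> Pt; apply: contrapT => none.
have P0 : (0 <= Phi t)%E by apply: esum_ge0 => i _; rewrite lee_fin.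
have Pfin : Phi t \is a fin_num.
  by rewrite ge0_fin_numE//; exact: lt_trans Pt (ltry _).
have big c : (c < s (size t))%N -> (1 <= Phi (rcons t c))%E.
  by move=> cs; rewrite leNgt; apply/negP => h; apply: none; exists c.
have le1 : (\sum_(c < s (size t)) 1%E <= \sum_(c < s (size t)) Phi t :> \bar R)%E.
  apply: (@le_trans _ _ (\sum_(c < s (size t)) Phi (rcons t (c : nat)))%E).
    by apply: lee_sum => c _; exact: big.
  rewrite /Phi -!esum_sum; try by move=> i c _ _; rewrite lee_fin.
  by apply: le_esum => i _; rewrite !sumEFin lee_fin avoid_average.
move: le1; rewrite -(fineK Pfin) !sumEFin lee_fin !sumr_const card_ord.
rewrite lerMn2r eqn0Ngt s_gt0/= leNgt => /negP; apply.
by rewrite -lte_fin fineK.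
Qed.

(* Conditional expectations: [psi i t] is the conditional weight of the [i]-th
   forbidden event given the first choices [t]; their average over the next choice
   does not exceed it, so the total weight can be kept below 1. *)
Lemma avoid : (\esum_(i in I) (\prod_(l < lev i) (b%:R / (s l)%:R))%:E < 1 :> \bar R)%E ->
  exists v : nat -> nat, (forall l, (v l < s l)%N) /\
    forall i, I i -> ~ (forall l, (l < lev i)%N -> B i l (v l)).
Proof.
move=> h0.
have P0 : (Phi [::] < 1)%E.
  by rewrite (_ : Phi [::] = \esum_(i in I) (\prod_(l < lev i) (b%:R / (s l)%:R))%:E).
have /choice [nx hnx] : forall t, exists c, (Phi t < 1)%E ->
    (c < s (size t))%N /\ (Phi (rcons t c) < 1)%E.
  move=> t; have [h|h] := pselect (Phi t < 1)%E; last by exists 0%N.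
  by have [c c1 c2] := avoid_step h; exists c.
pose T := fix T j := if j is i.+1 then rcons (T i) (nx (T i)) else [::].
have TS j : T j.+1 = rcons (T j) (nx (T j)) by [].
have T1 j : (Phi (T j) < 1)%E by elim: j => //= j /hnx[].
have sT j : size (T j) = j by elim: j => //= j IH; rewrite size_rcons IH.
have nT l d : nth 0%N (T (l.+1 + d)%N) l = nx (T l).
  elim: d => [|d IH]; first by rewrite addn0 TS nth_rcons sT ltnn eqxx.
  by rewrite addnS TS nth_rcons sT ltn_addr.
exists (fun l => nx (T l)); split.
  by move=> l; have [] := hnx _ (T1 l); rewrite sT.
move=> i Ii hB; have := T1 (lev i); rewrite ltNge => /negP; apply.
(* An event that has fully occurred has conditional weight 1, which alone would bring the total
   weight up to 1. *)
have E : psi i (T (lev i)) = 1.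
  apply: big1 => l _; rewrite /wt sT ltn_ord.
  by have := nT l (lev i - l.+1)%N; rewrite subnKC// => ->; rewrite hB.
apply: esum_ge; exists [set i]; last by rewrite fsbig_set1 E.
by split; [exact: finite_set1|move=> _ ->].
Qed.

End Avoiding.

(** * Sequences with bounded gluing errors *)

Section Glueable.
Variables (R : realType) (q : nat) (Q : 'M[bool]_q).
Implicit Types x y w : biseq q.

(* Logarithmic cocycle norms of quasi-multiplicative cocycles satisfy this with
   [f n x = ln |A^n(x)|]. The gap [g] between the two glued words is variable, but
   the glued segment has the fixed length [n + (G + m)]. *)
Record glueable (f : nat -> biseq q -> R) (G : nat) (Lam D : R) : Prop := Glueable {
  gl_G : (0 < G)%N;
  gl_Lam : 0 <= Lam;
  gl_D : 0 <= D;
  gl_bound : forall x n, subshift Q x -> `|f n x| <= Lam * n%:R;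
  gl_lip : forall x n m, subshift Q x -> `|f (n + m)%N x - f n x| <= Lam * m%:R;
  gl_shift : forall x n m, subshift Q x ->
    `|f (n + m)%N x - f m (shift n%:Z x)| <= Lam * n%:R;
  gl_past : forall x y n, subshift Q x -> subshift Q y ->
    (forall i, i < n%:Z -> x i = y i) -> `|f n x - f n y| <= D;
  gl_step : forall x y n m, subshift Q x -> subshift Q y -> exists w g,
    [/\ subshift Q w, (g <= G)%N, forall i, i < n%:Z -> w i = x i,
        forall i, 0 <= i -> w (n%:Z + g%:Z + i) = y i &
        `|f (n + (G + m))%N w - f n x - f m y| <= D] }.

Definition growth_set (f : nat -> biseq q -> R) (alpha : R) : set (biseq q) :=
  [set x | subshift Q x /\ (n%:R^-1 * f n x @[n --> \oo] --> alpha)].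

Lemma growth_setP f alpha x : growth_set f alpha x <->
  subshift Q x /\ forall e : R, 0 < e -> exists N, forall n, (N <= n)%N ->
    `|f n x - n%:R * alpha| <= n%:R * e.
Proof.
have E n : (0 < n)%N ->
    n%:R * `|alpha - n%:R^-1 * f n x| = `|f n x - n%:R * alpha|.
  move=> n0; have nR : 0 < n%:R :> R by rewrite ltr0n.
  rewrite -[X in X * `|_|](ger0_norm (ltW nR)) -normrM mulrBr mulrA mulfV ?gt_eqF//.
  by rewrite mul1r distrC.
split=> [[Qx /cvgrPdist_le h]|[Qx h]]; split=> //.
  move=> e e0; have [N _ hN] := h e e0; exists N.+1 => n Nn.
  have n0 : (0 < n)%N by exact: leq_trans Nn.
  by rewrite -E// ler_wpM2l//; exact: hN (ltnW Nn).
apply/cvgrPdist_le => e e0; have [N hN] := h e e0; exists N.+1 => // n /= Nn.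
have n0 : (0 < n)%N by exact: leq_trans Nn.
have nR : 0 < n%:R :> R by rewrite ltr0n.
by rewrite -(ler_pM2l nR) E// hN// ltnW.
Qed.

End Glueable.

Section Moran.
Variables (R : realType) (q : nat) (Q : 'M[bool]_q) (omega : R).
Hypothesis omega01 : 0 < omega < 1.
Variables (f : nat -> biseq q -> R) (G : nat) (Lam D : R).
Hypothesis gl : glueable Q f G Lam D.

Variables (nl s : nat -> nat) (F : nat -> nat -> biseq q).
Hypothesis s_gt0 : forall j, (0 < s j)%N.
Hypothesis F_Q : forall j c, (c < s j)%N -> subshift Q (F j c).
Hypothesis F_sep : forall j c c', (c < s j)%N -> (c' < s j)%N ->
  (forall l : nat, (l < nl j)%N -> F j c l%:Z = F j c' l%:Z) -> c = c'.

(** A slot has fixed length whatever its gap g <= G; its last G - g places continue the point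
    carrying the word. *)
Let ell j := (G + nl j)%N.
Definition total_length j := (\sum_(i < j) ell i)%N.
Let NN := total_length.

(** Every word of block j has log-norm [a j] up to [e j]. The [asymp] hypotheses say that these
    values follow gam with negligible error, that no slot is long compared with its past, and that
    the logarithmic word counts, reduced by ln (G + 1) per unknown gap, grow at rate at least h. *)
Variables (a e : nat -> R) (gam h : R).
Hypothesis F_val : forall j c, (c < s j)%N -> `|f (nl j) (F j c) - a j| <= e j.
Hypothesis asymp_val : forall d : R, 0 < d -> exists J, forall j, (J <= j)%N ->
  `|\sum_(i < j) a i - gam * (NN j)%:R| + \sum_(i < j) e i + D * j.+1%:R <= d * (NN j)%:R.
Hypothesis asymp_len : forall d : R, 0 < d -> exists J, forall j, (J <= j)%N ->
  (ell j)%:R <= d * (NN j)%:R.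
Hypothesis asymp_ent : forall d : R, 0 < d -> exists J, forall j, (J <= j)%N ->
  (h - d) * (NN j)%:R <= \sum_(i < j) (ln (s i)%:R - ln G.+1%:R).

Lemma total_lengthS j : NN j.+1 = (NN j + ell j)%N.
Proof. by rewrite /NN /total_length big_ord_recr. Qed.

Lemma total_length_mono i j : (i <= j)%N -> (NN i <= NN j)%N.
Proof.
move=> /subnKC <-; elim: (j - i)%N => [|d IH]; first by rewrite addn0.
by rewrite addnS total_lengthS (leq_trans IH)// leq_addr.
Qed.

Lemma total_length_ge j : (j <= NN j)%N.
Proof.
elim: j => // j IH; rewrite total_lengthS /ell -addn1 leq_add//.
by rewrite (leq_trans (gl_G gl))// leq_addr.
Qed.

Variables (st : biseq q * biseq q * nat * nat -> biseq q) (gp : biseq q * biseq q * nat * nat -> nat).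
Hypothesis stP : forall x y n m, subshift Q x -> subshift Q y ->
  let w := st (x, y, n, m) in let g := gp (x, y, n, m) in
    [/\ subshift Q w, (g <= G)%N, forall i, i < n%:Z -> w i = x i,
        forall i, 0 <= i -> w (n%:Z + g%:Z + i) = y i &
        `|f (n + (G + m))%N w - f n x - f m y| <= D].

(** The seed is glued at length 0 and only supplies the past. *)
Fixpoint glued (u : nat -> biseq q) j : biseq q :=
  if j is i.+1 then st (glued u i, u i, NN i, nl i) else F 0 0%N.

(** Coordinate i is final from stage |i| + 1 on, since the total length after j slots is at least
    j. *)
Definition glued_limit u : biseq q := fun i => glued u `|i|.+1 i.

Section OneSequence.
Variable u : nat -> biseq q.
Hypothesis Qu : forall j, subshift Q (u j).

Lemma glued_subshift j : subshift Q (glued u j).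
Proof.
elim: j => [|j IH]; first exact/F_Q/s_gt0.
by have [] := stP (NN j) (nl j) IH (Qu j).
Qed.

Lemma glued_stable j d i : i < (NN j)%:Z -> glued u (j + d)%N i = glued u j i.
Proof.
move=> ij; elim: d => [|d IH]; first by rewrite addn0.
have [_ _ h1 _ _] := stP (NN (j + d)) (nl (j + d)) (glued_subshift (j + d)%N) (Qu (j + d)%N).
rewrite addnS /= h1//; apply: lt_le_trans ij _.
by rewrite lez_nat total_length_mono// leq_addr.
Qed.

Lemma glued_limitE j i : i < (NN j)%:Z -> glued_limit u i = glued u j i.
Proof.
move=> ij; rewrite /glued_limit; set k := `|i|.+1.
have ik : i < (NN k)%:Z.
  apply: (@lt_le_trans _ _ k%:Z); first by rewrite /k; clear; lia.
  by rewrite lez_nat total_length_ge.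
by rewrite -(glued_stable j ik) -(glued_stable k ij) addnC.
Qed.

Lemma glued_limit_subshift : subshift Q (glued_limit u).
Proof.
move=> i; pose j := `|(i + 1)%R|.+1%N.
have h1 : i + 1 < (NN j)%:Z.
  apply: (@lt_le_trans _ _ j%:Z); first by rewrite /j; clear; lia.
  by rewrite lez_nat total_length_ge.
rewrite !(@glued_limitE j)//; first exact: glued_subshift.
by apply: lt_trans h1; rewrite ltrDl.
Qed.

Lemma glued_growth j :
  `|f (NN j) (glued u j) - \sum_(i < j) f (nl i) (u i)| <= D * j%:R.
Proof.
elim: j => [|j IH].
  rewrite big_ord0 subr0 mulr0 /NN /total_length big_ord0.
  by have := gl_bound gl 0 (glued_subshift 0); rewrite mulr0.
have [_ _ _ _ h1] := stP (NN j) (nl j) (glued_subshift j) (Qu j).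
rewrite big_ord_recr/= total_lengthS -addn1 natrD mulrDr mulr1.
rewrite (_ : _ - (_ + _) = (f (NN j) (glued u j) - \sum_(i < j) f (nl i) (u i)) +
  (f (NN j + ell j)%N (glued u j.+1) - f (NN j) (glued u j) - f (nl j) (u j))); last by ring.
by rewrite (le_trans (ler_normD _ _))// lerD// h1.
Qed.

Lemma glued_limit_growth j :
  `|f (NN j) (glued_limit u) - \sum_(i < j) f (nl i) (u i)| <= D * j.+1%:R.
Proof.
rewrite -addn1 natrD mulrDr mulr1 [leRHS]addrC.
have := gl_past gl glued_limit_subshift (glued_subshift j) (@glued_limitE j).
move=> h1; rewrite -(subrKA (f (NN j) (glued u j))).
by rewrite (le_trans (ler_normD _ _))// lerD// glued_growth.
Qed.

(** The offset [g] is the only ambiguity in reading the chosen words off the limit point. *)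
Lemma glued_limit_block j : exists2 g, (g <= G)%N &
  forall l : nat, (l < nl j)%N -> glued_limit u (NN j + g + l)%N%:Z = u j l%:Z.
Proof.
have [_ gG _ h2 _] := stP (NN j) (nl j) (glued_subshift j) (Qu j).
exists (gp (glued u j, u j, NN j, nl j)) => // l lj.
rewrite (@glued_limitE j.+1); first by rewrite /= !PoszD h2.
rewrite total_lengthS /ell; move: gG lj; clear; lia.
Qed.

End OneSequence.

Lemma glued_limit_growth_set (v : nat -> nat) : (forall j, (v j < s j)%N) ->
  growth_set Q f gam (glued_limit (fun j => F j (v j))).
Proof.
move=> vs; set u := fun j => _; have Qu j : subshift Q (u j) by exact/F_Q/vs.
apply/growth_setP; split; first exact: glued_limit_subshift.
move=> d d0; have K0 : 0 < 1 + Lam + `|gam|.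
  by rewrite -addrA ltr_pwDl// addr_ge0// ?(gl_Lam gl).
(* An incomplete last block of length m shifts the log-norm by at most Lam * m and its target by
   |gam| * m; both fit into half of the error. *)
pose d' := d / 2 / (1 + Lam + `|gam|).
have d'0 : 0 < d' by rewrite !divr_gt0.
have [J1 h1] := asymp_len d'0.
have d20 : 0 < d / 2 by rewrite divr_gt0.
have [J2 h2] := asymp_val d20.
exists (NN (maxn J1 J2)) => n Nn.
have [j [jJ hj1 hj2]] : exists j, [/\ (maxn J1 J2 <= j)%N, (NN j <= n)%N & (n < NN j.+1)%N].
  have ex : exists j, (NN j <= n)%N by exists (maxn J1 J2).
  have ub j : (NN j <= n)%N -> (j <= n)%N by apply: leq_trans; exact: total_length_ge.
  case: (ex_maxnP ex ub) => j jn hj; exists j; split=> //; first exact: hj.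
  by rewrite ltnNge; apply/negP => /hj; rewrite ltnn.
have J1j : (J1 <= j)%N by apply: leq_trans jJ; exact: leq_maxl.
have J2j : (J2 <= j)%N by apply: leq_trans jJ; exact: leq_maxr.
set z := glued_limit u; have Qz : subshift Q z by exact: glued_limit_subshift.
pose m := (n - NN j)%N; have nm : n = (NN j + m)%N by rewrite /m subnKC.
have ml : (m <= ell j)%N.
  by move: hj2; rewrite total_lengthS nm ltn_add2l => /ltnW.
have mR : m%:R <= d' * (NN j)%:R :> R.
  by apply: le_trans (h1 j J1j); rewrite ler_nat.
have e1 : `|f n z - f (NN j) z| <= Lam * m%:R by rewrite nm; exact: (gl_lip gl).
have e2 : `|f (NN j) z - \sum_(i < j) f (nl i) (u i)| <= D * j.+1%:R.
  exact: glued_limit_growth.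
have e3 : `|\sum_(i < j) f (nl i) (u i) - \sum_(i < j) a i| <= \sum_(i < j) e i.
  rewrite -sumrB (le_trans (ler_norm_sum _ _ _))//; apply: ler_sum => i _.
  exact/F_val/vs.
have e4 := h2 j J2j.
have -> : f n z - n%:R * gam = (f n z - f (NN j) z) +
   ((f (NN j) z - \sum_(i < j) f (nl i) (u i)) +
   ((\sum_(i < j) f (nl i) (u i) - \sum_(i < j) a i) +
   ((\sum_(i < j) a i - gam * (NN j)%:R) - m%:R * gam))).
  by rewrite nm natrD; ring.
have t1 : `|\sum_(i < j) a i - gam * (NN j)%:R - m%:R * gam| <=
   `|\sum_(i < j) a i - gam * (NN j)%:R| + m%:R * `|gam|.
  by rewrite (le_trans (ler_normB _ _))// normrM normr_nat.
apply: (@le_trans _ _ (Lam * m%:R + (D * j.+1%:R + (\sum_(i < j) e i +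
   (`|\sum_(i < j) a i - gam * (NN j)%:R| + m%:R * `|gam|))))).
  do 3! (rewrite (le_trans (ler_normD _ _))// lerD//).
apply: (@le_trans _ _ (d / 2 * (NN j)%:R + (1 + Lam + `|gam|) * m%:R)).
  have : 0 <= m%:R :> R by []. 
  by move: e4; lra.
have : (1 + Lam + `|gam|) * m%:R <= d / 2 * (NN j)%:R.
  have -> : d / 2 * (NN j)%:R = (1 + Lam + `|gam|) * (d' * (NN j)%:R).
    by rewrite /d' mulrA; congr (_ * _); field; rewrite gt_eqF.
  by rewrite ler_pM2l.
have : d * (NN j)%:R <= n%:R * d by rewrite mulrC ler_pM2r// ler_nat.
lra.
Qed.

Lemma moran_nonempty : growth_set Q f gam !=set0.
Proof.
by exists (glued_limit (fun j => F j 0)); exact: (glued_limit_growth_set (v := fun=> 0%N)).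
Qed.

(** Sending a word to an offset where it is read is injective, since two words read at the same
    place of [x] agree; there are G + 1 offsets. *)
Lemma block_card (x : biseq q) (l : nat) :
  (#|[set c : 'I_(s l) | `[< exists2 g, (g <= G)%N & forall t : nat, (t < nl l)%N ->
     x (NN l + g + t)%N%:Z = F l c t%:Z >]]%SET| <= G.+1)%N.
Proof.
set S := [set c | _]%SET.
have /choice [g hg] : forall c : 'I_(s l), exists g : 'I_G.+1, c \in S ->
    forall t : nat, (t < nl l)%N -> x (NN l + g + t)%N%:Z = F l c t%:Z.
  move=> c; have [|cS] := boolP (c \in S); last by exists ord0.
  by rewrite inE => /asboolP [g gG hg]; exists (Ordinal (gG : (g < G.+1)%N)).
rewrite -(card_in_imset (f := g)); first by rewrite -[leqRHS]card_ord max_card.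
move=> c c' cS c'S gg; apply/val_inj/(@F_sep l) => [||t tl]; try exact: ltn_ord.
by rewrite -hg// gg hg.
Qed.

(** A ball containing a limit point forces each block completed within its length into a set of at
    most G + 1 words. A cover of total weight below 1 thus gives forbidden events to which [avoid]
    applies, and the resulting limit point lies in no ball. *)
Lemma moran_bowen_sum (s0 eps : R) : 0 <= s0 -> s0 < h -> 0 < eps <= 1 ->
  bowen_sum Q omega (growth_set Q f gam) s0 eps <> 0%E.
Proof.
move=> s00 s0h /andP[eps0 eps1].
(* Needed is h - d >= s0 * (1 + d), where 1 + d bounds the ratio of consecutive total lengths; the
   additional 1 in the denominator is slack. *)
pose d := (h - s0) / (1 + s0 + 1).
have hs : 0 < h - s0 by rewrite subr_gt0.
have d0 : 0 < d by rewrite divr_gt0//; lra.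
have dE : d * (1 + s0 + 1) = h - s0 by rewrite /d divfK// gt_eqF//; lra.
have [J1 h1] := asymp_len d0.
have [J2 h2] := asymp_ent d0.
pose J := maxn J1 J2.
have rate j : (J <= j)%N -> \prod_(l < j) (G.+1%:R / (s l)%:R) <= expR (- s0 * (NN j.+1)%:R) :> R.
  rewrite geq_max => /andP[j1 j2].
  have -> : \prod_(l < j) (G.+1%:R / (s l)%:R) =
      expR (- \sum_(l < j) (ln (s l)%:R - ln G.+1%:R)) :> R.
    rewrite -sumrN expR_sum; apply: eq_bigr => l _.
    by rewrite opprB expRB !lnK// posrE ltr0n.
  rewrite ler_expR mulNr lerN2 total_lengthS natrD.
  apply: le_trans (h2 j j2); have := h1 j j1.
  have : 0 <= (NN j)%:R :> R by [].
  set N := (NN j)%:R; set L := (ell j)%:R => N0 LN.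
  apply: (@le_trans _ _ (s0 * (N + d * N))); first by rewrite ler_wpM2l// lerD2l.
  rewrite -subr_ge0; have -> : (h - d) * N - s0 * (N + d * N) = (h - s0 - d * (1 + s0)) * N by ring.
  by rewrite mulr_ge0// -dE; nra.
move=> sum0.
have : (1 <= bowen_sum_N Q omega (growth_set Q f gam) s0 eps (NN J))%E.
  apply: le_ereal_inf_tmp => _ [I [x [n [[hI cov] ->]]]].
  rewrite leNgt; apply/negP => small.
  (* [lev i] blocks are completed within length [n i]. The next total length exceeds [n i], which is
     why [rate] is stated at NN (j + 1). *)
  have /choice [lev hlev] : forall i, exists j, (NN j <= n i)%N /\ (n i < NN j.+1)%N.
    move=> i; have ex : exists j, (NN j <= n i)%N.
      by exists 0%N; rewrite /NN /total_length big_ord0.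
    have ub j : (NN j <= n i)%N -> (j <= n i)%N by apply: leq_trans; exact: total_length_ge.
    case: (ex_maxnP ex ub) => j jn hj; exists j; split=> //.
    by rewrite ltnNge; apply/negP => /hj; rewrite ltnn.
  pose B i l c := `[< exists2 g, (g <= G)%N & forall t : nat, (t < nl l)%N ->
     x i (NN l + g + t)%N%:Z = F l c t%:Z >].
  have [v [vs hv]] : exists v : nat -> nat, (forall l, (v l < s l)%N) /\
      forall i, I i -> ~ (forall l, (l < lev i)%N -> B i l (v l)).
    apply: (avoid (R := R) s_gt0 (b := G.+1)) => [i l|]; first exact: block_card.
    apply: le_lt_trans small; apply: le_esum => i Ii; rewrite lee_fin.
    have [hl1 hl2] := hlev i.
    have Jl : (J <= lev i)%N.
      rewrite leqNgt; apply/negP => lJ; have [_ ni] := hI i Ii.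
      by move: hl2; rewrite ltnNge (leq_trans (total_length_mono lJ) ni).
    apply: (le_trans (rate _ Jl)); rewrite ler_expR !mulNr lerN2 ler_wpM2l// ler_nat.
    exact: ltnW.
  have Ez := glued_limit_growth_set vs.
  have [i Ii [Qz hz]] := cov _ Ez.
  apply: (hv i Ii) => l ll; apply/asboolP.
  have Qu j : subshift Q (F j (v j)) by exact/F_Q/vs.
  have [g gG hg] := glued_limit_block Qu l; exists g => // t tl.
  rewrite -hg//; apply: (bowen_dist_agree omega01 eps1 hz).
  apply: (@leq_trans (NN l.+1)); first by rewrite total_lengthS /ell; move: gG tl; clear; lia.
  by apply: leq_trans (hlev i).1; exact: total_length_mono.
rewrite leNgt => /negP; apply; apply: (@le_lt_trans _ _ 0%E); last by rewrite lte_fin.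
by rewrite -sum0; exact: bowen_sum_N_le.
Qed.

Lemma moran_htop : (h%:E <= htop Q omega (growth_set Q f gam))%E.
Proof.
have [h0|h0] := leP h 0; first by apply: le_trans (htop_ge0 _ _ _); rewrite lee_fin.
apply: le_trans (htop_eps_le _ _ _ ltr01).
apply: le_ereal_inf_tmp => _ [s0 [s00 sum0] <-]; rewrite lee_fin leNgt; apply/negP => s0h.
by apply: (moran_bowen_sum s00 s0h _ sum0); rewrite ltr01 lexx.
Qed.

End Moran.

(** * Entropy spectrum *)

Section Families.
Variables (R : realType) (q : nat) (Q : 'M[bool]_q) (omega : R).
Hypothesis omega01 : 0 < omega < 1.
Variables (f : nat -> biseq q -> R) (G : nat) (Lam D : R).
Hypothesis gl : glueable Q f G Lam D.
Variable x0 : biseq q.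

Let Lam0 : 0 <= Lam := gl_Lam gl.
Let D0 : 0 <= D := gl_D gl.

(** Admissibility of (alpha, h), with points separated by their coordinates in [0, n). At h = 0 a
    single word suffices, so only the exponent matters. *)
Definition exponential_family (alpha h : R) := forall (e : R) (N : nat), 0 < e ->
  exists n s (F : nat -> biseq q),
  [/\ (N <= n)%N, (0 < s)%N,
      forall c, (c < s)%N -> subshift Q (F c) /\ `|f n (F c) - n%:R * alpha| <= n%:R * e,
      forall c c', (c < s)%N -> (c' < s)%N ->
        (forall l : nat, (l < n)%N -> F c l%:Z = F c' l%:Z) -> c = c' &
      n%:R * (h - e) <= ln s%:R].

Lemma nat_large (C e : R) : 0 < e -> exists n0, forall n : nat, (n0 <= n)%N -> C <= n%:R * e.
Proof.
move=> e0; exists (Num.trunc (C / e)).+1 => n nn; rewrite -ler_pdivrMr//.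
by rewrite ltW// (lt_le_trans (truncnS_gt _))// ler_nat.
Qed.

Lemma growth_family alpha x : growth_set Q f alpha x -> exponential_family alpha 0.
Proof.
move=> /growth_setP [Qx hx] e N e0; have [N1 h1] := hx e e0.
exists (maxn N N1), 1%N, (fun=> x); split; rewrite ?leq_maxl//.
- by move=> c _; split=> //; apply: h1; exact: leq_maxr.
- by move=> c c'; rewrite !ltnS !leqn0 => /eqP -> /eqP ->.
- by rewrite ln1 sub0r mulrN oppr_le0 mulr_ge0// ltW.
Qed.

Lemma window_shift (m n : nat) (y y' : biseq q) :
  (forall l : nat, (l < m + (n + m))%N ->
    shift (- m%:Z) y l%:Z = shift (- m%:Z) y' l%:Z) -> window m n y y'.
Proof.
move=> hl l lmn; have := hl `|(l + m%:Z)%R|%N; rewrite /Defs.shift.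
have -> : `|(l + m%:Z)%R|%N%:Z - m%:Z = l by move: lmn; clear; lia.
by apply; move: lmn; clear; lia.
Qed.

Lemma shift_growth (m n : nat) y : subshift Q y ->
  `|f (m + (n + m))%N (shift (- m%:Z) y) - f n y| <= 2 * Lam * m%:R.
Proof.
move=> Qy; have := gl_shift gl m (n + m) (subshift_shift (- m%:Z) Qy).
rewrite shift_shift addrN shift0 => h1; have h2 := gl_lip gl n m Qy.
rewrite -(subrKA (f (n + m)%N y)) (le_trans (ler_normD _ _))//.
by rewrite (_ : 2 * Lam * m%:R = Lam * m%:R + Lam * m%:R) ?lerD//; ring.
Qed.

Lemma htop_family alpha (h : R) : 0 <= h ->
  (h%:E < htop Q omega (growth_set Q f alpha))%E -> exponential_family alpha h.
Proof.
move=> h0 hh e N e0; have e20 : 0 < e / 2 by rewrite divr_gt0.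
have [|x|m hm] := htop_covering omega01 x0 (Y := growth_set Q f alpha)
  (Yn := fun n x => `|f n x - n%:R * alpha| <= n%:R * (e / 2)) _ h0 _ hh.
- by move=> x [].
- by move=> /growth_setP [_ /(_ _ e20)].
(* Turning centred windows into one-sided words adds 2m coordinates; the effect on log-norm, target
   and entropy is absorbed by n * e / 2. *)
have [n1 hn1] := nat_large (2 * m%:R * (Lam + `|alpha| + h)) e20.
have [n [nn [cnt [F [FY Fsep Fcnt]]]]] := hm (maxn N n1).
have Nn : (N <= n)%N by apply: leq_trans nn; exact: leq_maxl.
have big := hn1 n (leq_trans (leq_maxr _ _) nn).
have mR : 0 <= m%:R :> R by [].
have nR : 0 <= n%:R :> R by [].
have lamm : 0 <= m%:R * Lam by rewrite mulr_ge0.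
have am : 0 <= m%:R * `|alpha| by rewrite mulr_ge0.
have hmm : 0 <= m%:R * h by rewrite mulr_ge0.
have me : 0 <= m%:R * e by rewrite mulr_ge0// ltW.
have cnt0 : (0 < cnt)%N by rewrite -(ltr0n R); apply: lt_le_trans Fcnt; exact: expR_gt0.
pose F' c := oapp (fun i => shift (- m%:Z) (F i)) x0 (insub c).
have F'E (i : 'I_cnt) : F' (val i) = shift (- m%:Z) (F i) by rewrite /F' valK.
exists (m + (n + m))%N, cnt, F'; split=> //.
- by apply: (leq_trans Nn); clear; lia.
- move=> c cc; rewrite (F'E (Ordinal cc)); have [QF hF] := FY (Ordinal cc).
  split; first exact: subshift_shift.
  have := shift_growth m n QF; rewrite !natrD; set A := f _ _; set B := f _ _ in hF *.
  have -> : A - (m%:R + (n%:R + m%:R)) * alpha =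
      (A - B) + ((B - n%:R * alpha) - 2 * m%:R * alpha) by ring.
  move=> h1; apply: (le_trans (ler_normD _ _)); apply: (le_trans (lerD h1 (ler_normB _ _))).
  rewrite !normrM !normr_nat; move: hF big; lra.
- move=> c c' cc cc'; rewrite (F'E (Ordinal cc)) (F'E (Ordinal cc')).
  by move=> /window_shift/Fsep[].
- rewrite -ler_expR lnK ?posrE ?ltr0n// (le_trans _ Fcnt)// ler_expR !natrD.
  by move: big; lra.
Qed.

(** If no exponent were admissible, each would have a neighbourhood carrying at most e^(nh) words of
    any large length n. Finitely many of these cover [-Lam, Lam], where all exponents lie, so the
    whole subshift would have too few words. *)
Lemma htop_subshift_family (h : R) : 0 <= h -> (h%:E < htop Q omega (subshift Q))%E ->
  exists beta, exponential_family beta h.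
Proof.
move=> h0 hh.
have [h' hh' hh'2] : exists2 h' : R, h < h' & (h'%:E < htop Q omega (subshift Q))%E.
  case: (htop _ _ _) hh => [u| |] //; last by exists (h + 1); rewrite ?ltry// ltrDl.
  by rewrite lte_fin => hu; exists ((h + u) / 2); rewrite ?lte_fin; lra.
apply: contrapT => /forallNP none.
have /choice [E hE] : forall beta, exists eN : R * nat, 0 < eN.1 /\
    forall n s (F : nat -> biseq q), (eN.2 <= n)%N -> (0 < s)%N ->
    (forall c, (c < s)%N -> subshift Q (F c) /\
      `|f n (F c) - n%:R * beta| <= n%:R * eN.1) ->
    (forall c c', (c < s)%N -> (c' < s)%N ->
        (forall l : nat, (l < n)%N -> F c l%:Z = F c' l%:Z) -> c = c') ->
    ln s%:R <= n%:R * h.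
  move=> beta; have /existsNP [e /existsNP [N /not_implyP [e0 hN]]] := none beta.
  exists (e, N); split=> // n s F Nn s0 h1 h2; rewrite leNgt; apply/negP => h3.
  apply: hN; exists n, s, F; split=> //; rewrite (le_trans _ (ltW h3))// ler_wpM2l//.
  by rewrite gerBl ltW.
have : cover_compact `[(- Lam)%R, Lam] by rewrite -compact_cover; exact: segment_compact.
move=> /(_ R setT (fun beta => `](beta - (E beta).1), (beta + (E beta).1)[%classic)).
case=> [beta _|z _|S _ cov]; first exact: interval_open.
  by exists z => //=; rewrite in_itv/=; have := (hE z).1; lra.
pose N := (\max_(b <- finmap.enum_fset S) (E b).2)%N.
have [|x Qx|m hm] := htop_covering omega01 x0 (Y := subshift Q) (Yn := fun _ => setT) _
  (ltW (le_lt_trans h0 hh')) _ hh'2; [by []|by exists 0%N|].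
have hd : 0 < h' - h by rewrite subr_gt0.
(* The room h' - h pays for the number of neighbourhoods and for the 2m added coordinates. *)
have [n1 hn1] := nat_large (ln (size (finmap.enum_fset S)).+1%:R + 2 * m%:R * h + 1) hd.
have [n [nn [cnt [F [FY Fsep Fcnt]]]]] := hm (maxn N n1).+1.
have cnt0 : (0 < cnt)%N by rewrite -(ltr0n R); apply: lt_le_trans Fcnt; exact: expR_gt0.
pose n' := (m + (n + m))%N.
have n'0 : 0 < n'%:R :> R.
  by rewrite ltr0n /n'; move: nn; clear; lia.
have Nn' : (N <= n')%N.
  by rewrite /n'; have := leq_maxl N n1; move: nn; clear; lia.
pose F' (i : 'I_cnt) := shift (- m%:Z) (F i).
have QF' i : subshift Q (F' i) by apply: subshift_shift; case: (FY i).
pose T b := [set i : 'I_cnt | `|f n' (F' i) / n'%:R - b| < (E b).1]%SET.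
have cardT b : b \in finmap.enum_fset S -> (#|T b|)%:R <= expR (n'%:R * h).
  move=> bS; have [->|T0] := posnP #|T b|; first exact: expR_ge0.
  pose H c := oapp (fun i : 'I_#|T b| => F' (enum_val i)) x0 (insub c).
  have HE (i : 'I_#|T b|) : H (val i) = F' (enum_val i) by rewrite /H valK.
  rewrite -[leLHS]lnK ?posrE ?ltr0n// ler_expR.
  apply: ((hE b).2 n' _ H _ T0).
  - by apply: leq_trans Nn'; exact: (leq_bigmax_seq (F := fun b => (E b).2)).
  - move=> c cs; rewrite (HE (Ordinal cs)); split=> //.
    have := enum_valP (Ordinal cs); rewrite inE => hb.
    rewrite -[leRHS]mulrC -ler_pdivrMr//; apply: (le_trans _ (ltW hb)).
    rewrite -{2}(ger0_norm (ltW n'0)) -normrV ?unitfE ?gt_eqF// -normrM mulrBl.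
    by rewrite mulrAC mulfV ?gt_eqF// mul1r.
  - move=> c c' cc cc'; rewrite (HE (Ordinal cc)) (HE (Ordinal cc')).
    by move=> /window_shift/Fsep/enum_val_inj[].
have total : cnt%:R <= (size (finmap.enum_fset S))%:R * expR (n'%:R * h).
  have -> : cnt = (\sum_(i < cnt) 1)%N by rewrite sum1_card card_ord.
  apply: (@le_trans _ _ (\sum_(b <- finmap.enum_fset S) (#|T b|)%:R)); last first.
    rewrite big_seq (le_trans (ler_sum _ (fun b bS => cardT b bS)))//.
    by rewrite -big_seq big_const_seq count_predT iter_addr_0 [leRHS]mulr_natl.
  rewrite -natr_sum ler_nat.
  under [leqRHS]eq_bigr => b _ do rewrite -sum1_card big_mkcond/=.
  rewrite exchange_big/=; apply: leq_sum => i _.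
  have : `[(- Lam)%R, Lam]%classic (f n' (F' i) / n'%:R).
    rewrite /= in_itv/= -ler_norml normrM normfV normr_nat ler_pdivrMr//.
    exact: (gl_bound gl).
  move=> /cov [b /= bS hb]; rewrite (bigD1_seq b)//= ?finmap.fset_uniq// inE.
  by move: hb; rewrite in_itv/= -ltr_distl => ->.
have := le_trans Fcnt total; apply/negP; rewrite -ltNge.
have S0 : 0 < (size (finmap.enum_fset S)).+1%:R :> R by [].
apply: (@le_lt_trans _ _ ((size (finmap.enum_fset S)).+1%:R * expR (n'%:R * h))).
  by rewrite ler_wpM2r ?expR_ge0// ler_nat.
rewrite -[X in X * _](lnK (x := _)) ?posrE// -expRD ltr_expR.
have := hn1 n (leq_trans (leq_trans (leq_maxr _ _) (leqnSn _)) nn).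
rewrite /n' !natrD; set c1 := ln _; lra.
Qed.

End Families.

(** * Interleaving two kinds of blocks with prescribed frequencies *)

Section Schedule.
Variables (R : realType) (L1 L2 : nat -> nat) (t : R).
Hypothesis L1_gt0 : forall j, (0 < L1 j)%N.
Hypothesis L2_gt0 : forall j, (0 < L2 j)%N.
Hypothesis t01 : 0 <= t <= 1.

Let t0 : 0 <= t. Proof. by case/andP: t01. Qed.
Let t1 : t <= 1. Proof. by case/andP: t01. Qed.

Definition next_length kap := maxn (L1 kap) (L2 kap).

Record sched := Sched { level : nat; total : nat; part : nat }.

Definition first_kind x := (part x)%:R <= t * (total x)%:R.

Definition slot x := if first_kind x then L1 (level x) else L2 (level x).

Definition sched_next x :=
  let N := (total x + slot x)%N in
  Sched (if (next_length (level x).+1 * (level x).+1 <= N)%N then (level x).+1 else level x)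
    N (if first_kind x then part x + slot x else part x)%N.

(* Blocks of the current [level] are repeated until they are long compared to the
   blocks of the next one; the first kind is used exactly when its share of the
   total length does not exceed [t]. *)
Definition schedule j := iter j sched_next (Sched 0 0 0).

Let kap j := level (schedule j).
Let NN j := total (schedule j).
Let SS j := part (schedule j).
Let ell j := slot (schedule j).

Lemma schedule_totalS j : NN j.+1 = (NN j + ell j)%N.
Proof. by []. Qed.

Lemma schedule_partS j :
  SS j.+1 = (if first_kind (schedule j) then SS j + ell j else SS j)%N.
Proof. by []. Qed.

Lemma schedule_levelS j : kap j.+1 =
  if (next_length (kap j).+1 * (kap j).+1 <= NN j.+1)%N then (kap j).+1 else kap j.
Proof. by []. Qed.

Lemma slot_gt0 j : (0 < ell j)%N.
Proof. by rewrite /ell /slot; case: ifP. Qed.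

Lemma slot_le j : (ell j <= next_length (kap j))%N.
Proof. by rewrite /ell /slot /next_length; case: ifP; rewrite ?leq_maxl ?leq_maxr. Qed.

Lemma schedule_total_ge j : (j <= NN j)%N.
Proof.
by elim: j => // j IH; rewrite schedule_totalS -addn1 leq_add// slot_gt0.
Qed.

Lemma schedule_totalE j : NN j = (\sum_(i < j) ell i)%N.
Proof. by elim: j => [|j IH]; rewrite ?big_ord0// big_ord_recr/= -IH. Qed.

Lemma schedule_total_mono i j : (i <= j)%N -> (NN i <= NN j)%N.
Proof.
move=> /subnKC <-; elim: (j - i)%N => [|d IH]; first by rewrite addn0.
by rewrite addnS schedule_totalS (leq_trans IH)// leq_addr.
Qed.

(** The level rises only once the inequality holds for the new level, and totals only grow. A slot
    therefore occupies at most a fraction 1 / level of its past. *)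
Lemma schedule_level_total j : (next_length (kap j) * kap j <= NN j)%N.
Proof.
elim: j => [|j IH]; first by rewrite muln0.
rewrite schedule_levelS; case: ifP => // _.
by rewrite (leq_trans IH)// schedule_total_mono.
Qed.

Lemma schedule_level_mono i j : (i <= j)%N -> (kap i <= kap j)%N.
Proof.
move=> /subnKC <-; elim: (j - i)%N => [|d IH]; first by rewrite addn0.
by rewrite addnS schedule_levelS; case: ifP => // _; exact: leqW.
Qed.

Lemma schedule_level_unbounded K : exists J, forall j, (J <= j)%N -> (K <= kap j)%N.
Proof.
suff [J hJ] : exists J, (K <= kap J)%N.
  by exists J => j /schedule_level_mono; exact: leq_trans.
elim: K => [|K [J hJ]]; first by exists 0%N.
exists (maxn J (next_length K.+1 * K.+1)).+1; set j := maxn _ _.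
have Kj : (K <= kap j)%N by apply: leq_trans hJ (schedule_level_mono (leq_maxl _ _)).
move: Kj; rewrite leq_eqVlt => /orP[/eqP Kj|Kj]; last first.
  exact: leq_trans Kj (schedule_level_mono (leqnSn _)).
rewrite schedule_levelS -Kj ifT//; apply: leq_trans (schedule_total_ge _).
by apply: leqW; exact: leq_maxr.
Qed.

Lemma schedule_total_large (C d : R) : 0 < d ->
  exists J, forall j, (J <= j)%N -> C <= d * (NN j)%:R.
Proof.
move=> d0; have [J hJ] := nat_large C d0; exists J => j /hJ h.
by rewrite mulrC (le_trans h)// ler_pM2r// ler_nat schedule_total_ge.
Qed.

Lemma schedule_slot_small (d : R) : 0 < d ->
  exists J, forall j, (J <= j)%N -> (ell j)%:R <= d * (NN j)%:R.
Proof.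
move=> d0; have [K hK] := nat_large 1 d0.
have [J hJ] := schedule_level_unbounded K; exists J => j /hJ Kj.
have h1 := hK _ Kj.
apply: (@le_trans _ _ ((next_length (kap j))%:R * ((kap j)%:R * d))).
  by rewrite -[leLHS]mulr1 ler_pM// ler_nat slot_le.
rewrite mulrA [leRHS]mulrC ler_pM2r// -natrM ler_nat.
exact: schedule_level_total.
Qed.

(** A weighted Cesàro argument: the relative errors tend to 0 with the level, and the early blocks
    are outweighed by the total length. *)
Lemma schedule_error_small (d : R) : 0 < d -> exists J, forall j, (J <= j)%N ->
  \sum_(i < j) (ell i)%:R / (kap i).+1%:R <= d * (NN j)%:R.
Proof.
move=> d0; have d20 : 0 < d / 2 by rewrite divr_gt0.
have [K hK] := nat_large 1 d20.
have [J hJ] := schedule_level_unbounded K.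
have [J' hJ'] := schedule_total_large (NN J)%:R d20.
have bound j : \sum_(i < j) (ell i)%:R / (kap i).+1%:R <=
    (NN J)%:R + d / 2 * (NN j)%:R :> R.
  elim: j => [|j IH]; first by rewrite big_ord0 addr_ge0// mulr_ge0// ltW.
  have [jJ|Jj] := ltnP j J.
    apply: (@le_trans _ _ (NN j.+1)%:R); last first.
      rewrite -[leLHS]addr0 lerD ?ler_nat ?schedule_total_mono//.
      by rewrite mulr_ge0// ltW.
    rewrite schedule_totalE natr_sum; apply: ler_sum => i _.
    by rewrite ler_pdivrMr// ler_peMr// ler1n.
  rewrite big_ord_recr/= schedule_totalS natrD mulrDr addrA lerD//.
  rewrite ler_pdivrMr//; have h := hK _ (leqW (hJ _ Jj)).
  rewrite [leRHS](_ : _ = (ell j)%:R * ((kap j).+1%:R * (d / 2))); last by ring.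
  by rewrite ler_peMr.
exists J' => j /hJ' h; apply: (le_trans (bound j)); lra.
Qed.

(** The greedy rule moves the discrepancy towards 0 and overshoots by at most one slot, so it stays
    below the larger of its value at [J1] and the slot bound d * NN. *)
Lemma schedule_balance (d : R) : 0 < d -> exists J, forall j, (J <= j)%N ->
  `|(SS j)%:R - t * (NN j)%:R| <= d * (NN j)%:R.
Proof.
move=> d0; have [J1 h1] := schedule_slot_small d0.
have [J2 h2] := schedule_total_large `|(SS J1)%:R - t * (NN J1)%:R| d0.
pose M := `|(SS J1)%:R - t * (NN J1)%:R|.
have bound i : `|(SS (J1 + i))%:R - t * (NN (J1 + i))%:R| <=
    Num.max M (d * (NN (J1 + i))%:R).
  elim: i => [|i IH]; first by rewrite addn0 le_max lexx.
  rewrite addnS; set j := (J1 + i)%N.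
  have hl := h1 j (leq_addr _ _).
  have dN : d * (NN j)%:R <= d * (NN j.+1)%:R by rewrite ler_pM2l// ler_nat schedule_total_mono.
  have dl : (ell j)%:R <= d * (NN j.+1)%:R by exact: le_trans hl dN.
  have l0 : 0 <= (ell j)%:R :> R by [].
  have tl0 : 0 <= t * (ell j)%:R by rewrite mulr_ge0.
  have tl1 : t * (ell j)%:R <= (ell j)%:R by rewrite ler_piMl.
  have IH' : `|(SS j)%:R - t * (NN j)%:R| <= Num.max M (d * (NN j.+1)%:R).
    by rewrite (le_trans IH)// ge_max !le_max lexx/= dN orbT.
  have dl' : (ell j)%:R <= Num.max M (d * (NN j.+1)%:R) by rewrite le_max dl orbT.
  move: IH' dl'; set Y := Num.max _ _ => IH' dl'.
  rewrite schedule_partS schedule_totalS natrD.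
  case: ifPn => hk; move: hk; rewrite /first_kind -/(SS j) -/(NN j) -?ltNge => hk.
    rewrite natrD; move: IH'; rewrite !ler_norml => /andP[h3 h4]; apply/andP; split; lra.
  move: IH'; rewrite !ler_norml => /andP[h3 h4]; apply/andP; split; lra.
exists (maxn J1 J2) => j; rewrite geq_max => /andP[jJ1 jJ2].
have := bound (j - J1)%N; rewrite subnKC// => h; apply: (le_trans h).
by rewrite ge_max lexx andbT; exact: h2.
Qed.

End Schedule.

(** * Mixing two admissible pairs *)

Section Mixture.
Variables (R : realType) (q : nat) (Q : 'M[bool]_q) (omega : R).
Hypothesis omega01 : 0 < omega < 1.
Variables (f : nat -> biseq q -> R) (G : nat) (Lam D : R).
Hypothesis gl : glueable Q f G Lam D.

(** All gluing costs of a block are charged to it in advance: the G gap coordinates, the error [D]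
    and the factor G + 1 for the unknown offset. Large n absorbs them. *)
Lemma normalized_family alpha h : exponential_family Q f alpha h ->
  forall kap : nat, exists d : nat * nat * (nat -> biseq q),
  let n := d.1.1 in let s := d.1.2 in let F := d.2 in
  [/\ (0 < s)%N,
      forall c, (c < s)%N -> subshift Q (F c),
      forall c, (c < s)%N ->
        `|f n (F c) - (G + n)%:R * alpha| <= (G + n)%:R / kap.+1%:R - D,
      forall c c', (c < s)%N -> (c' < s)%N ->
        (forall l : nat, (l < n)%N -> F c l%:Z = F c' l%:Z) -> c = c' &
      (G + n)%:R * (h - kap.+1%:R^-1) <= ln s%:R - ln G.+1%:R].
Proof.
move=> fam kap; pose e : R := kap.+1%:R^-1 / 2.
have e0 : 0 < e by rewrite divr_gt0// invr_gt0.
have [n1 h1] := nat_large (G%:R * `|alpha| + D + G%:R * `|h| + ln G.+1%:R) e0.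
have [n [s [F [nn s0 FQ Fs Fc]]]] := fam e n1 e0.
have big := h1 n nn.
have D0 := gl_D gl.
have GR : 0 <= G%:R :> R by [].
have nR : 0 <= n%:R :> R by [].
have Ga : 0 <= G%:R * `|alpha| by rewrite mulr_ge0.
have Gh : 0 <= G%:R * `|h| by rewrite mulr_ge0.
have Ghh : G%:R * h <= G%:R * `|h| by rewrite ler_wpM2l// ler_norm.
have lnG : 0 <= ln G.+1%:R :> R by rewrite ln_ge0// ler1n.
have Ge : 0 <= G%:R * e by rewrite mulr_ge0// ltW.
have ke : kap.+1%:R^-1 = 2 * e :> R by rewrite /e mulrC divfK.
exists (n, s, F); split=> //=.
- by move=> c /FQ[].
- move=> c /FQ[_]; rewrite natrD ke; set u := f n _ => hu.
  have -> : u - (G%:R + n%:R) * alpha = (u - n%:R * alpha) - G%:R * alpha by ring.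
  apply: (le_trans (ler_normB _ _)); rewrite normrM normr_nat; lra.
- rewrite natrD ke; lra.
Qed.

Lemma mixture alpha beta h g t : 0 <= t <= 1 ->
  exponential_family Q f alpha h -> exponential_family Q f beta g ->
  let gam := t * alpha + (1 - t) * beta in
  growth_set Q f gam !=set0 /\
  ((t * h + (1 - t) * g)%:E <= htop Q omega (growth_set Q f gam))%E.
Proof.
move=> t01 fam1 fam2 gam.
have /choice [d1 hd1] := normalized_family fam1.
have /choice [d2 hd2] := normalized_family fam2.
pose L1 kap := (G + (d1 kap).1.1)%N.
pose L2 kap := (G + (d2 kap).1.1)%N.
have L10 j : (0 < L1 j)%N by rewrite addn_gt0 (gl_G gl).
have L20 j : (0 < L2 j)%N by rewrite addn_gt0 (gl_G gl).
pose st j := schedule L1 L2 t j.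
pose kap j := level (st j).
pose k1 j := first_kind t (st j).
pose dd j := if k1 j then d1 (kap j) else d2 (kap j).
pose nl j := (dd j).1.1; pose s j := (dd j).1.2; pose F j := (dd j).2.
pose al j := if k1 j then alpha else beta.
pose hh j := if k1 j then h else g.
pose ell j := (G + nl j)%N.
have slotE j : slot L1 L2 t (st j) = ell j.
  by rewrite /slot /ell /nl /dd -/(k1 j) -/(kap j) /L1 /L2; case: (k1 j).
have totE j : total_length G nl j = total (st j).
  by rewrite (schedule_totalE L1 L2 t) /total_length; apply: eq_bigr => i _; rewrite slotE.
pose a j := (ell j)%:R * al j.
(* With [D] already subtracted from each block, the j + 1 gluing errors leave a single [D] in
   [asymp_val]. *)
pose e j := (ell j)%:R / (kap j).+1%:R - D.
have ok j : [/\ (0 < s j)%N, forall c, (c < s j)%N -> subshift Q (F j c),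
    forall c, (c < s j)%N -> `|f (nl j) (F j c) - a j| <= e j,
    forall c c', (c < s j)%N -> (c' < s j)%N ->
        (forall l : nat, (l < nl j)%N -> F j c l%:Z = F j c' l%:Z) -> c = c' &
    (ell j)%:R * (hh j - (kap j).+1%:R^-1) <= ln (s j)%:R - ln G.+1%:R].
  rewrite /a /e /ell /nl /s /F /dd /al /hh; case: (k1 j); [exact: hd1|exact: hd2].
have s0 j : (0 < s j)%N by case: (ok j).
have F_Q j c : (c < s j)%N -> subshift Q (F j c) by case: (ok j) => _ h1 _ _ _; exact: h1.
have F_val j c : (c < s j)%N -> `|f (nl j) (F j c) - a j| <= e j.
  by case: (ok j) => _ _ h1 _ _; exact: h1.
have F_sep j c c' : (c < s j)%N -> (c' < s j)%N ->
    (forall l : nat, (l < nl j)%N -> F j c l%:Z = F j c' l%:Z) -> c = c'.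
  by case: (ok j) => _ _ _ h1 _; exact: h1.
have F_ent j : (ell j)%:R * (hh j - (kap j).+1%:R^-1) <= ln (s j)%:R - ln G.+1%:R.
  by case: (ok j).
pose N j : R := (total (st j))%:R; pose S j : R := (part (st j))%:R.
have NS j : N j.+1 = N j + (ell j)%:R.
  by rewrite /N /st schedule_totalS natrD -/(st j) slotE.
have SS j : S j.+1 = if k1 j then S j + (ell j)%:R else S j.
  by rewrite /S /st schedule_partS -/(st j) slotE -/(k1 j); case: (k1 j); rewrite ?natrD.
(* [S] is the length occupied by the first kind; exponent and entropy sums thus equal the desired
   mixture times [N] plus a multiple of the discrepancy S - t N. *)
have sum_mix (u v : R) j : \sum_(i < j) (ell i)%:R * (if k1 i then u else v) =
    u * S j + v * (N j - S j).
  elim: j => [|j IH]; first by rewrite big_ord0 /S /N /st /=; ring.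
  by rewrite big_ord_recr/= IH NS SS; case: (k1 j); ring.
have err_small (d : R) : 0 < d -> exists J, forall j, (J <= j)%N ->
    \sum_(i < j) (ell i)%:R / (kap i).+1%:R <= d * N j.
  move=> dp; have [J hJ] := schedule_error_small t L10 L20 dp.
  exists J => j /hJ; apply: le_trans; apply: ler_sum => i _.
  by rewrite -/(st i) slotE.
have N0 j : 0 <= N j by [].
have bal (C d : R) : 0 < d -> exists J, forall j, (J <= j)%N ->
    `|C * (S j - t * N j)| <= d * N j.
  move=> dp; have C1 : 0 < `|C| + 1 by rewrite ltr_wpDl.
  have [J hJ] := schedule_balance L10 L20 t01 (divr_gt0 dp C1).
  exists J => j /hJ; rewrite normrM -/(S j) -/(N j) => hb.
  apply: (@le_trans _ _ (`|C| * (d / (`|C| + 1) * N j))); first by rewrite ler_wpM2l.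
  rewrite mulrA ler_wpM2r// mulrA ler_pdivrMr// mulrC ler_wpM2l ?(ltW dp)//.
  by rewrite lerDl.
have asymp_len d : 0 < d -> exists J, forall j, (J <= j)%N ->
    (ell j)%:R <= d * (total_length G nl j)%:R :> R.
  move=> dp; have [J hJ] := schedule_slot_small t L10 L20 dp.
  by exists J => j /hJ; rewrite totE -/(st j) slotE.
have asymp_val d : 0 < d -> exists J, forall j, (J <= j)%N ->
    `|\sum_(i < j) a i - gam * (total_length G nl j)%:R| + \sum_(i < j) e i + D * j.+1%:R
      <= d * (total_length G nl j)%:R.
  move=> dp; have d3 : 0 < d / 3 by rewrite divr_gt0.
  have [J1 h1] := err_small _ d3.
  have [J2 h2] := bal (alpha - beta) _ d3.
  have [J3 h3] := schedule_total_large t L10 L20 D d3.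
  exists (maxn J1 (maxn J2 J3)) => j; rewrite !geq_max => /and3P[j1 j2 j3].
  rewrite totE -/(N j) /a sum_mix.
  have -> : alpha * S j + beta * (N j - S j) - gam * N j = (alpha - beta) * (S j - t * N j).
    by rewrite /gam; ring.
  have -> : \sum_(i < j) e i = \sum_(i < j) (ell i)%:R / (kap i).+1%:R - D * j%:R.
    by rewrite /e sumrB sumr_const card_ord mulr_natr.
  rewrite -addn1 natrD; have := h1 j j1; have := h2 j j2; have := h3 j j3.
  by rewrite -/(st j) -/(N j); lra.
have asymp_ent d : 0 < d -> exists J, forall j, (J <= j)%N ->
    (t * h + (1 - t) * g - d) * (total_length G nl j)%:R <=
    \sum_(i < j) (ln (s i)%:R - ln G.+1%:R).
  move=> dp; have d2' : 0 < d / 2 by rewrite divr_gt0.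
  have [J1 h1] := err_small _ d2'.
  have [J2 h2] := bal (h - g) _ d2'.
  exists (maxn J1 J2) => j; rewrite !geq_max => /andP[j1 j2].
  rewrite totE -/(N j).
  apply: (@le_trans _ _ (\sum_(i < j) (ell i)%:R * (hh i - (kap i).+1%:R^-1))); last first.
    by apply: ler_sum => i _; exact: F_ent.
  under eq_bigr => i _ do rewrite mulrBr.
  rewrite sumrB sum_mix.
  have := h1 j j1; have := h2 j j2; rewrite ler_norml => /andP[h3 _]; move: h3.
  have -> : h * S j + g * (N j - S j) = (t * h + (1 - t) * g) * N j + (h - g) * (S j - t * N j).
    by ring.
  by move: (\sum_(i < j) _) => E; lra.
have /choice [stg hstg] : forall xynm : biseq q * biseq q * nat * nat, exists wg : biseq q * nat,
    subshift Q xynm.1.1.1 -> subshift Q xynm.1.1.2 ->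
    [/\ subshift Q wg.1, (wg.2 <= G)%N, forall i, i < xynm.1.2%:Z -> wg.1 i = xynm.1.1.1 i,
        forall i, 0 <= i -> wg.1 (xynm.1.2%:Z + wg.2%:Z + i) = xynm.1.1.2 i &
        `|f (xynm.1.2 + (G + xynm.2))%N wg.1 - f xynm.1.2 xynm.1.1.1 - f xynm.2 xynm.1.1.2| <= D].
  move=> [[[x y] n] m] /=.
  have [Qx|nQx] := pselect (subshift Q x); last by exists (x, 0%N).
  have [Qy|nQy] := pselect (subshift Q y); last by exists (x, 0%N).
  by have [w [g' hw]] := gl_step gl n m Qx Qy; exists (w, g').
have stP x y n m (Qx : subshift Q x) (Qy : subshift Q y) := hstg (x, y, n, m) Qx Qy.
split.
  exact: (moran_nonempty gl s0 F_Q F_val asymp_val asymp_len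
    (st := fun z => (stg z).1) (gp := fun z => (stg z).2) stP).
exact: (moran_htop omega01 gl s0 F_Q F_sep F_val asymp_val asymp_len asymp_ent
    (st := fun z => (stg z).1) (gp := fun z => (stg z).2) stP).
Qed.

End Mixture.

(** * Logarithmic norms of the cocycle as a glueable sequence *)

Section CocycleGlueable.
Variables (R : realType) (q k : nat) (Q : 'M[bool]_q).
Variables (A : biseq q -> 'M[R]_k) (CA C rho theta : R).
Hypothesis reg : regular Q A CA C rho theta.
Hypothesis k_gt0 : (0 < k)%N.

Let CA1 : 1 <= CA := reg_CA reg.
Let CA0 : 0 < CA := lt_le_trans ltr01 CA1.

Lemma cnorm_gt0 n x : subshift Q x -> 0 < cnorm A n x.
Proof. by move=> Qx; apply: opnorm_unit_gt0 => //; exact: (cocycle_unit reg). Qed.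

Lemma ln_close (a b K : R) : 0 < a -> 0 < b -> 0 < K -> a <= K * b -> b <= K * a ->
  `|ln a - ln b| <= ln K.
Proof.
move=> a0 b0 K0 h1 h2; rewrite ler_norml; apply/andP; split.
  rewrite lerNl opprB lerBlDr -lnM ?posrE// ler_ln ?posrE// ?mulr_gt0//.
by rewrite lerBlDr -lnM ?posrE// ler_ln ?posrE ?mulr_gt0.
Qed.

Lemma ln_close_expn (a b : R) n : 0 < a -> 0 < b ->
  a <= CA ^+ n * b -> b <= CA ^+ n * a -> `|ln a - ln b| <= ln CA * n%:R.
Proof.
by move=> a0 b0 h1 h2; rewrite mulr_natr -lnXn// ln_close// exprn_gt0.
Qed.

Lemma opnorm1_ge : 1 <= opnorm (1%:M : 'M[R]_k).
Proof.
have p := opnorm_unit_gt0 k_gt0 (unitmx1 R k).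
by rewrite -(ler_pM2l p) mulr1 -{1}(mulmx1 (1%:M : 'M[R]_k)) opnormM.
Qed.

Lemma cocycle_glueable : quasi_multiplicative Q A ->
  exists G Lam D, glueable Q (fun n x => ln (cnorm A n x)) G Lam D.
Proof.
(* The successor makes G positive, so that no slot is empty. *)
move=> [G0 [c [c0 qm]]]; pose G := G0.+1.
have Kd1 := Kd_ge1 reg; have Kd0 : 0 < Kd CA C theta by exact: lt_le_trans ltr01 Kd1.
have CAp n : 0 < CA ^+ n by rewrite exprn_gt0.
have Qs n x : subshift Q x -> subshift Q (shift n x) by exact: subshift_shift.
have cp n x (Qx : subshift Q x) := cnorm_gt0 n Qx.
have up n m x : subshift Q x -> cnorm A (n + m) x <= CA ^+ m * cnorm A n x.
  move=> Qx; rewrite mulrC (le_trans (cnorm_add _ _ _ _))// ler_wpM2l ?cnorm_ge0//.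
  exact: (cnorm_le reg _ (Qs _ _ Qx)).
have upl n m x : subshift Q x -> cnorm A (n + m) x <= CA ^+ n * cnorm A m (shift n%:Z x).
  move=> Qx; rewrite (le_trans (cnorm_add _ _ _ _))// ler_wpM2r ?cnorm_ge0//.
  exact: (cnorm_le reg _ Qx).
(* One constant for three estimates: the first summand is the distortion in [gl_past], the other two
   bound the gluing error from below and from above, with CA^G for adjusting the length of the
   gap. *)
pose K := Kd CA C theta + (c^-1 * CA ^+ G + CA ^+ G * CA ^+ G * (Kd CA C theta * Kd CA C theta)).
have P1 : 0 <= c^-1 * CA ^+ G by rewrite mulr_ge0// ltW// invr_gt0.
have P2 : 0 <= CA ^+ G * CA ^+ G * (Kd CA C theta * Kd CA C theta) by rewrite !mulr_ge0// ltW.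
have K1 : 1 <= K by rewrite /K -[leLHS]addr0 lerD// addr_ge0.
have K0 : 0 < K by exact: lt_le_trans K1.
exists G, (ln CA), (ln K); split.
- by [].
- exact: ln_ge0.
- exact: ln_ge0.
- move=> x n Qx; rewrite -[ln (cnorm _ _ _)]subr0 -ln1.
  apply: ln_close_expn => //; first exact: cp.
    by rewrite mulr1; exact: (cnorm_le reg).
  by apply: le_trans (cnorm_le_addr reg 0 n Qx); exact: opnorm1_ge.
- move=> x n m Qx; apply: ln_close_expn; try exact: cp.
    exact: up.
  exact: (cnorm_le_addr reg).
- move=> x n m Qx; apply: ln_close_expn; try exact: cp.
  + exact/cp/Qs.
  + exact: upl.
  + exact: (cnorm_le_addl reg).
- move=> x y n Qx Qy h; apply: ln_close => //; try exact: cp.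
    apply: (le_trans (cnorm_past reg Qx Qy h)); rewrite mulrC ler_wpM2r ?cnorm_ge0//.
    by rewrite /K lerDl addr_ge0.
  apply: (le_trans (cnorm_past reg Qy Qx _)); first by move=> i hi; rewrite h.
  by rewrite mulrC ler_wpM2r ?cnorm_ge0// /K lerDl addr_ge0.
- move=> x y n m Qx Qy; have [w [g [Qw gG wx wy hw]]] := qm x y n m Qx Qy.
  exists w, g; split=> //; first exact: leqW.
  have a0 := cp n x Qx; have b0 := cp m y Qy.
  rewrite -addrA -opprD -lnM ?posrE//.
  apply: ln_close; rewrite ?mulr_gt0//; first exact: cp.
  + have -> : (n + (G + m) = (n + g + m) + (G - g))%N by rewrite /G; move: gG; clear; lia.
    apply: (le_trans (up _ _ _ Qw)).
    have h1 : cnorm A (n + g + m) w <= cnorm A (n + g) w * cnorm A m (shift (n + g)%N%:Z w).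
      exact: cnorm_add.
    have h2 := up n g w Qw.
    have h3 : cnorm A n w <= cnorm A n x * Kd CA C theta by apply: (cnorm_past reg).
    have h4 : cnorm A m (shift (n + g)%N%:Z w) <= cnorm A m y * Kd CA C theta.
      apply: (cnorm_future reg) => //; first exact: Qs.
      by move=> i hi; rewrite /Defs.shift addrC PoszD wy.
    apply: (@le_trans _ _ (CA ^+ G * (CA ^+ G * (cnorm A n x * Kd CA C theta) * (cnorm A m y * Kd CA C theta)))).
      rewrite ler_pM ?cnorm_ge0 ?(ltW (CAp _))//.
        by rewrite ler_weXn2l// leq_subr.
      apply: (le_trans h1); rewrite ler_pM ?cnorm_ge0//.
      apply: (le_trans h2); rewrite ler_pM ?cnorm_ge0 ?(ltW (CAp _))//.
      by rewrite ler_weXn2l// leqW.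
    rewrite (_ : _ * (_ * _) = (CA ^+ G * CA ^+ G * (Kd CA C theta * Kd CA C theta)) *
      (cnorm A n x * cnorm A m y)); last by ring.
    rewrite ler_wpM2r ?mulr_ge0 ?cnorm_ge0//.
    by rewrite /K addrA lerDr addr_ge0// ltW.
  + have hd : cnorm A (n + g + m) w <= CA ^+ G * cnorm A (n + (G + m)) w.
      have -> : (n + (G + m) = (n + g + m) + (G - g))%N by rewrite /G; move: gG; clear; lia.
      apply: (le_trans (cnorm_le_addr reg _ (G - g) Qw)).
      by rewrite ler_wpM2r ?cnorm_ge0// ler_weXn2l// leq_subr.
    have : cnorm A n x * cnorm A m y <= c^-1 * (CA ^+ G * cnorm A (n + (G + m)) w).
      by rewrite ler_pdivlMl//; exact: le_trans hw hd.
    move=> /le_trans; apply; rewrite mulrA ler_wpM2r ?cnorm_ge0//.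
    by rewrite /K addrCA lerDl addr_ge0// ltW.
Qed.

Lemma level_setE : level_set Q A = growth_set Q (fun n x => ln (cnorm A n x)).
Proof.
have E x : (fun n : nat => n%:R^-1 * ln (opnorm (cocycle A n%:Z x))) =
    (fun n : nat => n%:R^-1 * ln (cnorm A n x)).
  by apply: funext => n; rewrite cocycle_fwd.
apply: funext => alpha; apply/seteqP; split=> x [Qx hx]; (split; first exact: Qx).
  exact: (eq_ind _ (fun u : nat -> R => u @ \oo --> alpha) hx _ (E x)).
exact: (eq_ind _ (fun u : nat -> R => u @ \oo --> alpha) hx _ (esym (E x))).
Qed.

End CocycleGlueable.

(** Entropies are handled as extended reals, so the inequality is tested on reals strictly below
    both; -1 is such a real below any nonnegative value. *)
Lemma ereal_mix_le (R : realType) (x y z : \bar R) (t : R) :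
  0 < t -> 0 < 1 - t -> (0 <= x)%E -> (0 <= y)%E ->
  (forall c d : R, (c%:E < x)%E -> (d%:E < y)%E -> ((t * c + (1 - t) * d)%:E <= z)%E) ->
  (t%:E * x + (1 - t)%:E * y <= z)%E.
Proof.
move=> tp sp x0 y0 mix.
have N1 : ((-1)%:E < 0%E :> \bar R)%E by rewrite lte_fin oppr_lt0.
have infty : (forall M : R, (M%:E <= z)%E) -> (t%:E * x + (1 - t)%:E * y <= z)%E.
  by move=> hM; rewrite [leRHS](_ : _ = +oo%E); [exact: leey|exact: eq_infty].
case: x x0 mix infty => [u| |] // x0 mix infty; last first.
  apply: infty => M; have := mix ((M - (1 - t) * -1) / t) (-1).
  rewrite mulrCA mulfV ?gt_eqF// mulr1 subrK; apply; first exact: ltry.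
  exact: lt_le_trans N1 y0.
case: y y0 mix infty => [v| |] // y0 mix infty; last first.
  apply: infty => M; have := mix (-1) ((M - t * -1) / (1 - t)).
  rewrite [(1 - t) * _]mulrCA mulfV ?gt_eqF// mulr1 [t * -1 + _]addrC subrK; apply.
    exact: lt_le_trans N1 x0.
  exact: ltry.
apply/lee_addgt0Pr => e e0.
rewrite -!EFinM -EFinD -leeBlDr// -EFinB.
rewrite (_ : _ - e = t * (u - e) + (1 - t) * (v - e)); last by ring.
by apply: mix; rewrite lte_fin gtrBl.
Qed.

(** * The spectrum: closure formula and concavity *)

Section Spectrum.
Variables (R : realType) (q : nat) (Q : 'M[bool]_q) (omega : R).
Hypothesis omega01 : 0 < omega < 1.
Variables (f : nat -> biseq q -> R) (G : nat) (Lam D : R).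
Hypothesis gl : glueable Q f G Lam D.
Variable x0 : biseq q.

Let E := growth_set Q f.
Let h alpha := htop Q omega (E alpha).
Let L : set R := [set alpha | exists x, E alpha x].

Lemma spectrum_family alpha (c : R) : L alpha -> (c%:E < h alpha)%E ->
  exponential_family Q f alpha c.
Proof.
move=> [x Ex] ch; have [c0|c0] := leP 0 c; first exact: (htop_family omega01 gl x0).
move=> e N e0; have [n [s [F [h1 h2 h3 h4 h5]]]] := growth_family Ex N e0.
exists n, s, F; split=> //; apply: le_trans h5.
by rewrite ler_wpM2l// lerD2r ltW.
Qed.

Lemma spectrum_mix alpha beta t : L alpha -> L beta -> 0 <= t <= 1 ->
  L (t * alpha + (1 - t) * beta).
Proof.
move=> [x /growth_family fx] [y /growth_family fy] t01.
by have [[z Ez] _] := mixture omega01 gl t01 fx fy; exists z.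
Qed.

Lemma spectrum_closure : (0 < htop Q omega (subshift Q))%E ->
  L = closure [set alpha | (0 < h alpha)%E].
Proof.
move=> htop0.
have [h0 h00 h0lt] : exists2 h0 : R, 0 < h0 & (h0%:E < htop Q omega (subshift Q))%E.
  case: (htop _ _ _) htop0 => [u| |] //; last by exists 1; rewrite ?ltry.
  by rewrite lte_fin => hu; exists (u / 2); rewrite ?lte_fin; lra.
have [beta fbeta] := htop_subshift_family omega01 gl x0 (ltW h00) h0lt.
apply/seteqP; split=> [alpha [x Ex] B /nbhs_ballP [e /= e0 eB]|alpha cl].
  pose K := `|beta - alpha| + 1.
  have K0 : 0 < K by rewrite ltr_wpDl.
  (* The share of the positive-entropy family is small enough to move the exponent by at most e /
     2. *)
  pose t := Num.min 1 (e / 2 / K).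
  have t0 : 0 < t by rewrite lt_min ltr01/= !divr_gt0.
  have t1 : t <= 1 by rewrite ge_min lexx.
  have t01 : 0 <= t <= 1 by rewrite t1 ltW.
  have [_ hm] := mixture omega01 gl t01 fbeta (growth_family Ex).
  exists (t * beta + (1 - t) * alpha); split.
    apply: lt_le_trans hm; rewrite lte_fin mulr0 addr0; exact: mulr_gt0.
  apply: eB; rewrite -ball_normE /=.
  have -> : alpha - (t * beta + (1 - t) * alpha) = - (t * (beta - alpha)) by ring.
  rewrite normrN normrM (ger0_norm (ltW t0)).
  apply: (@le_lt_trans _ _ (t * K)); first by rewrite ler_wpM2l ?(ltW t0)// lerDl.
  apply: (@le_lt_trans _ _ (e / 2)); last by lra.
  by rewrite -ler_pdivlMr// ge_min lexx orbT.
(* Exponents near alpha supply words approximating alpha itself; mixing this family with itself then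
   realizes alpha exactly. *)
have fam : exponential_family Q f alpha 0.
  move=> e N e0; have e20 : 0 < e / 2 by rewrite divr_gt0.
  have [gam [hgam bgam]] := cl _ (nbhsx_ballx alpha _ e20).
  have [n [s [F [h1 h2 h3 h4 h5]]]] := htop_family omega01 gl x0 (lexx 0) hgam N e20.
  exists n, s, F; split=> //; last first.
    by apply: le_trans h5; rewrite ler_wpM2l// !sub0r lerN2; lra.
  move=> c /h3 [Qc hc]; split=> //.
  move: bgam; rewrite -ball_normE /= distrC => /ltW bgam.
  rewrite (_ : _ - _ = (f n (F c) - n%:R * gam) + n%:R * (gam - alpha)); last by ring.
  rewrite (le_trans (ler_normD _ _))// normrM normr_nat.
  apply: (le_trans (lerD hc (ler_wpM2l _ bgam))) => //.
  by rewrite -mulrDr -splitr.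
have t01 : 0 <= (1 : R) <= 1 by rewrite ler01 lexx.
have [[x Ex] _] := mixture omega01 gl t01 fam fam.
by exists x; move: Ex; rewrite subrr mul0r addr0 mul1r.
Qed.

Lemma spectrum_entropy alpha beta t : L alpha -> L beta -> 0 <= t <= 1 ->
  (t%:E * h alpha + (1 - t)%:E * h beta <= h (t * alpha + (1 - t) * beta)%R)%E.
Proof.
move=> La Lb t01; have /andP[t0 t1] := t01.
have mix (c d : R) : (c%:E < h alpha)%E -> (d%:E < h beta)%E ->
    ((t * c + (1 - t) * d)%:E <= h (t * alpha + (1 - t) * beta)%R)%E.
  move=> hc hd.
  by have [] := mixture omega01 gl t01 (spectrum_family La hc) (spectrum_family Lb hd).
(* The endpoints are separate because the test values in [ereal_mix_le] involve division by t and 1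
   - t. *)
have [t00|tn0] := eqVneq t 0.
  by rewrite t00 mul0e add0e subr0 mul1e mul0r add0r mul1r.
have [t11|tn1] := eqVneq t 1.
  by rewrite t11 subrr mul0e adde0 mul1e mul0r addr0 mul1r.
have tp : 0 < t by rewrite lt_neqAle eq_sym tn0.
have sp : 0 < 1 - t by rewrite subr_gt0 lt_neqAle tn1.
by apply: ereal_mix_le mix; rewrite ?tp ?sp// htop_ge0.
Qed.

(** A point near the convex combination is the same combination of both endpoints translated by one
    common small amount. *)
Lemma spectrum_interior_convex : convex_set (L° : set R^o).
Proof.
apply/convex_setW => a b /set_mem La /set_mem Lb l l0 l1; apply/mem_set.
have /nbhs_ballP [e1 /= e10 h1] := La.
have /nbhs_ballP [e2 /= e20 h2] := Lb.
apply/nbhs_ballP; exists (Num.min e1 e2) => /=; first by rewrite lt_min e10.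
have cE : conv l a b = l%:num * a + (1 - l%:num) * b :> R by [].
move=> c; rewrite -ball_normE /= cE => hc.
set t := l%:num in hc l0 l1 *.
pose d := c - (t * a + (1 - t) * b).
have hd : `|d| < Num.min e1 e2 by rewrite /d distrC.
have -> : c = t * (a + d) + (1 - t) * (b + d) by rewrite /d; ring.
move: hd; rewrite lt_min => /andP[d1 d2].
apply: spectrum_mix; last by rewrite !ltW.
  by apply: h1; rewrite -ball_normE /= opprD addrA subrr sub0r normrN.
by apply: h2; rewrite -ball_normE /= opprD addrA subrr sub0r normrN.
Qed.

End Spectrum.

Unset Implicit Arguments.

Theorem theoremA (R : realType) (q k : nat) (Q : 'M[bool]_q) (omega r : R)
    (A : biseq q -> 'M[R]_k)
    (k_gt0 : (0 < k)%N) (omega01 : 0 < omega < 1) (r_gt0 : 0 < r)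
    (mixing : top_mixing Q omega)
    (htop_gt0 : (0 < htop Q omega (subshift Q))%E)
    (typA : typical Q omega r A) :
  lyap_spectrum Q A =
    closure [set alpha : R | (0 < htop Q omega (level_set Q A alpha))%E] /\
  concave_on (lyap_spectrum Q A)°
    (fun alpha : R => htop Q omega (level_set Q A alpha)).
Proof.
(* [p] only fills in default values for partially defined families of points. *)
have [_ [p _]] := typA.
have [CA [C [theta [reg qm]]]] :=
  typical_quasi_multiplicative k_gt0 omega01 r_gt0 mixing typA.
have [G [Lam [D gl]]] := cocycle_glueable reg k_gt0 qm.
rewrite /lyap_spectrum level_setE; split; first exact: (spectrum_closure omega01 gl p htop_gt0).
split; first exact: (spectrum_interior_convex omega01 gl).
move=> a b t /interior_subset La /interior_subset Lb t01.
exact: (spectrum_entropy omega01 gl p La Lb t01).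
Qed.
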